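(* Let $\mathbf{k}$ be a field of characteristic $\ne2$, $p$ a positive integer such that $\mathrm{Cl}_p$ is isomorphic to a matrix superalgebra, and $q$ an integer divisible by $p$ and by $4$ ($q=0$ allowed). Let $\mathcal A$ be a nice monoidal $\mathbb{Z}/q$-supercategory, $\beta_{A,B}:A\otimes B\to B\otimes A$ a natural isomorphism on $\mathcal A$, and $\beta'$ the induced isomorphism on the Clifford eversion $\mathrm{Cl}(\mathcal A)$. (a) If $\beta$ is a symmetry (or braiding) with respect to an even S-factor system $\omega$, then $\beta'$ is a type II supersymmetry (or superbraiding) with respect to $\mathtt D\mathtt A\omega$. (b) If $\beta$ is a type II supersymmetry (or superbraiding) with respect to an odd S-factor system $\omega$, then $\beta'$ is a symmetry (or braiding) with respect to $\mathtt A\omega$.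
   Context: Factor systems. For $e\in\mathbb{Z}/2$, a B-factor system of parity $e$ is a pair of functions $\omega_1,\omega_2:(\mathbb{Z}/q)^3\to\mathbf{k}^\times$ with, for all $a,b,c,d$: $\omega_1(a;b,c)\omega_1(a;b+c,d)=\omega_1(a;b,c+d)\omega_1(a;c,d)$; $\omega_2(a+b,c;d)\omega_2(a,b;d)=\omega_2(b,c;d)\omega_2(a,b+c;d)$; $\omega_1(b;c,d)\omega_1(a;c,d)\omega_1(a+b;c,d)^{-1}=(-1)^{abcd\,e}\omega_2(a,b;c)\omega_2(a,b;d)\omega_2(a,b;c+d)^{-1}$; $\omega_1(a;b,c)\omega_1(a;c,b)^{-1}=\omega_2(b,a;c)\omega_2(a,b;c)^{-1}$. An S-factor system of parity $e$ is a triple $(\omega_1,\omega_2,\omega_\sharp)$ with $(\omega_1,\omega_2)$ a B-factor system of parity $e$ and $\omega_\sharp:(\mathbb{Z}/q)^2\to\mathbf{k}^\times$ satisfying $\omega_1(a;b,c)\omega_2(b,c;a)=\omega_\sharp(a,b)\omega_\sharp(a,c)\omega_\sharp(a,b+c)^{-1}$ and $\omega_1(c;a,b)\omega_2(a,b;c)=\omega_\sharp(a,c)\omega_\sharp(b,c)\omega_\sharp(a+b,c)^{-1}$. Even means $e=0$, odd means $e=1$. Products are componentwise. $\mathtt A$ (odd): $\mathtt A_1=1$, $\mathtt A_2(a,b;c)=(-1)^{\binom c2ab}$, $\mathtt A_\sharp(a,b)=(-1)^{\binom a2\binom b2}$ (well defined as $4\mid q$). $\mathtt D$ (even): $\mathtt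 D_1(r;s,t)=\mathtt D_2(r,s;t)=(-1)^{rst}$, $\mathtt D_\sharp(r,s)=(-1)^{rs}$. Supercategories. A supercategory is a category enriched in $\mathbb{Z}/2$-graded vector spaces; $|f|$ is the parity. A $\mathbb{Z}/q$-supercategory is a family $(\mathcal A_i)_{i\in\mathbb{Z}/q}$ of supercategories, objects of $\mathcal A_i$ having degree $i$. In a monoidal one, $\otimes$ adds degrees, $(f'\otimes g')(f\otimes g)=(-1)^{|f||g'|}f'f\otimes g'g$, and there are even associators $\alpha_{X,Y,Z}:X\otimes(Y\otimes Z)\to(X\otimes Y)\otimes Z$ and unitors satisfying the pentagon and triangle axioms. Nice: each piece has finite direct sums, images of even idempotents, and every object $X$ admits an odd isomorphism to some object $\Pi(X)$. Braidings. For isomorphisms $\beta_{A,B}:A\otimes B\to B\otimes A$ (homogeneous $A,B$) consider (H1) $(1_B\otimes\beta_{A,C})\alpha_{B,A,C}^{-1}(\beta_{A,B}\otimes1_C)=\omega_1(|A|;|B|,|C|)\,\alpha_{B,C,A}^{-1}\beta_{A,B\otimes C}\alpha_{A,B,C}^{-1}$; (H2) $(\beta_{A,C}\otimes1_B)\alpha_{A,C,B}(1_A\otimes\beta_{B,C})=\omega_2(|A|,|B|;|C|)\,\alpha_{C,A,B}\beta_{A\otimes B,C}\alpha_{A,B,C}$; (S) $\beta_{B,A}\beta_{A,B}=\omega_\sharp(|A|,|B|)\mathrm{id}$. Braiding w.r.t. $\omega$: all $\beta_{A,B}$ even, $(g\otimes f)\beta=(-1)^{|f||g|}\beta(f\otimes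 g)$, (H1), (H2). Symmetry: also (S). Type II superbraiding w.r.t. $\omega$: $\beta_{A,B}$ of parity $|A||B|$, $(g\otimes f)\beta=(-1)^{|A||B|(|f|+|g|)+|f||g|}\beta(f\otimes g)$ for $f:A\to A'$, $g:B\to B'$, (H1), (H2). Type II supersymmetry: also (S). (Braidings and superbraidings involve only the underlying B-factor system $(\omega_1,\omega_2)$.) Spin-symmetric groups. $\tilde{\mathfrak S}_n$: generators $\tilde s_1,\dots,\tilde s_{n-1},c$; $c$ central, $c^2=1$, $\tilde s_i^2=1$, $\tilde s_i\tilde s_{i+1}\tilde s_i=\tilde s_{i+1}\tilde s_i\tilde s_{i+1}$, $\tilde s_i\tilde s_j=c\tilde s_j\tilde s_i$ ($|i-j|\ge2$); it surjects onto $\mathfrak S_n$ via $\tilde s_i\mapsto(i\ i{+}1)$, $c\mapsto1$, and has the parity of the image permutation. $\tilde\tau_{n,m}=\tilde\sigma_{n,m}\cdots\tilde\sigma_{n,1}\in\tilde{\mathfrak S}_{n+m}$, $\tilde\sigma_{n,i}=\tilde s_i\cdots\tilde s_{i+n-1}$. Clifford eversion. $\mathrm{Cl}_n$: odd generators $\alpha_1,\dots,\alpha_n$, $\alpha_i^2=2$, $\alpha_i\alpha_j=-\alpha_j\alpha_i$ ($i\ne j$). $\mathrm{Cl}_n(\mathcal C)$: objects $(M;\alpha_1,\dots,\alpha_n)$ with $M\in\mathcal C$ and odd endomorphisms satisfying these relations, morphisms of parity $e$ satisfying $f\alpha_i=(-1)^e\alpha_if$. $\tilde{\mathfrak S}_n$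 acts on $M$ by $\tilde s_i\mapsto\frac12(\alpha_{i+1}-\alpha_i)$, $c\mapsto-1$, and $\sigma$ gives an isomorphism $(M;\alpha_\bullet)\to(M;\alpha_{\sigma(1)},\dots,\alpha_{\sigma(n)})$ of parity $|\sigma|$. $U_p$ is a $\mathrm{Cl}_p$-module such that $V\mapsto V\otimes U_p$ is an equivalence from super vector spaces to $\mathrm{Cl}_p$-modules. $\mathrm{Cl}_{(i;p)}(\mathcal C)$ is the $2$-colimit of $\mathrm{Cl}_n(\mathcal C)$, $n\ge0$, $n\equiv i\bmod p$, along the equivalences $M\mapsto M\otimes U_p$ (new generators appended last). $\mathrm{Cl}(\mathcal A)_i=\mathrm{Cl}_{(i;p)}(\mathcal A_i)$, with product $(M;\mu_1,\dots,\mu_{r})\otimes(N;\nu_1,\dots,\nu_{s})=(M\otimes N;\mu_\bullet\otimes1,1\otimes\nu_\bullet)$ (blocks of generators of $U_p$ moved to the end with the corresponding $\tilde\tau$ elements). $\beta'$ is the composite $(M\otimes N;\mu_\bullet,\nu_\bullet)\xrightarrow{\beta_{M,N}}(N\otimes M;\mu_\bullet,\nu_\bullet)\xrightarrow{\tilde\tau_{r,s}^{-1}}(N\otimes M;\nu_\bullet,\mu_\bullet)$, where $\tilde\tau_{r,s}^{-1}$ acts via the ordered list $(\mu_1,\dots,\mu_r,\nu_1,\dots,\nu_s)$.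
   Formalization: The interchange sign is corrected to (-1)^{|f||g'|}; Cl(A) is any model of the 2-colimit whose described product is a genuine monoidal structure, which forces all tensor products to vanish unless 4 divides p (for p = 2 mod 4 the stated claim fails). *)

(* Defs.v *)
From HB Require Import structures.
From mathcomp Require Import all_boot all_order all_algebra zify.

Set Implicit Arguments.
Unset Strict Implicit.
Unset Printing Implicit Defensive.

Import GRing.Theory Num.Theory.
Local Open Scope ring_scope.

(* Z/q for an arbitrary integer q, including q = 0, as the set of canonical
   representatives: a %% 0 = a, so that Zmodulo 0 is the group of integers.
   An element coerces to its representative. *)
Record Zmodulo (q : int) :=
  ZModulo {zrep :> int; zrepP : zrep == (zrep %% q)%Z}.

HB.instance Definition _ q := [isSub for @zrep q].
HB.instance Definition _ q := [Choice of Zmodulo q by <:].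

Section ZmoduloGroup.
Variable q : int.

Lemma zclass_subproof (a : int) : (a %% q)%Z == ((a %% q)%Z %% q)%Z.
Proof. by rewrite modz_mod. Qed.

Definition zclass (a : int) : Zmodulo q := ZModulo (zclass_subproof a).

Definition zmo_add (a b : Zmodulo q) := zclass (zrep a + zrep b).
Definition zmo_opp (a : Zmodulo q) := zclass (- zrep a).

Fact zmo_addA : associative zmo_add.
Proof. by move=> a b c; apply: val_inj; rewrite /= modzDml modzDmr addrA. Qed.
Fact zmo_addC : commutative zmo_add.
Proof. by move=> a b; apply: val_inj; rewrite /= addrC. Qed.
Fact zmo_add0 : left_id (zclass 0) zmo_add.
Proof.
by move=> a; apply: val_inj; rewrite /= modzDml add0r -(eqP (zrepP a)).
Qed.
Fact zmo_addN : left_inverse (zclass 0) zmo_opp zmo_add.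
Proof. by move=> a; apply: val_inj; rewrite /= modzDml addNr. Qed.

HB.instance Definition _ :=
  GRing.isZmodule.Build (Zmodulo q) zmo_addA zmo_addC zmo_add0 zmo_addN.

Lemma zrepD (a b : Zmodulo q) : zrep (a + b) = ((zrep a + zrep b) %% q)%Z.
Proof. by []. Qed.

Lemma zrep0 : zrep (0 : Zmodulo q) = 0.
Proof. by rewrite /= mod0z. Qed.

Lemma zrepD_dvd (d : int) (a b : Zmodulo q) : (d %| q)%Z ->
  (zrep (a + b)%R == zrep a + zrep b %[mod d])%Z.
Proof.
move=> dq; rewrite zrepD; set m := zrep a + zrep b.
by rewrite eq_sym eqz_mod_dvd {1}(divz_eq m q) addrK dvdz_mull.
Qed.

End ZmoduloGroup.

(* The binomial coefficient c(c-1)/2 of an arbitrary integer c. *)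
Definition binz2 (c : int) : int := ((c * (c - 1)) %/ 2)%Z.

Definition zodd (m : int) : bool := odd `|m|%N.

Lemma zoddD m n : zodd (m + n) = zodd m (+) zodd n.
Proof. by rewrite /zodd; lia. Qed.

Lemma zoddM m n : zodd (m * n) = zodd m && zodd n.
Proof. by rewrite /zodd abszM oddM. Qed.

Lemma zodd_mod (q m : int) : (2 %| q)%Z -> zodd (m %% q)%Z = zodd m.
Proof.
move=> /dvdzP[r ->]; rewrite [in RHS](divz_eq m (r * 2)).
by rewrite zoddD /zodd; lia.
Qed.

Lemma binz2E c : c * (c - 1) = binz2 c * 2.
Proof.
rewrite /binz2; symmetry; apply/eqP; rewrite -dvdz_eq dvdzE /= abszM dvdn2.
by rewrite oddM; lia.
Qed.

Lemma binz2D c d : binz2 (c + d) = binz2 c + binz2 d + c * d.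
Proof. by have := binz2E c; have := binz2E d; have := binz2E (c + d); nia. Qed.

Lemma zodd_binz2_mod (q m : int) :
  (4 %| q)%Z -> zodd (binz2 (m %% q)%Z) = zodd (binz2 m).
Proof.
move=> /dvdzP[r ->]; rewrite [in RHS](divz_eq m (r * 4)).
move: (m %/ _)%Z (m %% _)%Z => n c.
rewrite binz2D !zoddD; have := binz2E (n * (r * 4)) => E.
have -> : binz2 (n * (r * 4)) = 2 * (n * r * (n * (r * 4) - 1)) by lia.
by rewrite /zodd; lia.
Qed.

Lemma expz_sign (R : fieldType) (m : int) : (-1 : R) ^ m = (-1) ^+ zodd m.
Proof.
rewrite /zodd signr_odd; case: m => n; first by rewrite -exprnP.
by rewrite NegzE -exprnN abszN /= -signr_odd invr_sign.
Qed.

Record Bfactor (k : fieldType) (q : int) (e : bool) := BFactor {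
  w1 : Zmodulo q -> Zmodulo q -> Zmodulo q -> k;
  w2 : Zmodulo q -> Zmodulo q -> Zmodulo q -> k;
  w1_neq0 : forall a b c, w1 a b c != 0;
  w2_neq0 : forall a b c, w2 a b c != 0;
  w1_cocycle : forall a b c d,
    w1 a b c * w1 a (b + c) d = w1 a b (c + d) * w1 a c d;
  w2_cocycle : forall a b c d,
    w2 (a + b) c d * w2 a b d = w2 b c d * w2 a (b + c) d;
  w12_mixed : forall a b c d,
    w1 b c d * w1 a c d * (w1 (a + b) c d)^-1 =
      (-1) ^ (zrep a * zrep b * zrep c * zrep d * (e : nat)%:Z) *
      (w2 a b c * w2 a b d * (w2 a b (c + d))^-1);
  w12_sym : forall a b c,
    w1 a b c * (w1 a c b)^-1 = w2 b a c * (w2 a b c)^-1 }.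

Record Sfactor (k : fieldType) (q : int) (e : bool) := SFactor {
  Sfactor_B :> Bfactor k q e;
  ws : Zmodulo q -> Zmodulo q -> k;
  ws_neq0 : forall a b, ws a b != 0;
  ws_left : forall a b c, w1 Sfactor_B a b c * w2 Sfactor_B b c a =
    ws a b * ws a c * (ws a (b + c))^-1;
  ws_right : forall a b c, w1 Sfactor_B c a b * w2 Sfactor_B a b c =
    ws a c * ws b c * (ws (a + b) c)^-1 }.

Section FactorProduct.
Variables (k : fieldType) (q : int) (e e' : bool).

Lemma sign_addb (m : int) : (-1 : k) ^ (m * (addb e e' : nat)%:Z) =
  (-1) ^ (m * (e : nat)%:Z) * (-1) ^ (m * (e' : nat)%:Z).
Proof.
case: e e' => [] []; rewrite /= ?mulr1 ?mulr0 ?expr0z ?mul1r ?mulr1 //.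
by rewrite -expfzMl mulrNN mulr1 exp1rz.
Qed.

Section B.
Variables (u : Bfactor k q e) (v : Bfactor k q e').

Fact mulB_1 a b c : w1 u a b c * w1 v a b c != 0.
Proof. by rewrite mulf_neq0 ?w1_neq0. Qed.
Fact mulB_2 a b c : w2 u a b c * w2 v a b c != 0.
Proof. by rewrite mulf_neq0 ?w2_neq0. Qed.
Fact mulB_3 a b c d :
  w1 u a b c * w1 v a b c * (w1 u a (b + c) d * w1 v a (b + c) d) =
  w1 u a b (c + d) * w1 v a b (c + d) * (w1 u a c d * w1 v a c d).
Proof. by rewrite mulrACA !w1_cocycle mulrACA. Qed.
Fact mulB_4 a b c d :
  w2 u (a + b) c d * w2 v (a + b) c d * (w2 u a b d * w2 v a b d) =
  w2 u b c d * w2 v b c d * (w2 u a (b + c) d * w2 v a (b + c) d).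
Proof. by rewrite mulrACA !w2_cocycle mulrACA. Qed.
Fact mulB_5 a b c d :
  w1 u b c d * w1 v b c d * (w1 u a c d * w1 v a c d)
    * (w1 u (a + b) c d * w1 v (a + b) c d)^-1 =
  (-1) ^ (zrep a * zrep b * zrep c * zrep d * (addb e e' : nat)%:Z) *
  (w2 u a b c * w2 v a b c * (w2 u a b d * w2 v a b d)
    * (w2 u a b (c + d) * w2 v a b (c + d))^-1).
Proof.
rewrite sign_addb !invfM (mulrACA (w1 u b c d)) (mulrACA (w1 u b c d * _)).
rewrite !w12_mixed mulrACA; congr (_ * _).
by rewrite (mulrACA (w2 u a b c) (w2 v a b c)) [RHS]mulrACA.
Qed.
Fact mulB_6 a b c : w1 u a b c * w1 v a b c * (w1 u a c b * w1 v a c b)^-1 =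
  w2 u b a c * w2 v b a c * (w2 u a b c * w2 v a b c)^-1.
Proof. by rewrite !invfM mulrACA !w12_sym mulrACA. Qed.

Definition mulB : Bfactor k q (addb e e') :=
  BFactor mulB_1 mulB_2 mulB_3 mulB_4 mulB_5 mulB_6.
End B.

Section S.
Variables (u : Sfactor k q e) (v : Sfactor k q e').

Fact mulS_1 a b : ws u a b * ws v a b != 0.
Proof. by rewrite mulf_neq0 ?ws_neq0. Qed.
Fact mulS_2 a b c : w1 (mulB u v) a b c * w2 (mulB u v) b c a =
  ws u a b * ws v a b * (ws u a c * ws v a c)
    * (ws u a (b + c) * ws v a (b + c))^-1.
Proof.
by rewrite /= invfM mulrACA !ws_left (mulrACA (ws u a b)) [RHS]mulrACA.
Qed.
Fact mulS_3 a b c : w1 (mulB u v) c a b * w2 (mulB u v) a b c =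
  ws u a c * ws v a c * (ws u b c * ws v b c)
    * (ws u (a + b) c * ws v (a + b) c)^-1.
Proof.
by rewrite /= invfM mulrACA !ws_right (mulrACA (ws u a c)) [RHS]mulrACA.
Qed.

Definition mulS : Sfactor k q (addb e e') := SFactor mulS_1 mulS_2 mulS_3.
End S.
End FactorProduct.

Section StandardFactors.
Variables (k : fieldType) (q : int).

(* The exponents are computed on representatives; when 4 divides q the signs
   depend only on the classes modulo q. *)
Definition A_w1 (a b c : Zmodulo q) : k := 1.
Definition A_w2 (a b c : Zmodulo q) : k := (-1) ^ (binz2 c * zrep a * zrep b).
Definition A_ws (a b : Zmodulo q) : k := (-1) ^ (binz2 a * binz2 b).
Definition D_w1 (r s t : Zmodulo q) : k := (-1) ^ (zrep r * zrep s * zrep t).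
Definition D_w2 (r s t : Zmodulo q) : k := (-1) ^ (zrep r * zrep s * zrep t).
Definition D_ws (r s : Zmodulo q) : k := (-1) ^ (zrep r * zrep s).

Hypothesis q4 : (4 %| q)%Z.

Let q2 : (2 %| q)%Z.
Proof. exact: dvdz_trans q4. Qed.

Ltac sign_solve :=
  rewrite /= /A_w1 /A_w2 /A_ws /D_w1 /D_w2 /D_ws ?(mulr0, mulr1, mul1r, invr1);
  rewrite ?expr0z ?mul1r ?expz_sign ?zoddM ?zrepD ?(zodd_binz2_mod _ q4)
    ?(zodd_mod _ q2) ?binz2D ?zoddD ?zoddM ?invr_sign -?signr_addb;
  lazymatch goal with
  | |- 1%R = _ => transitivity ((-1 : k) ^+ false); first by []
  | _ => idtac
  end;
  congr (_ ^+ nat_of_bool _);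
  repeat match goal with |- context [zodd ?x] => case: (zodd x) end; done.

Fact sign_neq0 (m : int) : (-1 : k) ^ m != 0.
Proof. by rewrite expz_sign signr_eq0. Qed.

Program Definition A_B : Bfactor k q true :=
  @BFactor k q true A_w1 A_w2 _ _ _ _ _ _.
Next Obligation. exact: oner_neq0. Qed.
Next Obligation. exact: sign_neq0. Qed.
Next Obligation. sign_solve. Qed.
Next Obligation. sign_solve. Qed.
Next Obligation. sign_solve. Qed.

Program Definition A_sys : Sfactor k q true := @SFactor k q true A_B A_ws _ _ _.
Next Obligation. exact: sign_neq0. Qed.
Next Obligation. sign_solve. Qed.
Next Obligation. sign_solve. Qed.

Program Definition D_B : Bfactor k q false :=
  @BFactor k q false D_w1 D_w2 _ _ _ _ _ _.
Next Obligation. exact: sign_neq0. Qed.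
Next Obligation. exact: sign_neq0. Qed.
Next Obligation. sign_solve. Qed.
Next Obligation. sign_solve. Qed.
Next Obligation. sign_solve. Qed.
Next Obligation. sign_solve. Qed.

Program Definition D_sys : Sfactor k q false :=
  @SFactor k q false D_B D_ws _ _ _.
Next Obligation. exact: sign_neq0. Qed.
Next Obligation. sign_solve. Qed.
Next Obligation. sign_solve. Qed.

End StandardFactors.

(* spart e is the projection on the component of parity e; true is odd. *)
Record svect (k : fieldType) := SVect {
  sv_car :> lmodType k;
  spart : bool -> sv_car -> sv_car;
  spart_linear : forall e, linear (spart e);
  spartK : forall e e' v, spart e (spart e' v) = if e == e' then spart e v else 0;
  spart_sum : forall v, spart false v + spart true v = v }.

Definition homog (k : fieldType) (V : svect k) (e : bool) (v : V) : Prop :=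
  spart e v = v.

Record supercat (k : fieldType) (Ob : Type) := Supercat {
  Mor : Ob -> Ob -> svect k;
  idm : forall X, Mor X X;
  mcomp : forall X Y Z, Mor Y Z -> Mor X Y -> Mor X Z;
  idm_even : forall X, homog false (idm X);
  comp_homog : forall X Y Z (g : Mor Y Z) (f : Mor X Y) e e',
    homog e g -> homog e' f -> homog (e (+) e') (mcomp g f);
  comp_linear_r : forall X Y Z (g : Mor Y Z), linear (@mcomp X Y Z g);
  comp_linear_l : forall X Y Z (f : Mor X Y), linear (fun g : Mor Y Z => mcomp g f);
  comp1m : forall X Y (f : Mor X Y), mcomp (idm Y) f = f;
  compm1 : forall X Y (f : Mor X Y), mcomp f (idm X) = f;
  compA : forall X Y Z W (h : Mor Z W) (g : Mor Y Z) (f : Mor X Y),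
    mcomp h (mcomp g f) = mcomp (mcomp h g) f }.

Arguments idm {k Ob} s X.
Arguments mcomp {k Ob s X Y Z} g f.
Notation "g ∘ f" := (mcomp g f) (at level 40, left associativity).

Definition isom (k : fieldType) (Ob : Type) (C : supercat k Ob) (X Y : Ob)
    (f : Mor C X Y) : Prop :=
  exists g : Mor C Y X, g ∘ f = idm C X /\ f ∘ g = idm C Y.

(* A Z/q-supercategory, i.e. a family of supercategories indexed by Z/q, is
   given as the disjoint union of its members: each object has a degree and
   there are no non-zero morphisms between objects of different degrees. *)
Record zsupercat (k : fieldType) (q : int) (Ob : Type) (deg : Ob -> Zmodulo q) :=
  ZSupercat {
    zsc :> supercat k Ob;
    hom_deg : forall X Y (f : Mor zsc X Y), deg X != deg Y -> f = 0 }.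

Record nice (k : fieldType) (q : int) (Ob : Type) (deg : Ob -> Zmodulo q)
    (C : zsupercat k deg) : Prop := Nice {
  nice_zero : forall i, exists2 Z, deg Z = i & idm C Z = 0;
  nice_sum : forall X Y, deg X = deg Y ->
    exists S (i1 : Mor C X S) (i2 : Mor C Y S) (p1 : Mor C S X) (p2 : Mor C S Y),
      [/\ deg S = deg X, homog false i1 /\ homog false i2,
          homog false p1 /\ homog false p2,
          [/\ p1 ∘ i1 = idm C X, p2 ∘ i2 = idm C Y, p1 ∘ i2 = 0 & p2 ∘ i1 = 0]
        & i1 ∘ p1 + i2 ∘ p2 = idm C S];
  nice_idem : forall X (f : Mor C X X), homog false f -> f ∘ f = f ->
    exists Y (r : Mor C X Y) (s : Mor C Y X),
      [/\ deg Y = deg X, homog false r, homog false s, r ∘ s = idm C Y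
        & s ∘ r = f];
  nice_shift : forall X, exists Y (f : Mor C X Y),
    [/\ deg Y = deg X, homog true f & isom f] }.

Record mobjects (q : int) := MObjects {
  mob :> Type;
  deg : mob -> Zmodulo q;
  tens : mob -> mob -> mob;
  munit : mob;
  deg_tens : forall X Y, deg (tens X Y) = deg X + deg Y;
  deg_munit : deg munit = 0 }.

Arguments munit {q m}.
Notation "X ⊗ Y" := (tens X Y) (at level 39, left associativity).

Record monoidal (k : fieldType) (q : int) (O : mobjects q) := Monoidal {
  mcat :> zsupercat k (@deg q O);
  tensh : forall X X' Y Y' : O,
    Mor mcat X X' -> Mor mcat Y Y' -> Mor mcat (X ⊗ Y) (X' ⊗ Y');
  tensh_linear_r : forall (X X' Y Y' : O) (f : Mor mcat X X'),
    linear (@tensh X X' Y Y' f);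
  tensh_linear_l : forall (X X' Y Y' : O) (g : Mor mcat Y Y'),
    linear (fun f : Mor mcat X X' => tensh f g);
  tensh_homog : forall (X X' Y Y' : O) (f : Mor mcat X X') (g : Mor mcat Y Y') e e',
    homog e f -> homog e' g -> homog (e (+) e') (tensh f g);
  tensh1 : forall X Y : O, tensh (idm mcat X) (idm mcat Y) = idm mcat (X ⊗ Y);
  tensh_comp : forall (X X' X'' Y Y' Y'' : O)
      (f : Mor mcat X X') (f' : Mor mcat X' X'')
      (g : Mor mcat Y Y') (g' : Mor mcat Y' Y'') e e',
    homog e f -> homog e' g' ->
    tensh f' g' ∘ tensh f g = (-1) ^+ (e && e') *: tensh (f' ∘ f) (g' ∘ g);
  assoc : forall X Y Z : O, Mor mcat (X ⊗ (Y ⊗ Z)) ((X ⊗ Y) ⊗ Z);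
  associ : forall X Y Z : O, Mor mcat ((X ⊗ Y) ⊗ Z) (X ⊗ (Y ⊗ Z));
  lunit : forall X : O, Mor mcat (munit ⊗ X) X;
  runit : forall X : O, Mor mcat (X ⊗ munit) X;
  assoc_even : forall X Y Z : O, homog false (assoc X Y Z);
  assocK : forall X Y Z : O, associ X Y Z ∘ assoc X Y Z = idm mcat _;
  associK : forall X Y Z : O, assoc X Y Z ∘ associ X Y Z = idm mcat _;
  assoc_nat : forall (X X' Y Y' Z Z' : O)
      (f : Mor mcat X X') (g : Mor mcat Y Y') (h : Mor mcat Z Z'),
    assoc X' Y' Z' ∘ tensh f (tensh g h) = tensh (tensh f g) h ∘ assoc X Y Z;
  lunit_even : forall X : O, homog false (lunit X);
  lunit_iso : forall X : O, isom (lunit X);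
  lunit_nat : forall (X X' : O) (f : Mor mcat X X'),
    lunit X' ∘ tensh (idm mcat munit) f = f ∘ lunit X;
  runit_even : forall X : O, homog false (runit X);
  runit_iso : forall X : O, isom (runit X);
  runit_nat : forall (X X' : O) (f : Mor mcat X X'),
    runit X' ∘ tensh f (idm mcat munit) = f ∘ runit X;
  pentagon : forall X Y Z W : O,
    assoc (X ⊗ Y) Z W ∘ assoc X Y (Z ⊗ W) =
      tensh (assoc X Y Z) (idm mcat W) ∘ assoc X (Y ⊗ Z) W
        ∘ tensh (idm mcat X) (assoc Y Z W);
  triangle : forall X Y : O,
    tensh (runit X) (idm mcat Y) ∘ assoc X munit Y =
      tensh (idm mcat X) (lunit Y) }.

Arguments tensh {k q O m X X' Y Y'} f g.
Arguments assoc {k q O} m X Y Z.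
Arguments associ {k q O} m X Y Z.
Arguments lunit {k q O} m X.
Arguments runit {k q O} m X.
Notation "f ⊠ g" := (tensh f g) (at level 39, left associativity).

Section Braidings.
Variables (k : fieldType) (q : int) (O : mobjects q) (M : monoidal k O).
Variable b : forall X Y : O, Mor M (X ⊗ Y) (Y ⊗ X).

Definition hexagon1 (w : Zmodulo q -> Zmodulo q -> Zmodulo q -> k) : Prop :=
  forall A B C : O,
    (idm M B ⊠ b A C) ∘ associ M B A C ∘ (b A B ⊠ idm M C) =
    w (deg A) (deg B) (deg C) *:
      (associ M B C A ∘ b A (B ⊗ C) ∘ associ M A B C).

Definition hexagon2 (w : Zmodulo q -> Zmodulo q -> Zmodulo q -> k) : Prop :=
  forall A B C : O,
    (b A C ⊠ idm M B) ∘ assoc M A C B ∘ (idm M A ⊠ b B C) =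
    w (deg A) (deg B) (deg C) *:
      (assoc M C A B ∘ b (A ⊗ B) C ∘ assoc M A B C).

Definition involutive_up_to (w : Zmodulo q -> Zmodulo q -> k) : Prop :=
  forall A B : O, b B A ∘ b A B = w (deg A) (deg B) *: idm M (A ⊗ B).

Definition degodd (A : O) : bool := zodd (deg A).

Record braiding (e : bool) (w : Bfactor k q e) : Prop := Braiding {
  br_iso : forall A B, isom (b A B);
  br_even : forall A B, homog false (b A B);
  br_nat : forall (A A' B B' : O) (f : Mor M A A') (g : Mor M B B') d d',
    homog d f -> homog d' g ->
    (g ⊠ f) ∘ b A B = (-1) ^+ (d && d') *: (b A' B' ∘ (f ⊠ g));
  br_hex1 : hexagon1 (w1 w);
  br_hex2 : hexagon2 (w2 w) }.

Record symmetry (e : bool) (w : Sfactor k q e) : Prop := Symmetry {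
  sym_braiding : braiding w;
  sym_inv : involutive_up_to (ws w) }.

Record superbraiding (e : bool) (w : Bfactor k q e) : Prop := Superbraiding {
  sbr_iso : forall A B, isom (b A B);
  sbr_homog : forall A B, homog (degodd A && degodd B) (b A B);
  sbr_nat : forall (A A' B B' : O) (f : Mor M A A') (g : Mor M B B') d d',
    homog d f -> homog d' g ->
    (g ⊠ f) ∘ b A B =
      (-1) ^+ ((degodd A && degodd B && (d (+) d')) (+) (d && d')) *:
        (b A' B' ∘ (f ⊠ g));
  sbr_hex1 : hexagon1 (w1 w);
  sbr_hex2 : hexagon2 (w2 w) }.

Record supersymmetry (e : bool) (w : Sfactor k q e) : Prop := Supersymmetry {
  ssym_braiding : superbraiding w;
  ssym_inv : involutive_up_to (ws w) }.

End Braidings.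

Record superalg (k : fieldType) := Superalg {
  sa_sp :> svect k;
  sa_one : sa_sp;
  sa_mul : sa_sp -> sa_sp -> sa_sp;
  sa_linear_r : forall x, linear (sa_mul x);
  sa_linear_l : forall y, linear (sa_mul^~ y);
  sa_mulA : associative sa_mul;
  sa_mul1 : left_id sa_one sa_mul;
  sa_1mul : right_id sa_one sa_mul;
  sa_one_even : homog false sa_one;
  sa_mul_homog : forall e e' x y,
    homog e x -> homog e' y -> homog (e (+) e') (sa_mul x y) }.

Arguments sa_one {k s}.

Definition superhom (k : fieldType) (B B' : superalg k) (phi : B -> B') : Prop :=
  [/\ linear phi, phi sa_one = sa_one,
      forall x y, phi (sa_mul x y) = sa_mul (phi x) (phi y)
    & forall e x, homog e x -> homog e (phi x)].

Definition clifford_relations (k : fieldType) (n : nat) (B : superalg k)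
    (a : 'I_n -> B) : Prop :=
  [/\ forall i, homog true (a i),
      forall i, sa_mul (a i) (a i) = 2%:R *: sa_one
    & forall i j, i != j -> sa_mul (a i) (a j) = - sa_mul (a j) (a i)].

(* B, with the elements a_i, is the superalgebra presented by odd generators
   a_i subject to the Clifford relations. *)
Definition is_clifford (k : fieldType) (n : nat) (B : superalg k)
    (a : 'I_n -> B) : Prop :=
  clifford_relations a /\
  forall (B' : superalg k) (b : 'I_n -> B'), clifford_relations b ->
    exists phi : B -> B', [/\ superhom phi, forall i, phi (a i) = b i
      & forall psi : B -> B', superhom psi -> (forall i, psi (a i) = b i) ->
          psi =1 phi].

Section MatrixSuperalgebra.
Variables (k : fieldType) (m n : nat).

(* The parity of the basis vectors of k^{m|n}: the first m are even. *)
Definition ipar (x : 'I_(m + n)) : bool := (m <= x)%N.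

Definition mx_part (e : bool) (B : 'M[k]_(m + n)) : 'M[k]_(m + n) :=
  \matrix_(x, y) if ipar x (+) ipar y == e then B x y else 0.

Fact mx_part_linear e : linear (mx_part e).
Proof.
by move=> c B B'; apply/matrixP=> x y; rewrite !mxE; case: ifP; rewrite ?mulr0 ?addr0.
Qed.

Fact mx_partK e e' B :
  mx_part e (mx_part e' B) = if e == e' then mx_part e B else 0.
Proof.
apply/matrixP=> x y; case: (eqVneq e e') => [->|ne]; rewrite !mxE.
  by case: ifP => // ->.
by case: ifP => // /eqP ->; rewrite (negPf ne).
Qed.

Fact mx_part_sum B : mx_part false B + mx_part true B = B.
Proof.
by apply/matrixP=> x y; rewrite !mxE; case: (_ (+) _); rewrite ?addr0 ?add0r.
Qed.

Definition mx_sv : svect k := SVect mx_part_linear mx_partK mx_part_sum.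

Lemma mx_homogP e (B : mx_sv) :
  homog e B <-> forall x y, ipar x (+) ipar y != e -> (B : 'M_(m + n)) x y = 0.
Proof.
split=> [<- x y ne|h]; first by rewrite mxE (negPf ne).
by apply/matrixP=> x y; rewrite mxE; have [//|/h ->] := eqVneq (ipar x (+) ipar y) e.
Qed.

Fact mx_linear_r (B : mx_sv) : linear (mulmx B : mx_sv -> mx_sv).
Proof. by move=> c C C'; rewrite mulmxDr scalemxAr. Qed.
Fact mx_linear_l (B : mx_sv) : linear (mulmx^~ B : mx_sv -> mx_sv).
Proof. by move=> c C C'; rewrite mulmxDl scalemxAl. Qed.
Fact mx_one_even : homog false (1%:M : mx_sv).
Proof.
apply/mx_homogP=> x y; rewrite mxE; have [->|//] := eqVneq x y.
by rewrite addbb.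
Qed.
Fact mx_mul_homog e e' (B C : mx_sv) :
  homog e B -> homog e' C -> homog (e (+) e') (mulmx B C : mx_sv).
Proof.
move=> /mx_homogP hB /mx_homogP hC; apply/mx_homogP=> x y ne.
rewrite mxE big1 // => z _.
have [eB|/hB->] := eqVneq (ipar x (+) ipar z) e; last by rewrite mul0r.
have [eC|/hC->] := eqVneq (ipar z (+) ipar y) e'; last by rewrite mulr0.
by move: ne; rewrite -eB -eC addbA -(addbA (ipar x)) addbb addbF eqxx.
Qed.

Definition matrix_superalg : superalg k :=
  @Superalg k mx_sv 1%:M (fun B C => mulmx B C) mx_linear_r mx_linear_l
    (@mulmxA _ _ _ _ _) (@mul1mx _ _ _) (@mulmx1 _ _ _) mx_one_even mx_mul_homog.

End MatrixSuperalgebra.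

Definition clifford_is_matrix (k : fieldType) (p : nat) : Prop :=
  exists (Cl : superalg k) (a : 'I_p -> Cl) (m n : nat)
         (phi : Cl -> matrix_superalg k m n),
    [/\ is_clifford a, (0 < m + n)%N, superhom phi & bijective phi].

Record clrep (k : fieldType) (p : nat) := ClRep {
  cr_sp :> svect k;
  cr_act : 'I_p -> cr_sp -> cr_sp;
  cr_linear : forall j, linear (cr_act j);
  cr_odd : forall j e v, homog e v -> homog (~~ e) (cr_act j v);
  cr_sq : forall j v, cr_act j (cr_act j v) = 2%:R *: v;
  cr_anti : forall i j v, i != j -> cr_act i (cr_act j v) = - cr_act j (cr_act i v) }.

Definition smap (k : fieldType) (V W : svect k) (e : bool) (f : V -> W) : Prop :=
  linear f /\ forall e' v, homog e' v -> homog (e (+) e') (f v).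

Definition clrep_map (k : fieldType) (p : nat) (P Q : clrep k p) (e : bool)
    (f : P -> Q) : Prop :=
  smap e f /\
  forall j v, f (cr_act j v) = (-1) ^+ e *: cr_act j (f v).

(* A Cl_p-module with underlying super vector space k^{m|n}; the generators act
   on column vectors by odd matrices. *)
Record clmod (k : fieldType) (p : nat) := ClMod {
  um : nat;
  un : nat;
  umx : 'I_p -> 'M[k]_(um + un);
  umx_rel : @clifford_relations k p (matrix_superalg k um un) umx }.

Notation uidx U := 'I_(um U + un U).

Section TensorModule.
Variables (k : fieldType) (p : nat) (U : clmod k p) (V : svect k).

(* V ⊗ U: the family v stands for the sum of the tensors of v_x with the x-th
   basis vector of U. *)
Notation VU := {ffun uidx U -> V}.

Definition vu_part (e : bool) (v : VU) : VU :=
  [ffun x => spart (e (+) ipar x) (v x)].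

Fact vu_part_linear e : linear (vu_part e).
Proof. by move=> c v w; apply/ffunP=> x; rewrite !ffunE spart_linear. Qed.

Fact vu_partK e e' v :
  vu_part e (vu_part e' v) = if e == e' then vu_part e v else 0.
Proof.
apply/ffunP=> x; rewrite !ffunE spartK.
by case: (eqVneq e e') => [->|]; rewrite ?eqxx ?ffunE //; case: e e' (ipar x) => [] [] [].
Qed.

Fact vu_part_sum v : vu_part false v + vu_part true v = v.
Proof.
apply/ffunP=> x; rewrite !ffunE; case: (ipar x) => /=; rewrite ?spart_sum //.
by rewrite addrC spart_sum.
Qed.

Definition vu_sv : svect k := SVect vu_part_linear vu_partK vu_part_sum.

(* (1 ⊗ u_j)(v ⊗ w) = (-1)^|v| v ⊗ u_j w *)
Definition vgrade (v : V) : V := spart false v - spart true v.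

Definition vu_act (j : 'I_p) (v : VU) : VU :=
  [ffun x => \sum_(y : uidx U) umx U j x y *: vgrade (v y)].

Fact vgrade_linear : linear vgrade.
Proof.
move=> c v w; rewrite /vgrade !spart_linear scalerBr opprD.
by rewrite !addrA; congr (_ + _); rewrite -!addrA; congr (_ + _); rewrite addrC.
Qed.

Fact spart0 e : spart e (0 : V) = 0.
Proof.
have /= E := @spart_linear _ V e (-1) 0 0.
by move: E; rewrite scaleN1r oppr0 addr0 scaleN1r addNr.
Qed.

Fact vgradeK v : vgrade (vgrade v) = v.
Proof.
rewrite /vgrade; set a := spart false v; set b := spart true v.
have sB e x y : spart e (x - y) = spart e x - spart e y.
  by rewrite -scaleN1r addrC spart_linear scaleN1r addrC.
by rewrite !sB /a /b !spartK /= subr0 sub0r opprK spart_sum.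
Qed.

Fact vgradeZsum (c : uidx U -> k) (w : uidx U -> V) :
  vgrade (\sum_y c y *: w y) = \sum_y c y *: vgrade (w y).
Proof.
elim/big_rec2: _ => [|y v1 v2 _ <-]; last by rewrite vgrade_linear.
by rewrite /vgrade !spart0 subr0.
Qed.

Fact vu_act2 i j v x : vu_act i (vu_act j v) x =
  \sum_(z : uidx U) (umx U i *m umx U j) x z *: v z.
Proof.
rewrite ffunE (eq_bigr (fun y => \sum_z (umx U i x y * umx U j y z) *: v z)).
  by rewrite exchange_big /=; apply: eq_bigr => z _; rewrite mxE scaler_suml.
move=> y _; rewrite ffunE vgradeZsum scaler_sumr; apply: eq_bigr => z _.
by rewrite vgradeK scalerA.
Qed.

Fact vu_linear j : linear (vu_act j).
Proof.
move=> c v w; apply/ffunP=> x; rewrite !ffunE scaler_sumr -big_split /=.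
apply: eq_bigr => y _; rewrite !ffunE vgrade_linear scalerDr !scalerA.
by rewrite (mulrC c).
Qed.

Fact vu_odd j e (v : vu_sv) : homog e v -> homog (~~ e) (vu_act j v : vu_sv).
Proof.
move=> hv; apply/ffunP=> x; rewrite !ffunE.
have sS (r : seq (uidx U)) F : spart (~~ e (+) ipar x) (\sum_(y <- r) F y) =
    \sum_(y <- r) spart (~~ e (+) ipar x) (F y) :> V.
  elim/big_rec2: _ => [|y v1 v2 _ <-]; first exact: spart0.
  by rewrite -[F y]scale1r spart_linear !scale1r.
rewrite sS; apply: eq_bigr => y _.
have sZ d c (w : V) : spart d (c *: w) = c *: spart d w.
  by rewrite -[c *: w]addr0 spart_linear spart0 addr0.
rewrite sZ; have [ixy|ixy] := eqVneq (ipar x (+) ipar y) true; last first.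
  case: (umx_rel U) => /(_ j)/mx_homogP/(_ _ _ ixy)-> _ _.
  by rewrite !scale0r.
have hy : spart (e (+) ipar y) (v y) = v y.
  by move: hv => /ffunP/(_ y); rewrite ffunE.
congr (_ *: _); rewrite /vgrade -hy !spartK.
have -> : ~~ e (+) ipar x = e (+) ipar y.
  by case: (ipar x) (ipar y) ixy => [] [] //; case: e {hv hy sS}.
have sN d (w : V) : spart d (- w) = - spart d w.
  by rewrite -scaleN1r sZ scaleN1r.
case: (e (+) ipar y) => /=; rewrite ?sub0r ?subr0 ?sN ?spartK //.
Qed.

Fact vu_sq j v : vu_act j (vu_act j v) = 2%:R *: v.
Proof.
apply/ffunP=> x; rewrite vu_act2; case: (umx_rel U) => _ /(_ j) /= -> _.
rewrite ffunE (bigD1 x) //= !mxE eqxx mulr1 big1 ?addr0 // => z zx.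
by rewrite !mxE eq_sym (negPf zx) mulr0 scale0r.
Qed.

Fact vu_anti i j v : i != j -> vu_act i (vu_act j v) = - vu_act j (vu_act i v).
Proof.
move=> ij; apply/ffunP=> x; rewrite [RHS]ffunE !vu_act2 -sumrN.
case: (umx_rel U) => _ _ /(_ _ _ ij) /= ->.
by apply: eq_bigr => z _; rewrite !mxE scaleNr.
Qed.

Definition tensor_rep : clrep k p :=
  @ClRep k p vu_sv vu_act vu_linear vu_odd vu_sq vu_anti.

End TensorModule.

(* V |-> V ⊗ U, f |-> f ⊗ 1 is an equivalence from super vector spaces to
   Cl_p-modules. *)
Definition tensor_equivalence (k : fieldType) (p : nat) (U : clmod k p) : Prop :=
  (forall (V W : svect k) e (g : tensor_rep U V -> tensor_rep U W),
     clrep_map e g ->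
     exists f : V -> W,
       (smap e f /\ forall (v : {ffun uidx U -> V}) x,
          (g v : {ffun uidx U -> W}) x = f (v x)) /\
       (forall f' : V -> W, smap e f' ->
          (forall (v : {ffun uidx U -> V}) x,
             (g v : {ffun uidx U -> W}) x = f' (v x)) -> f' =1 f)) /\
  (forall P : clrep k p, exists (V : svect k) (phi : tensor_rep U V -> P),
     clrep_map false phi /\ bijective phi).

Section CliffordObjects.
Variables (k : fieldType) (q : int) (O : mobjects q) (A : monoidal k O).

Definition clifford_gens (X : O) (s : seq (Mor A X X)) : Prop :=
  [/\ forall i, (i < size s)%N -> homog true s`_i,
      forall i, (i < size s)%N -> s`_i ∘ s`_i = 2%:R *: idm A X
    & forall i j, (i < size s)%N -> (j < size s)%N -> i != j ->
        s`_i ∘ s`_j = - (s`_j ∘ s`_i)].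

Variable p : nat.

(* The objects (M; alpha_1, ..., alpha_n) of the categories Cl_n(A_i), for all
   i in Z/q and all n congruent to i modulo p; here i = deg M, n = size clgens
   and alpha_i is the (i-1)-st item of clgens. *)
Record clobj := ClObj {
  clob : O;
  clgens : seq (Mor A clob clob);
  clrel : clifford_gens clgens;
  cllevel : ((size clgens)%:Z == zrep (deg clob) %[mod p])%Z }.

(* f is a morphism of parity e from X to Y in some Cl_n(A_i). *)
Definition clmor (e : bool) (X Y : clobj) (f : Mor A (clob X) (clob Y)) : Prop :=
  [/\ size (clgens X) = size (clgens Y), homog e f
    & forall i, (i < size (clgens X))%N ->
        f ∘ (clgens X)`_i = (-1) ^+ e *: ((clgens Y)`_i ∘ f)].

Section Linearity.
Variables X Y Z : O.
Implicit Types (f : Mor A X Y) (g : Mor A Y Z).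

Lemma comp0r g : g ∘ (0 : Mor A X Y) = 0.
Proof.
have E := @comp_linear_r _ _ A X Y Z g (-1) 0 0.
by move: E; rewrite scaleN1r oppr0 addr0 scaleN1r addNr.
Qed.
Lemma compDr g f f' : g ∘ (f + f') = g ∘ f + g ∘ f'.
Proof. by have := comp_linear_r g 1 f f'; rewrite !scale1r. Qed.
Lemma compZr c g f : g ∘ (c *: f) = c *: (g ∘ f).
Proof. by have := comp_linear_r g c f 0; rewrite comp0r !addr0. Qed.
Lemma comp0l f : (0 : Mor A Y Z) ∘ f = 0.
Proof.
have /= E := @comp_linear_l _ _ A X Y Z f (-1) 0 0.
by move: E; rewrite scaleN1r oppr0 addr0 scaleN1r addNr.
Qed.
Lemma compDl g g' f : (g + g') ∘ f = g ∘ f + g' ∘ f.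
Proof. by have /= := comp_linear_l f 1 g g'; rewrite !scale1r. Qed.
Lemma compZl c g f : (c *: g) ∘ f = c *: (g ∘ f).
Proof. by have /= := comp_linear_l f c g 0; rewrite comp0l !addr0. Qed.
Lemma comp_suml (I : Type) (r : seq I) (F : I -> Mor A Y Z) f :
  (\sum_(x <- r) F x) ∘ f = \sum_(x <- r) (F x ∘ f).
Proof. by elim/big_rec2: _ => [|x a b _ <-]; rewrite ?comp0l ?compDl. Qed.
Lemma comp_sumr (I : Type) (r : seq I) (F : I -> Mor A X Y) g :
  g ∘ (\sum_(x <- r) F x) = \sum_(x <- r) (g ∘ F x).
Proof. by elim/big_rec2: _ => [|x a b _ <-]; rewrite ?comp0r ?compDr. Qed.
End Linearity.

Section TensorLinearity.
Variables X X' Y Y' : O.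
Implicit Types (f : Mor A X X') (g : Mor A Y Y').

Lemma tensh0r f : f ⊠ (0 : Mor A Y Y') = 0.
Proof.
have E := @tensh_linear_r _ _ _ A X X' Y Y' f (-1) 0 0.
by move: E; rewrite scaleN1r oppr0 addr0 scaleN1r addNr.
Qed.
Lemma tenshDr f g g' : f ⊠ (g + g') = f ⊠ g + f ⊠ g'.
Proof. by have := tensh_linear_r f 1 g g'; rewrite !scale1r. Qed.
Lemma tenshZr c f g : f ⊠ (c *: g) = c *: (f ⊠ g).
Proof. by have := tensh_linear_r f c g 0; rewrite tensh0r !addr0. Qed.
Lemma tensh0l g : (0 : Mor A X X') ⊠ g = 0.
Proof.
have /= E := @tensh_linear_l _ _ _ A X X' Y Y' g (-1) 0 0.
by move: E; rewrite scaleN1r oppr0 addr0 scaleN1r addNr.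
Qed.
Lemma tenshDl f f' g : (f + f') ⊠ g = f ⊠ g + f' ⊠ g.
Proof. by have /= := tensh_linear_l g 1 f f'; rewrite !scale1r. Qed.
Lemma tenshZl c f g : (c *: f) ⊠ g = c *: (f ⊠ g).
Proof. by have /= := tensh_linear_l g c f 0; rewrite tensh0l !addr0. Qed.
End TensorLinearity.

Lemma clifford_gens_cat (X : O) (s1 s2 : seq (Mor A X X)) :
  clifford_gens s1 -> clifford_gens s2 ->
  (forall i j, (i < size s1)%N -> (j < size s2)%N ->
     s1`_i ∘ s2`_j = - (s2`_j ∘ s1`_i)) ->
  clifford_gens (s1 ++ s2).
Proof.
move=> [o1 q1 a1] [o2 q2 a2] a12.
have lt2 i : (i < size (s1 ++ s2))%N -> ~~ (i < size s1)%N ->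
    (i - size s1 < size s2)%N by rewrite size_cat => ? ?; lia.
split.
- move=> i li; rewrite nth_cat; case: ifP => [/o1//|/negbT ni].
  exact: o2 (lt2 _ li ni).
- move=> i li; rewrite nth_cat; case: ifP => [/q1//|/negbT ni].
  exact: q2 (lt2 _ li ni).
move=> i j li lj ij; rewrite !nth_cat.
case: ifP => [i1|/negbT ni]; case: ifP => [j1|/negbT nj].
- exact: a1.
- exact: a12 (lt2 _ lj nj).
- by rewrite (a12 _ _ j1 (lt2 _ li ni)) opprK.
by apply: a2; rewrite ?lt2 //; move: ni nj ij; lia.
Qed.

Fact cltens_rel (X Y : clobj) : clifford_gens
  ([seq mu ⊠ idm A (clob Y) | mu <- clgens X] ++
   [seq idm A (clob X) ⊠ nu | nu <- clgens Y]).
Proof.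
case: X Y => [M s [os qs as_] _] [N t [ot qt at_] _] /=.
apply: clifford_gens_cat; first split.
- move=> i; rewrite size_map => li; rewrite (nth_map 0) //.
  exact: (tensh_homog (os _ li) (idm_even _ _)).
- move=> i; rewrite size_map => li; rewrite (nth_map 0) //.
  rewrite (tensh_comp _ _ (os _ li) (idm_even _ _)) andbF expr0 scale1r.
  by rewrite qs // comp1m tenshZl tensh1.
- move=> i j; rewrite size_map => li lj ij; rewrite !(nth_map 0) //.
  rewrite (tensh_comp _ _ (os _ lj) (idm_even _ _)).
  rewrite (tensh_comp _ _ (os _ li) (idm_even _ _)) !andbF !expr0 !scale1r.
  by rewrite as_ // -scaleN1r tenshZl scaleN1r.
- split.
  + move=> i; rewrite size_map => li; rewrite (nth_map 0) //.
    exact: (tensh_homog (idm_even _ _) (ot _ li)).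
  + move=> i; rewrite size_map => li; rewrite (nth_map 0) //.
    rewrite (tensh_comp _ _ (idm_even _ _) (ot _ li)) expr0 scale1r.
    by rewrite qt // comp1m tenshZr tensh1.
  move=> i j; rewrite size_map => li lj ij; rewrite !(nth_map 0) //.
  rewrite (tensh_comp _ _ (idm_even _ _) (ot _ lj)).
  rewrite (tensh_comp _ _ (idm_even _ _) (ot _ li)) !expr0 !scale1r.
  by rewrite at_ // -scaleN1r tenshZr scaleN1r.
move=> i j; rewrite !size_map => li lj; rewrite !(nth_map 0) //.
rewrite (tensh_comp _ _ (idm_even _ _) (idm_even _ _)) expr0 scale1r.
rewrite (tensh_comp _ _ (os _ li) (ot _ lj)) expr1 scaleN1r.
by rewrite !comp1m !compm1 opprK.
Qed.

Hypothesis pq : (p%:Z %| q)%Z.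

Fact cltens_level (X Y : clobj) :
  ((size ([seq mu ⊠ idm A (clob Y) | mu <- clgens X] ++
          [seq idm A (clob X) ⊠ nu | nu <- clgens Y]))%:Z ==
     zrep (deg (clob X ⊗ clob Y)) %[mod p])%Z.
Proof.
rewrite size_cat !size_map deg_tens PoszD.
rewrite (eqP (zrepD_dvd (deg (clob X)) (deg (clob Y)) pq)).
by rewrite -modzDm (eqP (cllevel X)) (eqP (cllevel Y)) modzDm.
Qed.

Definition cltens (X Y : clobj) : clobj :=
  ClObj (cltens_rel X Y) (cltens_level X Y).

Fact clunit_rel : clifford_gens ([::] : seq (Mor A (munit : O) munit)).
Proof. by []. Qed.

Fact clunit_level :
  ((size ([::] : seq (Mor A (munit : O) munit)))%:Z ==
     zrep (deg (munit : O)) %[mod p])%Z.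
Proof. by rewrite deg_munit zrep0. Qed.

Definition clunit : clobj := ClObj clunit_rel clunit_level.

Definition clobjects : mobjects q :=
  @MObjects q clobj (fun X => deg (clob X)) cltens clunit
    (fun X Y => deg_tens (clob X) (clob Y)) (deg_munit O).

Variable U : clmod k p.

(* P is M ⊗ U: the direct sum of copies of M, up to parity shift, indexed by
   the basis of U.  The inclusion tin x, of the parity of x, is the tensor
   product of the identity of M with the x-th basis vector of U. *)
Record tensU (M P : O) := TensU {
  tin : uidx U -> Mor A M P;
  tpr : uidx U -> Mor A P M;
  tensU_deg : deg P = deg M;
  tin_homog : forall x, homog (ipar x) (tin x);
  tpr_homog : forall x, homog (ipar x) (tpr x);
  tensU_pi : forall x y, tpr x ∘ tin y = if x == y then idm A M else 0;
  tensU_sum : \sum_x (tin x ∘ tpr x) = idm A P }.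

(* f ⊗ 1_U for f of parity e: (f ⊗ 1) tin_x = (-1)^(e|x|) tin'_x f *)
Definition amp (e : bool) (M P N Q : O) (t : tensU M P) (t' : tensU N Q)
    (f : Mor A M N) : Mor A P Q :=
  \sum_x (-1) ^+ (e && ipar x) *: (tin t' x ∘ f ∘ tpr t x).

(* 1_M ⊗ B for an endomorphism B of U *)
Definition ampU (M P : O) (t : tensU M P) (B : 'M[k]_(um U + un U)) : Mor A P P :=
  \sum_x \sum_y B x y *: (tin t x ∘ tpr t y).

Definition gensU (M P : O) (t : tensU M P) (s : seq (Mor A M M)) :
    seq (Mor A P P) :=
  [seq amp true t t f | f <- s] ++ [seq ampU t (umx U j) | j <- enum 'I_p].

Lemma homog_sum (V : svect k) (I : Type) (r : seq I) (F : I -> V) e :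
  (forall i, homog e (F i)) -> homog e (\sum_(i <- r) F i).
Proof.
move=> h; elim/big_rec: _ => [|i v _ hv]; first exact: spart0.
by have := spart_linear e 1 (F i) v; rewrite !scale1r /homog h hv.
Qed.

Lemma homogZ (V : svect k) c (v : V) e : homog e v -> homog e (c *: v).
Proof.
move=> h; have := spart_linear e c v 0.
by rewrite /homog spart0 h !addr0.
Qed.

Lemma amp_homog e M P N Q (t : tensU M P) (t' : tensU N Q) f :
  homog e f -> homog e (amp e t t' f).
Proof.
move=> h; apply: homog_sum => x; apply: homogZ.
have := comp_homog (comp_homog (tin_homog t' x) h) (tpr_homog t x).
by rewrite (addbC (ipar x)) -addbA addbb addbF.
Qed.

Lemma amp_comp e e' M P N Q L R (t : tensU M P) (t' : tensU N Q)
    (t'' : tensU L R) (f : Mor A M N) (g : Mor A N L) :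
  amp e' t' t'' g ∘ amp e t t' f = amp (e (+) e') t t'' (g ∘ f).
Proof.
rewrite /amp comp_suml; apply: eq_bigr => x _.
rewrite comp_sumr (bigD1 x) //= [X in _ + X]big1 ?addr0 => [|y yx].
  rewrite compZl compZr scalerA -!compA (compA (tpr t' x)) tensU_pi eqxx comp1m.
  by rewrite -signr_addb; congr ((-1) ^+ nat_of_bool _ *: _); case: e e' => [] [] //=; case: ipar.
rewrite compZl compZr -!compA (compA (tpr t' x)) tensU_pi eq_sym (negPf yx).
by rewrite comp0l !comp0r !scaler0.
Qed.

Lemma amp1 M P (t : tensU M P) : amp false t t (idm A M) = idm A P.
Proof.
rewrite -(tensU_sum t); apply: eq_bigr => x _.
by rewrite /= expr0 scale1r compm1.
Qed.

Lemma ampZ e M P N Q (t : tensU M P) (t' : tensU N Q) c f :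
  amp e t t' (c *: f) = c *: amp e t t' f.
Proof.
rewrite /amp scaler_sumr; apply: eq_bigr => x _.
by rewrite compZr compZl !scalerA mulrC.
Qed.

Lemma ampU_homog M P (t : tensU M P) (B : matrix_superalg k (um U) (un U)) e :
  homog e B -> homog e (ampU t B).
Proof.
move=> /mx_homogP h; apply: homog_sum => x; apply: homog_sum => y.
have [ixy|/h ->] := eqVneq (ipar x (+) ipar y) e; last first.
  by rewrite scale0r; apply: spart0.
by apply: homogZ; rewrite -ixy; apply: comp_homog (tin_homog _ _) (tpr_homog _ _).
Qed.

Lemma tprK M P (t : tensU M P) x y (N L : O) (g : Mor A M L) (f : Mor A N M) :
  (g ∘ tpr t x) ∘ (tin t y ∘ f) = if x == y then g ∘ f else 0.
Proof.
rewrite -compA (compA (tpr t x)) tensU_pi; case: ifP; rewrite ?comp1m //.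
by rewrite comp0l comp0r.
Qed.

Lemma ampU_comp M P (t : tensU M P) (B C : 'M[k]_(um U + un U)) :
  ampU t B ∘ ampU t C = ampU t (B *m C).
Proof.
rewrite /ampU comp_suml; apply: eq_bigr => x _; rewrite comp_suml.
under eq_bigr => y _.
  rewrite compZl comp_sumr (bigD1 y) //= [X in _ + X]big1 ?addr0; last first.
    move=> z zy; rewrite comp_sumr big1 // => w _.
    by rewrite compZr tprK eq_sym (negPf zy) scaler0.
  rewrite comp_sumr scaler_sumr.
  under eq_bigr => z _ do rewrite compZr tprK eqxx scalerA.
  over.
rewrite exchange_big /=; apply: eq_bigr => z _.
by rewrite mxE scaler_suml.
Qed.

Lemma ampU1 M P (t : tensU M P) : ampU t 1%:M = idm A P.
Proof.
rewrite -(tensU_sum t); apply: eq_bigr => x _.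
rewrite (bigD1 x) //= big1 ?addr0 => [|y yx]; first by rewrite mxE eqxx scale1r.
by rewrite mxE eq_sym (negPf yx) scale0r.
Qed.

Lemma ampUZ M P (t : tensU M P) c (B : 'M[k]_(um U + un U)) :
  ampU t (c *: B) = c *: ampU t B.
Proof.
rewrite /ampU scaler_sumr; apply: eq_bigr => x _; rewrite scaler_sumr.
by apply: eq_bigr => y _; rewrite mxE scalerA.
Qed.

Lemma amp_ampU M P (t : tensU M P) (f : Mor A M M)
    (B : matrix_superalg k (um U) (un U)) :
  homog true B -> amp true t t f ∘ ampU t B = - (ampU t B ∘ amp true t t f).
Proof.
move=> /mx_homogP h; rewrite /amp /ampU comp_suml [in RHS]comp_suml.
rewrite -sumrN; apply: eq_bigr => x _.
rewrite comp_sumr (bigD1 x) //= [X in _ + X]big1 ?addr0; last first.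
  move=> y yx; rewrite comp_sumr big1 // => z _.
  by rewrite compZr compZl tprK eq_sym (negPf yx) !scaler0.
rewrite comp_suml comp_sumr -sumrN; apply: eq_bigr => y _.
rewrite comp_sumr (bigD1 y) //= [X in _ + X]big1 ?addr0; last first.
  by move=> z zy; rewrite compZl compZr -[tin t z ∘ f ∘ _]compA tprK eq_sym (negPf zy) !scaler0.
rewrite !compZl !compZr -[tin t y ∘ f ∘ _]compA !tprK !eqxx !scalerA -scaleNr compA.
congr (_ *: _); have [ixy|/h ->] := eqVneq (ipar x (+) ipar y) true; last first.
  by rewrite mulr0 mul0r oppr0.
by case: (ipar x) (ipar y) ixy => [] [] //= _; rewrite ?expr0 ?expr1 ?mulN1r ?mulrN ?mulr1 ?mul1r ?opprK.
Qed.

Fact gensU_rel (M P : O) (t : tensU M P) s :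
  clifford_gens s -> clifford_gens (gensU t s).
Proof.
move=> [os qs as_]; have [uo uq ua] := umx_rel U.
have se (i : nat) : (i < size [seq ampU t (umx U j) | j <- enum 'I_p])%N ->
    exists2 j : 'I_p, val j = i &
      [seq ampU t (umx U j) | j <- enum 'I_p]`_i = ampU t (umx U j).
  rewrite size_map size_enum_ord => li; exists (Ordinal li) => //.
  by rewrite (nth_map (Ordinal li)) ?size_enum_ord // -[i in LHS]/(val (Ordinal li)) nth_ord_enum.
apply: clifford_gens_cat; first split.
- move=> i; rewrite size_map => li; rewrite (nth_map 0) //.
  exact: amp_homog (os _ li).
- move=> i; rewrite size_map => li; rewrite (nth_map 0) // amp_comp qs //.
  by rewrite ampZ amp1.
- move=> i j; rewrite size_map => li lj ij; rewrite !(nth_map 0) // !amp_comp.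
  by rewrite as_ // -scaleN1r ampZ scaleN1r.
- split.
  + by move=> i /se[j _ ->]; apply: ampU_homog.
  + by move=> i /se[j _ ->]; rewrite ampU_comp; have /= -> := uq j; rewrite ampUZ ampU1.
  move=> _ _ /se[i <- ->] /se[j <- ->] ij; rewrite !ampU_comp.
  by have /= -> := ua i j ij; rewrite -scaleN1r ampUZ scaleN1r.
move=> i j; rewrite size_map => li /se[l _ ->]; rewrite (nth_map 0) //.
exact: amp_ampU.
Qed.

Fact gensU_level (X : clobj) P (t : tensU (clob X) P) :
  ((size (gensU t (clgens X)))%:Z == zrep (deg P) %[mod p])%Z.
Proof.
rewrite size_cat (size_map _ (clgens X)) (size_map _ (enum 'I_p)) size_enum_ord.
rewrite PoszD -modzDmr modzz addr0.
by rewrite (tensU_deg t) (cllevel X).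
Qed.

Definition clU (X : clobj) P (t : tensU (clob X) P) : clobj :=
  ClObj (gensU_rel t (clrel X)) (gensU_level t).

Program Definition tensU_l (L M P : O) (t : tensU M P) : tensU (L ⊗ M) (L ⊗ P) :=
  @TensU _ _ (fun x => idm A L ⊠ tin t x) (fun x => idm A L ⊠ tpr t x) _ _ _ _ _.
Next Obligation. by rewrite !deg_tens (tensU_deg t). Qed.
Next Obligation. exact: (tensh_homog (idm_even _ _) (tin_homog t x)). Qed.
Next Obligation. exact: (tensh_homog (idm_even _ _) (tpr_homog t x)). Qed.
Next Obligation.
rewrite (tensh_comp _ _ (idm_even _ _) (tpr_homog t x)) expr0 scale1r comp1m.
by rewrite tensU_pi; case: ifP; rewrite ?tensh1 ?tensh0r.
Qed.
Next Obligation.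
transitivity (idm A L ⊠ (\sum_x (tin t x ∘ tpr t x))).
  elim/big_rec2: _ => [|x a b _ ->]; first by rewrite tensh0r.
  rewrite (tensh_comp _ _ (idm_even _ _) (tin_homog t x)) expr0 scale1r comp1m.
  by rewrite tenshDr.
by rewrite tensU_sum tensh1.
Qed.

Program Definition tensU_r (M P : O) (t : tensU M P) (L : O) :
    tensU (M ⊗ L) (P ⊗ L) :=
  @TensU _ _ (fun x => tin t x ⊠ idm A L) (fun x => tpr t x ⊠ idm A L) _ _ _ _ _.
Next Obligation. by rewrite !deg_tens (tensU_deg t). Qed.
Next Obligation.
by have := tensh_homog (tin_homog t x) (idm_even A L); rewrite addbF.
Qed.
Next Obligation.
by have := tensh_homog (tpr_homog t x) (idm_even A L); rewrite addbF.
Qed.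
Next Obligation.
rewrite (tensh_comp _ _ (tin_homog t y) (idm_even _ _)) andbF expr0 scale1r.
by rewrite comp1m tensU_pi; case: ifP; rewrite ?tensh1 ?tensh0l.
Qed.
Next Obligation.
transitivity ((\sum_x (tin t x ∘ tpr t x)) ⊠ idm A L).
  elim/big_rec2: _ => [|x a b _ ->]; first by rewrite tensh0l.
  rewrite (tensh_comp _ _ (tpr_homog t x) (idm_even _ _)) andbF expr0 scale1r.
  by rewrite comp1m tenshDl.
by rewrite tensU_sum tensh1.
Qed.

End CliffordObjects.

Arguments clmor {k q O A p} e X Y f.

(* Elements of the spin-symmetric groups are written as words in the generators
   s_1, s_2, ...; as s_i^2 = 1, the inverse of a word is its reversal. *)
Definition sigma_word (n i : nat) : seq nat := iota i n.

Definition tau_word (n m : nat) : seq nat :=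
  flatten [seq sigma_word n i | i <- rev (iota 1 m)].

Section SpinAction.
Variables (k : fieldType) (Ob : Type) (C : supercat k Ob) (X : Ob).

(* The generator s_i acts by (alpha_(i+1) - alpha_i)/2, and words act by
   composition; the list alpha is indexed from 0. *)
Definition spin_act (alpha : seq (Mor C X X)) (w : seq nat) : Mor C X X :=
  foldr (fun i f => (2%:R^-1 *: (alpha`_i - alpha`_i.-1)) ∘ f) (idm C X) w.

Definition tau_inv (alpha : seq (Mor C X X)) (n m : nat) : Mor C X X :=
  spin_act alpha (rev (tau_word n m)).

End SpinAction.

Section Eversion.
Variables (k : fieldType) (q : int) (O : mobjects q) (A : monoidal k O).
Variables (p : nat) (pq : (p%:Z %| q)%Z) (U : clmod k p).

(* The composites of the transition morphisms j : M -> M ⊗ U. *)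
Inductive stage (C : supercat k (clobj A p))
    (j : forall (X : clobj A p) (P : O) (t : tensU A U (clob X) P),
           Mor C X (clU t)) (X : clobj A p) :
    forall X' : clobj A p, Mor C X X' -> Prop :=
  | Stage0 : stage j (idm C X)
  | StageS (X' : clobj A p) (u : Mor C X X') (P : O)
      (t : tensU A U (clob X') P) : stage j u -> stage j (j X' P t ∘ u).

(* The Clifford eversion Cl(A).  Its objects are those of the Cl_n(A_i) with n
   congruent to i modulo p, the standard objects of a filtered 2-colimit; its
   morphisms are given by functors J : Cl_n(A_i) -> Cl(A) and isomorphisms
   j : J(M) -> J(M ⊗ U), natural for J, so that Mor X Y is the colimit of the
   spaces of morphisms from M ⊗ U^a to N ⊗ U^b in the Cl_n(A_i).  (The
   transition maps f |-> f ⊗ 1_U of this colimit are injective, whence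
   ev_faithful.)  The tensor product is that of A on the images of the J's; the
   tensor products of j with identities are determined by the identification
   of (M ⊗ U) ⊗ N with (M ⊗ N) ⊗ U that moves the block of generators of U
   past those of N.  Moving two blocks of generators of U past each other
   multiplies by the sign (-1)^(p(p-1)/2) after two moves; so, if not all tensor
   products in A are zero, the interchange law of Cl(A) can only hold when 4
   divides p. *)
Record eversion := Eversion {
  ev_cat :> monoidal k (clobjects A pq);
  evJ : forall X Y : clobj A p, Mor A (clob X) (clob Y) -> Mor ev_cat X Y;
  evj : forall (X : clobj A p) (P : O) (t : tensU A U (clob X) P),
    Mor ev_cat X (clU t);

  evJ_linear : forall (X Y : clobj A p) e c f g,
    clmor e X Y f -> clmor e X Y g ->
    @evJ X Y (c *: f + g) = c *: @evJ X Y f + @evJ X Y g;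
  evJ_homog : forall (X Y : clobj A p) e f, clmor e X Y f -> homog e (@evJ X Y f);
  evJ1 : forall X : clobj A p, @evJ X X (idm A (clob X)) = idm ev_cat X;
  evJ_comp : forall (X Y Z : clobj A p) e e' f g,
    clmor e X Y f -> clmor e' Y Z g ->
    @evJ X Z (g ∘ f) = @evJ Y Z g ∘ @evJ X Y f;

  evj_even : forall (X : clobj A p) P (t : tensU A U (clob X) P), homog false (evj t);
  evj_iso : forall (X : clobj A p) P (t : tensU A U (clob X) P), isom (evj t);
  evj_nat : forall (X Y : clobj A p) P Q
      (t : tensU A U (clob X) P) (t' : tensU A U (clob Y) Q) e f,
    clmor e X Y f -> @evJ (clU t) (clU t') (amp e t t' f) ∘ evj t = evj t' ∘ @evJ X Y f;

  ev_faithful : forall (X Y : clobj A p) e f,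
    clmor e X Y f -> @evJ X Y f = 0 -> f = 0;
  ev_full : forall (X Y : clobj A p) e (phi : Mor ev_cat X Y),
    deg (clob X) = deg (clob Y) -> homog e phi ->
    exists (X' Y' : clobj A p) (u : Mor ev_cat X X') (v : Mor ev_cat Y Y') f,
      [/\ stage evj u, stage evj v, clmor e X' Y' f & v ∘ phi = @evJ X' Y' f ∘ u];

  ev_tens : forall (X X' Y Y' : clobj A p) e e' f g,
    clmor e X X' f -> clmor e' Y Y' g ->
    @evJ X X' f ⊠ @evJ Y Y' g =
      @evJ (cltens pq X Y) (cltens pq X' Y') (f ⊠ g);
  ev_assoc : forall X Y Z : clobj A p,
    assoc ev_cat X Y Z =
      @evJ (cltens pq X (cltens pq Y Z)) (cltens pq (cltens pq X Y) Z)
        (assoc A (clob X) (clob Y) (clob Z));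
  ev_lunit : forall X : clobj A p,
    lunit ev_cat X = @evJ (cltens pq (clunit A p) X) X (lunit A (clob X));
  ev_runit : forall X : clobj A p,
    runit ev_cat X = @evJ (cltens pq X (clunit A p)) X (runit A (clob X));

  (* X ⊗ (Y ⊗ U) and (X ⊗ Y) ⊗ U have the same generators *)
  evj_tens_l : forall (X Y : clobj A p) P (t : tensU A U (clob Y) P),
    @evJ (cltens pq X (clU t)) (clU (X := cltens pq X Y) (tensU_l (clob X) t))
        (idm A (clob X ⊗ P))
      ∘ (idm ev_cat X ⊠ evj t) = evj (X := cltens pq X Y) (tensU_l (clob X) t);
  evj_tens_r : forall (X Y : clobj A p) P (t : tensU A U (clob X) P),
    @evJ (cltens pq (clU t) Y) (clU (X := cltens pq X Y) (tensU_r t (clob Y)))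
        (tau_inv ([seq ampU t (umx U j) ⊠ idm A (clob Y) | j <- enum 'I_p] ++
                  [seq idm A P ⊠ nu | nu <- clgens Y]) p (size (clgens Y)))
      ∘ (evj t ⊠ idm ev_cat Y) = evj (X := cltens pq X Y) (tensU_r t (clob Y)) }.

Arguments evJ : clear implicits.

Definition ev_braid (E : eversion) (b : forall M N : O, Mor A (M ⊗ N) (N ⊗ M))
    (X Y : clobjects A pq) : Mor E (X ⊗ Y) (Y ⊗ X) :=
  @evJ E (cltens pq X Y) (cltens pq Y X)
    (tau_inv ([seq idm A (clob Y) ⊠ mu | mu <- clgens X] ++
              [seq nu ⊠ idm A (clob X) | nu <- clgens Y])
             (size (clgens X)) (size (clgens Y))
       ∘ b (clob X) (clob Y)).

End Eversion.

(* Main.v *)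
(* In a list of Clifford generators, (b - a)/2 acts as the reflection exchanging
   a and b.  So tau^-1, for a list mu ++ nu of sizes r and s, is up to sign the
   product over all pairs of the elements (n - m)/2, and elements of disjoint
   pairs anticommute.  Rearranging this product shows how tau^-1 behaves when mu
   or nu is cut in two and when mu and nu are exchanged: the signs that appear
   are (-1)^(r s t), (-1)^(r s (t + C(t,2))) and (-1)^(r s + C(r,2) C(s,2)), the
   values of D and A on the sizes.  Transporting the generators through beta
   multiplies by a further sign when beta is odd, which cancels D.

   Sizes agree with degrees only modulo p, so these signs are well defined only if
   4 divides p.  If it does not, the interchange law of the eversion fails for the
   transition morphisms M -> M ⊗ U, unless all tensor products vanish.

   Every homogeneous morphism of the eversion becomes a morphism of A after
   composition with transition morphisms, so naturality has to be checked only for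
   these two kinds of morphisms. *)

Require Import Defs.
From mathcomp Require Import all_boot all_order all_algebra zify.

Set Implicit Arguments.
Unset Strict Implicit.
Unset Printing Implicit Defensive.

(* Defs again: ssrfun has its own compA. *)
Import Defs GRing.Theory.
Local Open Scope ring_scope.

(** All signs come from one notion, [intertwines]: a morphism of A carries one list of generators to
    another up to a uniform sign. A word of the spin group acts as a polynomial in the generators,
    so such a morphism passes through a block swap at the cost of that sign raised to the number of
    letters. Associators, b, morphisms of the Cl_n and block swaps themselves are all of this kind,
    so each exponent below counts letters that have been crossed.

    The asymmetry between A_1 = 1 and A_2 reflects the order of the factors in tau^-1. The word is
    built by recursion on nu, so cutting nu separates two complete groups of factors. Cutting mu
    instead has to disentangle interleaved factors: every pair of entries of nu makes a swap of one
    half of mu cross a swap of the other half, and this produces C(t,2).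

    The definition of the eversion is asymmetric too: j tensored with an identity on its right
    involves a swap of U with other generators. Sliding j through beta' in the second argument
    therefore meets the square of such a swap, and this is where C(p,2), and not only p, has to be
    even. *)

Lemma sign_eq (R : pzRingType) m n : odd m = odd n -> (-1 : R) ^+ m = (-1) ^+ n.
Proof. by move=> mn; rewrite -[LHS]signr_odd mn signr_odd. Qed.

Ltac sign_parity := apply: sign_eq; rewrite ?(oddD, oddM) /=;
  repeat match goal with |- context [odd ?x] => case: (odd x) end; done.

(** * Homogeneous morphisms, isomorphisms, tensoring with identities *)

Section Homogeneous.
Variables (k : fieldType) (V : svect k).
Implicit Types v w : V.

Lemma homog0 e : homog e (0 : V).
Proof. exact: spart0. Qed.

Lemma homogD e v w : homog e v -> homog e w -> homog e (v + w).
Proof.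
by move=> hv hw; have := spart_linear e 1 v w; rewrite !scale1r /homog hv hw.
Qed.

Lemma homogB e v w : homog e v -> homog e w -> homog e (v - w).
Proof. by move=> hv hw; apply: homogD => //; rewrite -scaleN1r; apply: homogZ. Qed.

Lemma homog_spart e v : homog e (spart e v).
Proof. by rewrite /homog spartK eqxx. Qed.

Lemma homog_unique v : homog false v -> homog true v -> v = 0.
Proof. by move=> hF hT; rewrite -hF -hT spartK. Qed.

End Homogeneous.

Section Isomorphisms.
Variables (k : fieldType) (q : int) (O : mobjects q) (A : monoidal k O).

Lemma isom_id (X : O) : isom (idm A X).
Proof. by exists (idm A X); rewrite comp1m. Qed.

Lemma isom_comp (X Y Z : O) (g : Mor A Y Z) (f : Mor A X Y) :
  isom g -> isom f -> isom (g ∘ f).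
Proof.
move=> [g' [g'g gg']] [f' [f'f ff']]; exists (f' ∘ g'); split.
  by rewrite -compA (compA g') g'g comp1m.
by rewrite -compA (compA f) ff' comp1m.
Qed.

Lemma isom_monic (X Y Z : O) (f : Mor A Y Z) (g h : Mor A X Y) :
  isom f -> f ∘ g = f ∘ h -> g = h.
Proof. by move=> [f' [f'f _]] e;
  rewrite -[g]comp1m -f'f -compA e compA f'f comp1m. Qed.

Lemma isom_epic (X Y Z : O) (f : Mor A X Y) (g h : Mor A Y Z) :
  isom f -> g ∘ f = h ∘ f -> g = h.
Proof. by move=> [f' [_ ff']] e;
  rewrite -[g]compm1 -ff' compA e -compA ff' compm1. Qed.

(** Composed with f, the component of g of the wrong parity is odd; it also equals an identity minus
    an even morphism, hence is even. So it vanishes, and f can be cancelled. *)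
Lemma inverse_homog (X Y : O) (f : Mor A X Y) (g : Mor A Y X) e :
  homog e f -> g ∘ f = idm A X -> f ∘ g = idm A Y -> homog e g.
Proof.
move=> hf gf fg; have := spart_sum g;
  have hg d : homog (e (+) d) (f ∘ spart d g) := comp_homog hf (homog_spart d g).
have E : f ∘ spart (~~ e) g = 0.
  have := hg (~~ e); rewrite addbN addbb; apply: homog_unique.
  have -> : f ∘ spart (~~ e) g = idm A Y - f ∘ spart e g.
    apply/eqP; rewrite eq_sym subr_eq -fg -compDr.
    by case: e {hf hg} => /=; last rewrite addrC; rewrite spart_sum.
  by apply: homogB; [exact: idm_even | have := hg e; rewrite addbb].
have E' : spart (~~ e) g = 0 by rewrite -[LHS]comp1m -gf -compA E comp0r.
by case: e E' {hf hg E} => /= ->; rewrite ?add0r ?addr0.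
Qed.

Lemma id0_mor (X Y : O) (f g : Mor A X Y) : idm A X = 0 -> f = g.
Proof. by move=> X0; rewrite -[f]compm1 -[g]compm1 X0 !comp0r. Qed.

Lemma id0_isom (X Y : O) (f : Mor A X Y) : isom f -> idm A Y = 0 -> idm A X = 0.
Proof. by move=> [g [<- _]] Y0; rewrite -(comp1m f) Y0 comp0l comp0r. Qed.

End Isomorphisms.

Section TensorOne.
Variables (k : fieldType) (q : int) (O : mobjects q) (A : monoidal k O).

(** The interchange law is given for homogeneous morphisms only; against an identity it carries no
    sign, so it extends to all morphisms by splitting into parities. *)
Lemma tensh1_comp (L X Y Z : O) (g : Mor A Y Z) (f : Mor A X Y) :
  (idm A L ⊠ g) ∘ (idm A L ⊠ f) = idm A L ⊠ (g ∘ f).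
Proof.
have hom e (h : Mor A Y Z) : homog e h ->
    (idm A L ⊠ h) ∘ (idm A L ⊠ f) = idm A L ⊠ (h ∘ f).
  by move=> hh; rewrite (tensh_comp _ _ (idm_even _ _) hh) expr0 scale1r comp1m.
rewrite -(spart_sum g) tenshDr !compDl tenshDr.
by rewrite !(hom _ _ (homog_spart _ _)).
Qed.

Lemma tensh_comp1 (L X Y Z : O) (g : Mor A Y Z) (f : Mor A X Y) :
  (g ⊠ idm A L) ∘ (f ⊠ idm A L) = (g ∘ f) ⊠ idm A L.
Proof.
have hom e (h : Mor A X Y) : homog e h ->
    (g ⊠ idm A L) ∘ (h ⊠ idm A L) = (g ∘ h) ⊠ idm A L.
  by move=> hh; rewrite (tensh_comp _ _ hh (idm_even _ _)) andbF expr0 scale1r comp1m.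
rewrite -(spart_sum f) tenshDl !compDr tenshDl.
by rewrite !(hom _ _ (homog_spart _ _)).
Qed.

Lemma tensh_split (X X' Y Y' : O) (f : Mor A X X') (g : Mor A Y Y') :
  f ⊠ g = (f ⊠ idm A Y') ∘ (idm A X ⊠ g).
Proof.
by rewrite (tensh_comp _ _ (idm_even _ _) (idm_even _ _)) scale1r compm1 comp1m.
Qed.

Lemma tensh_exchange (X X' Y Y' : O) (f : Mor A X X') (g : Mor A Y Y') e e' :
  homog e f -> homog e' g ->
  (idm A X' ⊠ g) ∘ (f ⊠ idm A Y) = (-1) ^+ (e && e') *: (f ⊠ g).
Proof. by move=> hf hg; rewrite (tensh_comp _ _ hf hg) comp1m compm1. Qed.

Lemma isom_tensl (X X' Y : O) (f : Mor A X X') : isom f -> isom (f ⊠ idm A Y).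
Proof.
by move=> [g [gf fg]]; exists (g ⊠ idm A Y); rewrite !tensh_comp1 gf fg !tensh1.
Qed.

Lemma isom_tensr (X Y Y' : O) (g : Mor A Y Y') : isom g -> isom (idm A X ⊠ g).
Proof.
by move=> [f [gf fg]]; exists (idm A X ⊠ f); rewrite !tensh1_comp gf fg !tensh1.
Qed.

End TensorOne.

(** * Block permutations of Clifford generators *)

Section Intertwiners.
Variables (k : fieldType) (q : int) (O : mobjects q) (A : monoidal k O).

(** The exponent is a natural number, so that word lengths and block sizes can be added and
    multiplied before reducing modulo 2. The index is unbounded because past the end both entries
    default to 0. *)
Definition intertwines n (X Y : O) (f : Mor A X Y) (s : seq (Mor A X X))
    (t : seq (Mor A Y Y)) : Prop :=
  size s = size t /\ forall i, f ∘ s`_i = (-1) ^+ n *: (t`_i ∘ f).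

Section Pair.
Variables (X Y : O) (f : Mor A X Y).
Implicit Types (s : seq (Mor A X X)) (t : seq (Mor A Y Y)).

Lemma intertwines_parity m n s t :
  odd m = odd n -> intertwines m f s t -> intertwines n f s t.
Proof. by move=> mn [sz e]; split=> // i; rewrite e (sign_eq _ mn). Qed.

Lemma intertwines_nil n : intertwines n f [::] [::].
Proof. by split=> // i; rewrite !nth_nil comp0l comp0r scaler0. Qed.

Lemma intertwines_cons n a b s t : f ∘ a = (-1) ^+ n *: (b ∘ f) ->
  intertwines n f s t -> intertwines n f (a :: s) (b :: t).
Proof. by move=> ab [sz e]; split=> [|[|i]] //=; rewrite sz. Qed.

Lemma intertwines_cat n s1 s2 t1 t2 : intertwines n f s1 t1 ->
  intertwines n f s2 t2 -> intertwines n f (s1 ++ s2) (t1 ++ t2).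
Proof.
move=> [sz1 e1] [sz2 e2]; split; first by rewrite !size_cat sz1 sz2.
by move=> i; rewrite !nth_cat sz1; case: ifP.
Qed.

Lemma intertwines_behead n s t :
  intertwines n f s t -> intertwines n f (behead s) (behead t).
Proof. by move=> [sz e]; split=> [|i]; rewrite ?size_behead ?sz // !nth_behead. Qed.

Lemma intertwines_map n (I : eqType) (r : seq I) F G :
  (forall x, x \in r -> f ∘ F x = (-1) ^+ n *: (G x ∘ f)) ->
  intertwines n f (map F r) (map G r).
Proof.
elim: r => [|x r IH] e /=; first exact: intertwines_nil.
apply: intertwines_cons; first by rewrite e ?mem_head.
by apply: IH => y yr; apply: e; rewrite in_cons yr orbT.
Qed.

Lemma intertwines_isom n s t (g : Mor A Y X) : g ∘ f = idm A X ->
  f ∘ g = idm A Y -> intertwines n f s t -> intertwines n g t s.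
Proof.
move=> gf fg [sz e]; split=> // i.
apply: (isom_monic (f := f)); first by exists g.
by rewrite compZr !compA fg comp1m e compZl -compA fg compm1 signrZK.
Qed.

End Pair.

Lemma intertwines_comp m n (X Y Z : O) (f : Mor A X Y) (g : Mor A Y Z) s t u :
  intertwines m f s t -> intertwines n g t u -> intertwines (m + n) (g ∘ f) s u.
Proof.
move=> [sz1 e1] [sz2 e2]; split; first by rewrite sz1.
by move=> i; rewrite -compA e1 compZr compA e2 compZl scalerA -compA exprD.
Qed.

Lemma intertwinesZ n c (X Y : O) (f : Mor A X Y) s t :
  intertwines n f s t -> intertwines n (c *: f) s t.
Proof. by move=> [sz e]; split=> // i; rewrite compZl e compZr !scalerA mulrC. Qed.

Lemma intertwines_id (X : O) s : intertwines 0 (idm A X) s s.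
Proof. by split=> // i; rewrite comp1m compm1 scale1r. Qed.

Lemma intertwine_reflection n (X Y : O) (f : Mor A X Y) a b a' b' :
  f ∘ a = (-1) ^+ n *: (a' ∘ f) -> f ∘ b = (-1) ^+ n *: (b' ∘ f) ->
  f ∘ (2%:R^-1 *: (a - b)) = (-1) ^+ n *: ((2%:R^-1 *: (a' - b')) ∘ f).
Proof.
move=> ea eb; rewrite compZr compZl scalerA mulrC -scalerA -!scaleN1r.
by rewrite compDr compZr ea eb compDl compZl !scalerDr !scalerA (mulrAC _ (-1)).
Qed.

(* The spin action is polynomial in the generators, hence passes through any
   morphism that exchanges two lists of generators up to a uniform sign. *)
Lemma spin_act_intertwines n (X Y : O) (f : Mor A X Y) s t w :
  intertwines n f s t ->
  f ∘ spin_act s w = (-1) ^+ (n * size w) *: (spin_act t w ∘ f).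
Proof.
move=> [_ e]; elim: w => [|i w IH] /=.
  by rewrite muln0 scale1r compm1 comp1m.
rewrite compA (intertwine_reflection (e i) (e i.-1)) compZl -compA IH.
by rewrite compZr scalerA -exprD -mulnS compA.
Qed.

Lemma spin_act_cat (X : O) (s : seq (Mor A X X)) w w' :
  spin_act s (w ++ w') = spin_act s w ∘ spin_act s w'.
Proof. by elim: w => [|i w IH] /=; rewrite ?comp1m // IH compA. Qed.

(** Letter i involves the entries i and i - 1. The letter 0 is excluded because its predecessor is
    again 0. *)
Lemma spin_act_succ (X : O) (s : seq (Mor A X X)) w : all (leq 1) w ->
  spin_act s (map succn w) = spin_act (behead s) w.
Proof. by elim: w => [|[|i] w IH] //= iw; rewrite IH // !nth_behead. Qed.

Lemma spin_act_prefix (X : O) (s t : seq (Mor A X X)) w :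
  all (fun i => i < size s)%N w -> spin_act (s ++ t) w = spin_act s w.
Proof.
elim: w => [|i w IH] //= /andP[li lw]; rewrite IH // !nth_cat li.
by rewrite (leq_ltn_trans (leq_pred i) li).
Qed.

Lemma spin_act_homog (X : O) (s : seq (Mor A X X)) w :
  (forall f, f \in s -> homog true f) -> homog (odd (size w)) (spin_act s w).
Proof.
move=> hs; elim: w => [|i w IH] /=; first exact: idm_even.
have hn j : homog true s`_j.
  by case: (ltnP j (size s)) => [/(mem_nth 0)/hs|/(nth_default 0)->];
    last exact: homog0.
by apply: (comp_homog (e := true)) IH; apply/homogZ/homogB.
Qed.

End Intertwiners.

Lemma size_tau_word n m : size (tau_word n m) = (n * m)%N.
Proof.
rewrite size_flatten /shape -map_comp sumnE big_map.
rewrite (eq_bigr (fun => n)) => [|i _]; last by rewrite /= size_iota.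
by rewrite big_const_seq count_predT size_rev size_iota iter_addn_0.
Qed.

(** Peels off the first entry of the second block: sigma_(n,1) is the last factor of tau, so its
    inverse comes first in tau^-1, and the other factors are those of the smaller tau shifted by
    one. *)
Lemma rev_tau_wordS n m : rev (tau_word n m.+1) =
  rev (iota 1 n) ++ map succn (rev (tau_word n m)).
Proof.
rewrite /tau_word [iota 1 m.+1]/= rev_cons map_rcons flatten_rcons rev_cat.
rewrite (map_rev succn) map_flatten -map_comp (iotaDl 1 1 m) -(map_rev (addn 1))
  -map_comp.
congr (_ ++ rev (flatten _)); apply: eq_map => i /=.
exact: (iotaDl 1 i n).
Qed.

Lemma tau_word_letters n m :
  all (fun i => (1 <= i) && (i < n + m))%N (rev (tau_word n m)).
Proof.
rewrite all_rev; apply/allP=> i /flatten_mapP[j]; rewrite mem_rev !mem_iota.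
by lia.
Qed.

Section CliffordLists.
Variables (k : fieldType) (q : int) (O : mobjects q) (A : monoidal k O).

(* The element tau^-1 of the context, acting through the list mu ++ nu. *)
Definition block_swap (X : O) (mu nu : seq (Mor A X X)) : Mor A X X :=
  tau_inv (mu ++ nu) (size mu) (size nu).

Variable X : O.
Implicit Types (a b f g : Mor A X X) (s mu nu : seq (Mor A X X)).

Definition anticommute f g := f ∘ g == - (g ∘ f).

Definition clifford_gen f := (spart true f == f) && (f ∘ f == 2%:R *: idm A X).

(** Boolean form of [clifford_gens]: [pairwise] over a symmetric relation passes to permutations and
    subsequences, as the cutting of blocks requires. *)
Definition clifford s := all clifford_gen s && pairwise anticommute s.

Lemma anticommuteC f g : anticommute f g = anticommute g f.
Proof. by rewrite /anticommute -[in RHS]eqr_oppLR eq_sym. Qed.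

Lemma cliffordP s : clifford_gens s <-> clifford s.
Proof.
split=> [[os qs aS]|/andP[/all_nthP gs /(pairwiseP 0) aS]].
  apply/andP; split.
    by apply/(all_nthP 0)=> i li; rewrite /clifford_gen qs // eqxx andbT;
      apply/eqP/os.
  by apply/(pairwiseP 0)=> i j li lj ij; apply/eqP/aS; rewrite // neq_ltn ij.
split=> [i li|i li|i j li lj]; try by have /andP[/eqP ? /eqP ?] := gs 0 i li.
by rewrite neq_ltn => /orP[/aS|/aS]; [|rewrite anticommuteC]; move=> h; apply/eqP/h.
Qed.

Lemma clifford_cat s1 s2 :
  clifford (s1 ++ s2) = [&& clifford s1, clifford s2 & allrel anticommute s1 s2].
Proof.
rewrite /clifford all_cat pairwise_cat.
by case: all; case: all; case: allrel; case: pairwise; case: pairwise.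
Qed.

Lemma allrel_anticommuteC s1 s2 :
  allrel anticommute s1 s2 = allrel anticommute s2 s1.
Proof. by rewrite allrelC; apply: eq_allrel => f g; rewrite anticommuteC. Qed.

Lemma clifford_catC s1 s2 : clifford (s1 ++ s2) = clifford (s2 ++ s1).
Proof. by rewrite !clifford_cat allrel_anticommuteC andbCA. Qed.

Lemma perm_clifford s1 s2 : perm_eq s1 s2 -> clifford s1 = clifford s2.
Proof.
apply: catCA_perm_subst => {}s1 {}s2 s3.
rewrite !catA clifford_cat (clifford_catC s1) [RHS]clifford_cat.
by rewrite !allrel_catl [allrel _ s1 s3 && _]andbC.
Qed.

Lemma clifford_subseq s1 s2 : subseq s1 s2 -> clifford s2 -> clifford s1.
Proof.
move=> s12 /andP[/allP gs aS]; rewrite /clifford (subseq_pairwise s12 aS) andbT.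
by apply/allP=> f /(mem_subseq s12)/gs.
Qed.

Lemma anticommute_intertwines f s :
  all (anticommute f) s -> intertwines 1 f s s.
Proof.
move=> /(all_nthP 0) fs; split=> // i; rewrite scaleN1r.
by case: (ltnP i (size s)) => [/fs/eqP //|/(nth_default 0)->];
  rewrite comp0l comp0r oppr0.
Qed.

Lemma block_swap_nilr mu : block_swap mu [::] = idm A X.
Proof. by rewrite /block_swap /tau_inv /tau_word. Qed.

Lemma block_swap_nill nu : block_swap [::] nu = idm A X.
Proof.
rewrite /block_swap /tau_inv; have := size_tau_word 0 (size nu).
by case: (tau_word 0 _).
Qed.

Lemma block_swap_homog mu nu : clifford (mu ++ nu) ->
  homog (odd (size mu * size nu)) (block_swap mu nu).
Proof.
rewrite /block_swap /tau_inv => /andP[/allP gs _];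
  rewrite -size_tau_word -(size_rev (tau_word _ _)).
by apply: spin_act_homog => f /gs/andP[/eqP].
Qed.

Lemma block_swap_transport n (Y : O) (f : Mor A X Y) mu nu
    (mu' nu' : seq (Mor A Y Y)) :
  intertwines n f mu mu' -> intertwines n f nu nu' ->
  f ∘ block_swap mu nu =
    (-1) ^+ (n * (size mu * size nu)) *: (block_swap mu' nu' ∘ f).
Proof.
move=> fmu fnu; have [smu _] := fmu; have [snu _] := fnu.
rewrite /block_swap /tau_inv -smu -snu -(size_tau_word (size mu))
  -(size_rev (tau_word _ _)).
by apply: spin_act_intertwines; apply: intertwines_cat.
Qed.

(** What anticommutes with a and b anticommutes with (b - a)/2, so it picks up one sign per letter
    of the word. *)
Lemma block_swap_fix mu nu s : allrel anticommute s (mu ++ nu) ->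
  intertwines (size mu * size nu) (block_swap mu nu) s s.
Proof.
move=> /allrelP fs; split=> // i.
case: (ltnP i (size s)) => [li|/(nth_default 0)->]; last first.
  by rewrite comp0r comp0l scaler0.
have /anticommute_intertwines/spin_act_intertwines h : all (anticommute s`_i) (mu ++
  nu).
  by apply/allP=> g gs; apply: fs => //; apply: mem_nth.
by rewrite /block_swap /tau_inv h mul1n size_rev size_tau_word signrZK.
Qed.

Definition reflection a b : Mor A X X := 2%:R^-1 *: (a - b).

Lemma reflectionC a b : reflection b a = - reflection a b.
Proof. by rewrite /reflection -scalerN opprB. Qed.

Section TwoInvertible.
Hypothesis two_neq0 : 2%:R != 0 :> k.

Lemma reflection_swap a b : clifford [:: a; b] ->
  reflection a b ∘ b = - (a ∘ reflection a b).
Proof.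
rewrite /clifford /= !andbT => /andP[/andP[/andP[_ /eqP aa] /andP[_ /eqP bb]] _].
rewrite compZl compZr -scalerN -!scaleN1r; congr (_ *: _).
by rewrite compDl compDr compZl compZr !scaleN1r aa bb opprB.
Qed.

(** In the square, ab and ba cancel, and a^2 + b^2 = 4 cancels the factor 1/4. *)
Lemma reflectionK a b : clifford [:: a;
  b] -> reflection a b ∘ reflection a b = idm A X.
Proof.
rewrite /clifford /= !andbT => /andP[/andP[/andP[_ /eqP aa] /andP[_ /eqP bb]] /eqP
  ab].
rewrite compZl compZr scalerA -!scaleN1r compDl !compDr !compZl !compZr aa bb ab.
rewrite !scaleN1r !opprK addrA addrK -scalerDl scalerA.
have -> : (2 + 2 : k) = 2 * 2 by rewrite -natrD -natrM.
by rewrite mulrACA !mulVf ?mulr1 ?scale1r.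
Qed.

End TwoInvertible.
End CliffordLists.

Section BlockSwap.
Variables (k : fieldType) (two_neq0 : 2%:R != 0 :> k).
Variables (q : int) (O : mobjects q) (A : monoidal k O) (X : O).
Implicit Types (m n : Mor A X X) (mu nu : seq (Mor A X X)).

Lemma block_swap1E mu n nu :
  spin_act (mu ++ n :: nu) (rev (iota 1 (size mu))) = block_swap mu [:: n].
Proof.
rewrite -cat_rcons -cats1 spin_act_prefix /block_swap /tau_inv.
  by rewrite rev_tau_wordS /= cats0.
by apply/allP=> i; rewrite mem_rev mem_iota size_cat /=; lia.
Qed.

(** Only the last letter, s_1, involves [m]; the others form the word for [mu] shifted by one. *)
Lemma block_swap1_headE m mu n : block_swap (m :: mu) [:: n] =
  block_swap mu [:: n] ∘ reflection (mu ++ [:: n])`_0 m.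
Proof.
rewrite -(block_swap1E _ _ [::]) [iota _ _]/= rev_cons -cats1 spin_act_cat.
rewrite (iotaDl 1 1) -(map_rev (addn 1)) spin_act_succ ?block_swap1E /= ?compm1 //.
by apply/allP=> i; rewrite mem_rev mem_iota => /andP[].
Qed.

Lemma block_swap11 m n : block_swap [:: m] [:: n] = reflection n m.
Proof. by rewrite block_swap1_headE block_swap_nill comp1m. Qed.

Lemma reflection_intertwines m n mu : clifford (m :: n :: mu) ->
  intertwines 1 (reflection n m) (m :: n :: mu) (n :: m :: mu).
Proof.
rewrite -[m :: _]/([:: m; n] ++ mu) clifford_cat => /and3P[cmn _ mnmu].
have cnm : clifford [:: n; m] by rewrite (clifford_catC [:: n] [:: m]).
do 2?[apply: intertwines_cons]; rewrite ?scaleN1r.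
- exact: reflection_swap.
- by rewrite reflectionC -scaleN1r compZl compZr reflection_swap // !scaleN1r opprK.
rewrite -block_swap11; apply: block_swap_fix.
by rewrite allrel_anticommuteC.
Qed.

(** The two claims support each other. The swap for [mu] carries the first entry of [mu ++ [:: n]]
    to [n] and keeps [m], up to sign, so the adjacent reflection of [block_swap1_headE] becomes the
    reflection of the pair n, m once moved to the left; this factorization yields the intertwining
    for [m :: mu]. Adjacent transpositions are thus replaced by reflections indexed by pairs. *)
Lemma block_swap1 mu n : clifford (mu ++ [:: n]) ->
  intertwines (size mu) (block_swap mu [:: n]) (mu ++ [:: n]) (n :: mu) /\
  forall m, clifford (m :: mu ++ [:: n]) -> block_swap (m :: mu) [:: n] =
    (-1) ^+ size mu *: (reflection n m ∘ block_swap mu [:: n]).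
Proof.
have step m mu' : clifford (m :: mu' ++ [:: n]) ->
    intertwines (size mu') (block_swap mu' [:: n]) (mu' ++ [:: n]) (n :: mu') ->
    intertwines (size mu') (block_swap mu' [:: n]) (m :: mu' ++ [:: n])
      (m :: n :: mu') /\
    block_swap (m :: mu') [:: n] =
      (-1) ^+ size mu' *: (reflection n m ∘ block_swap mu' [:: n]).
  rewrite -cat1s clifford_cat => /and3P[_ _ /block_swap_fix].
  rewrite /= muln1 => fix_m h; split; first exact: intertwines_cat fix_m h.
  rewrite block_swap1_headE; apply: intertwine_reflection.
    by have [_ /(_ 0)] := h.
  by have [_ /(_ 0)] := fix_m.
move=> cl; suff h : intertwines (size mu) (block_swap mu [:: n]) (mu ++ [:: n])
  (n :: mu).
  by split=> // m cm; have [] := step m mu cm h.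
elim: mu cl => [|m mu IH] cl.
  by rewrite block_swap_nill; apply: intertwines_id.
have clmu : clifford (mu ++ [:: n]).
  by move: cl; rewrite /= -cat1s clifford_cat => /and3P[].
have [h ->] := step _ _ cl (IH clmu).
apply/intertwinesZ/(@intertwines_parity _ _ _ _ _ _ _ (size mu + 1)).
  by rewrite addn1.
apply: intertwines_comp h _; apply: reflection_intertwines.
by rewrite (perm_clifford (s2 := m :: mu ++ [:: n])) // perm_cons -cat1s perm_catC.
Qed.

Lemma clifford_mid mu n nu : clifford (mu ++ n :: nu) ->
  [/\ clifford (mu ++ [:: n]), clifford (mu ++ nu),
      allrel (anticommute (X := X)) nu (mu ++ [:: n])
    & allrel (anticommute (X := X)) [:: n] (mu ++ nu)].
Proof.
move=> cl; have := cl; rewrite -cat_rcons -cats1 clifford_cat.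
rewrite allrel_anticommuteC => /and3P[-> _ ->].
have : clifford ([:: n] ++ mu ++ nu).
  by rewrite (perm_clifford (permEl (perm_catCA [:: n] mu nu))).
by rewrite clifford_cat => /and3P[_ -> ->].
Qed.

Lemma block_swap_consr mu n nu : clifford (mu ++ n :: nu) ->
  block_swap mu (n :: nu) =
    (-1) ^+ (size mu * size nu) *: (block_swap mu nu ∘ block_swap mu [:: n]).
Proof.
move=> /clifford_mid[cl _ fix_nu _]; have [h _] := block_swap1 cl.
have {fix_nu} := block_swap_fix fix_nu; rewrite /= muln1 => fix_nu.
(* The shifted letters act through the tail of [mu ++ n :: nu]; moving the swap of [n] to their
   right replaces this tail by [mu ++ nu]. With r and t the sizes of [mu] and [nu], each of the r t
   letters costs r signs, and r^2 t has the parity of r t. *)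
have := intertwines_behead (intertwines_cat h fix_nu); rewrite -catA /= => hb.
rewrite {1}/block_swap /tau_inv rev_tau_wordS spin_act_cat block_swap1E.
rewrite spin_act_succ; last first.
  by apply/allP=> i /(allP (tau_word_letters _ _))/andP[].
rewrite (spin_act_intertwines _ hb) size_rev size_tau_word.
by congr (_ *: _); sign_parity.
Qed.

Lemma block_swap_intertwines mu nu : clifford (mu ++ nu) ->
  intertwines (size mu * size nu) (block_swap mu nu) (mu ++ nu) (nu ++ mu).
Proof.
elim: nu => [|n nu IH] cl.
  by rewrite block_swap_nilr muln0 cats0; apply: intertwines_id.
rewrite (block_swap_consr cl); apply: intertwinesZ.
have [cl1 clnu fix_nu fix_n] := clifford_mid cl; rewrite mulnS.
have [h _] := block_swap1 cl1.
have := block_swap_fix fix_nu; rewrite /= muln1 => fix_nu'.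
have := intertwines_cat h fix_nu'; rewrite -catA /= => h1.
apply: intertwines_comp h1 _.
exact: (intertwines_cat (block_swap_fix fix_n) (IH clnu)).
Qed.

(** By [block_swap_consr] each entry of [nu1] costs the size of [mu] times the number of later
    entries. Those inside [nu1] are counted on both sides, so only the pairs across the cut
    remain. *)
Lemma block_swap_catr mu nu1 nu2 : clifford (mu ++ nu1 ++ nu2) ->
  block_swap mu (nu1 ++ nu2) =
    (-1) ^+ (size mu * size nu1 * size nu2) *:
      (block_swap mu nu2 ∘ block_swap mu nu1).
Proof.
elim: nu1 => [|n nu1 IH] cl /=.
  by rewrite muln0 scale1r block_swap_nilr compm1.
have [_ cl2 _ _] := clifford_mid cl.
have cl1 : clifford (mu ++ n :: nu1).
  by apply: clifford_subseq cl; rewrite catA prefix_subseq.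
rewrite (block_swap_consr (nu := nu1 ++ nu2) cl) (block_swap_consr cl1) IH //.
rewrite compZl compZr !scalerA compA size_cat -!exprD.
by congr (_ *: _); sign_parity.
Qed.

Lemma block_swap1_cat mu1 mu2 n : clifford (mu1 ++ mu2 ++ [:: n]) ->
  block_swap (mu1 ++ mu2) [:: n] =
    (-1) ^+ (size mu1 * size mu2) *:
      (block_swap mu1 [:: n] ∘ block_swap mu2 [:: n]).
Proof.
elim: mu1 => [|m mu1 IH] cl /=.
  by rewrite scale1r block_swap_nill comp1m.
have clc : clifford ((mu1 ++ mu2) ++ [:: n]).
  by apply: clifford_subseq cl; rewrite -catA subseq_cons.
have cl1 : clifford (m :: mu1 ++ [:: n]).
  apply: clifford_subseq cl.
  exact: (cat_subseq (subseq_refl (m :: mu1)) (suffix_subseq mu2 [:: n])).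
have [_ ->] := block_swap1 clc; last by rewrite -catA.
have [_ ->] // := block_swap1 (clifford_subseq (subseq_cons _ _) cl1).
rewrite IH ?catA // (compZr (_ ^+ _)) (compZl (_ ^+ _))
  !scalerA compA size_cat -!exprD.
by congr (_ *: _); sign_parity.
Qed.

(** Each entry n of [nu] contributes the product of the sizes of [mu1] and [mu2] through
    [block_swap1_cat]. The swap of [mu2] with the later entries then crosses the swap of [mu1] with
    n, which contributes this product once more for every pair of entries of [nu]. *)
Lemma block_swap_catl mu1 mu2 nu : clifford (mu1 ++ mu2 ++ nu) ->
  block_swap (mu1 ++ mu2) nu =
    (-1) ^+ (size mu1 * size mu2 * (size nu + 'C(size nu, 2))) *:
      (block_swap mu1 nu ∘ block_swap mu2 nu).
Proof.
elim: nu => [|n nu IH] cl.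
  by rewrite !block_swap_nilr comp1m muln0 scale1r.
have clc : clifford ((mu1 ++ mu2) ++ n :: nu) by rewrite -catA.
have [cln clnu _ fix_n] := clifford_mid clc.
have cl1 : clifford (mu1 ++ n :: nu).
  by apply: clifford_subseq cl; rewrite subseq_cat2l suffix_subseq.
have cl2 : clifford (mu2 ++ n :: nu).
  by apply: clifford_subseq cl; rewrite suffix_subseq.
have h : clifford ((mu1 ++ [:: n]) ++ (mu2 ++ nu)).
  rewrite (perm_clifford (s2 := mu1 ++ mu2 ++ n :: nu)) // -catA perm_cat2l.
  exact: permEl (perm_catCA [:: n] mu2 nu).
have {h} := h; rewrite clifford_cat allrel_anticommuteC allrel_catl => /and3P[_ _
  /andP[fix2 fixnu]].
have := block_swap_transport (block_swap_fix fix2) (block_swap_fix fixnu).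
rewrite /= muln1 => comm.
rewrite (block_swap_consr clc) (block_swap_consr cl1) (block_swap_consr cl2).
rewrite IH ?catA // block_swap1_cat ?catA //.
rewrite !(compZl, compZr) !scalerA -!compA.
rewrite [block_swap mu2 nu ∘ (_ ∘ _)]compA.
have -> : block_swap mu2 nu ∘ block_swap mu1 [:: n] =
    (-1) ^+ (size mu1 * (size mu2 * size nu))
      *: (block_swap mu1 [:: n] ∘ block_swap mu2 nu).
  by rewrite comm signrZK.
rewrite !(compZl, compZr) !scalerA -!compA -!exprD binS bin1 size_cat.
by congr (_ *: _); sign_parity.
Qed.

(** Up to sign both factors are products of the reflections of [n] with the entries of [mu], in
    opposite orders, and cancel from the middle outwards. As [reflection m n] is minus
    [reflection n m], each entry leaves one sign. *)
Lemma block_swap_inv1 mu n : clifford (mu ++ [:: n]) ->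
  block_swap [:: n] mu ∘ block_swap mu [:: n] = (-1) ^+ size mu *: idm A X.
Proof.
elim: mu => [|m mu IH] cl.
  by rewrite block_swap_nill block_swap_nilr comp1m scale1r.
have cln : clifford (mu ++ [:: n]) := clifford_subseq (subseq_cons _ _) cl.
have [_ -> //] := block_swap1 cln.
have cl' : clifford ([:: n] ++ m :: mu) by rewrite clifford_catC.
rewrite (block_swap_consr (mu := [:: n]) cl') !block_swap11.
have -> : reflection m n = (-1) ^+ 1 *: reflection n m.
  by rewrite expr1 scaleN1r reflectionC.
have cnm : clifford [:: n; m] by apply: clifford_subseq cl'; rewrite /= !eqxx sub0seq.
rewrite (compZr ((-1) ^+ 1)) (compZl (_ ^+ _)) (compZr (_ ^+ _)) (compZl (_ ^+ _)).
rewrite -!compA [reflection _ _ ∘ (_ ∘ _)]compA reflectionK // comp1m IH //.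
rewrite !scalerA -!exprD; congr (_ *: _); sign_parity.
Qed.

(** With r and s the sizes, r s is one sign per pair, as in [block_swap_inv1]. Cutting an entry off
    the first block by [block_swap_catl] gives C(r,2) for each later entry of [nu], and these add up
    to C(r,2) C(s,2). *)
Lemma block_swapK mu nu : clifford (mu ++ nu) ->
  block_swap nu mu ∘ block_swap mu nu =
    (-1) ^+ (size mu * size nu + 'C(size mu, 2) * 'C(size nu, 2)) *: idm A X.
Proof.
elim: nu => [|n nu IH] cl.
  by rewrite block_swap_nill block_swap_nilr comp1m /= bin0n !muln0 scale1r.
have [cln clnu _ _] := clifford_mid cl.
have cl' : clifford ([:: n] ++ nu ++ mu) by rewrite catA clifford_catC.
rewrite (block_swap_catl (mu1 := [:: n]) cl').
rewrite (block_swap_consr cl) !(compZl, compZr) !scalerA -!compA.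
rewrite [block_swap nu mu ∘ (_ ∘ _)]compA IH // compZl comp1m compZr.
rewrite block_swap_inv1 // !scalerA -!exprD binS bin1.
by congr (_ *: _); sign_parity.
Qed.

Lemma block_swap_isom mu nu : clifford (mu ++ nu) -> isom (block_swap mu nu).
Proof.
move=> cl; have cl' : clifford (nu ++ mu) by rewrite clifford_catC.
have := block_swapK cl; have := block_swapK cl'.
rewrite (mulnC (size nu)) (mulnC 'C(size nu, 2)); set n := (_ + _)%N => e e'.
(* The exponent is symmetric in the two sizes, so one multiple of the opposite swap is an inverse on
   both sides. *)
by exists ((-1) ^+ n *: block_swap nu mu); rewrite compZl compZr e e' signrZK.
Qed.

End BlockSwap.

Local Notation "s ◁ N" := [seq f ⊠ idm _ N | f <- s]
  (at level 39, left associativity).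
Local Notation "M ▷ s" := [seq idm _ M ⊠ f | f <- s] (at level 39).

(** * Tensor products with U *)

Section Functoriality.
Variables (k : fieldType) (q : int) (O : mobjects q) (A : monoidal k O).

Lemma spin_act_map (X Y : O) (F : Mor A X X -> Mor A Y Y) (s : seq (Mor A X X)) w :
  linear F -> F (idm A X) = idm A Y ->
  (forall f g, F (f ∘ g) = F f ∘ F g) ->
  F (spin_act s w) = spin_act (map F s) w.
Proof.
move=> linF F1 Fcomp; have F0 : F 0 = 0.
  by have := linF (-1) 0 0; rewrite scaleN1r oppr0 addr0 scaleN1r addNr.
have FZ c f : F (c *: f) = c *: F f by have := linF c f 0; rewrite F0 !addr0.
have nthF i : (map F s)`_i = F s`_i.
  by case: (ltnP i (size s)) => li; [exact: nth_map|rewrite !nth_default ?size_map].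
elim: w => [|i w IH] //=; rewrite Fcomp IH FZ !nthF; congr (_ *: _ ∘ _).
by rewrite -!scaleN1r addrC linF addrC.
Qed.

Lemma block_swap_tensl (X Y : O) (mu nu : seq (Mor A X X)) :
  block_swap mu nu ⊠ idm A Y =
    block_swap [seq f ⊠ idm A Y | f <- mu] [seq f ⊠ idm A Y | f <- nu].
Proof.
rewrite /block_swap !size_map -map_cat.
apply: (spin_act_map (F := fun f => f ⊠ idm A Y)).
- exact: tensh_linear_l.
- exact: tensh1.
by move=> f g; rewrite tensh_comp1.
Qed.

Lemma block_swap_tensr (X Y : O) (mu nu : seq (Mor A X X)) :
  idm A Y ⊠ block_swap mu nu =
    block_swap [seq idm A Y ⊠ f | f <- mu] [seq idm A Y ⊠ f | f <- nu].
Proof.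
rewrite /block_swap !size_map -map_cat.
apply: (spin_act_map (F := fun f => idm A Y ⊠ f)).
- exact: tensh_linear_r.
- exact: tensh1.
by move=> f g; rewrite tensh1_comp.
Qed.

Variables (p : nat) (U : clmod k p).

Lemma ampD e (M P N Q : O) (t : tensU A U M P) (t' : tensU A U N Q) (f g : Mor A M N)
  :
  amp e t t' (f + g) = amp e t t' f + amp e t t' g.
Proof.
by rewrite /amp -big_split; apply: eq_bigr => x _; rewrite compDr compDl scalerDr.
Qed.

(** [spin_act_map] does not apply, because [amp] takes the parity of its argument as a parameter;
    for a word this is its length modulo 2. *)
Lemma amp_spin_act (M P : O) (t : tensU A U M P) (s : seq (Mor A M M)) w :
  amp (odd (size w)) t t (spin_act s w) = spin_act [seq amp true t t f | f <- s] w.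
Proof.
have amp0 : amp true t t (0 : Mor A M M) = 0.
  by have := ampZ true t t 0 (0 : Mor A M M); rewrite !scale0r.
have nthF i : [seq amp true t t f | f <- s]`_i = amp true t t s`_i.
  by case: (ltnP i (size s)) => li; [exact: nth_map|rewrite !nth_default ?size_map].
elim: w => [|i w IH] /=; first exact: amp1.
rewrite -IH !nthF -!scaleN1r -(ampZ _ _ _ (-1)) -ampD -ampZ amp_comp.
by rewrite addbT.
Qed.

Lemma amp_block_swap (M P : O) (t : tensU A U M P) (mu nu : seq (Mor A M M)) :
  amp (odd (size mu * size nu)) t t (block_swap mu nu) =
    block_swap [seq amp true t t f | f <- mu] [seq amp true t t f | f <- nu].
Proof.
rewrite /block_swap /tau_inv !size_map -map_cat -amp_spin_act.
by rewrite size_rev size_tau_word.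
Qed.

(** A nonzero entry of an odd matrix joins basis vectors of opposite parity, so the signs of [amp]
    at its two ends differ by (-1)^e. *)
Lemma amp_ampU2 e (M P N Q : O) (t : tensU A U M P) (t' : tensU A U N Q)
    (f : Mor A M N) (B : matrix_superalg k (um U) (un U)) :
  homog true B -> amp e t t' f ∘ ampU t B = (-1) ^+ e *: (ampU t' B ∘ amp e t t' f).
Proof.
move=> /mx_homogP h; rewrite /amp /ampU comp_suml [in RHS]comp_suml.
rewrite scaler_sumr; apply: eq_bigr => x _.
rewrite comp_sumr (bigD1 x) //= [X in _ + X]big1 ?addr0; last first.
  move=> y yx; rewrite comp_sumr big1 // => z _.
  by rewrite compZr compZl tprK eq_sym (negPf yx) !scaler0.
rewrite comp_suml comp_sumr scaler_sumr; apply: eq_bigr => y _.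
rewrite comp_sumr (bigD1 y) //= [X in _ + X]big1 ?addr0; last first.
  by move=> z zy; rewrite compZl compZr -[tin t' z ∘ f ∘ _]compA tprK eq_sym (negPf
    zy) !scaler0.
rewrite !compZl !compZr -[tin t' y ∘ f ∘ _]compA !tprK !eqxx !scalerA compA.
congr (_ *: _); have [ixy|/h ->] := eqVneq (ipar x (+) ipar y) true; last first.
  by rewrite ?(mulr0, mul0r).
by case: (ipar x) (ipar y) e ixy => [] [] [] //= _;
  rewrite ?expr0 ?expr1 ?mulN1r ?mulrN ?mulr1 ?mul1r ?opprK.
Qed.

Lemma clmorP e (X Y : clobj A p) f :
  clmor e X Y f <-> homog e f /\ intertwines e f (clgens X) (clgens Y).
Proof.
split=> [[sz hf ef]|[hf [sz ef]]]; last by split.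
split=> //; split=> // i; case: (ltnP i (size (clgens X))) => [/ef //|li].
by rewrite !nth_default -?sz // comp0l comp0r scaler0.
Qed.

Lemma clmor_id (X : clobj A p) : clmor false X X (idm A (clob X)).
Proof. by apply/clmorP; split; [exact: idm_even|exact: intertwines_id]. Qed.

Lemma clmor_comp e e' (X Y Z : clobj A p) f g :
  clmor e X Y f -> clmor e' Y Z g -> clmor (e (+) e') X Z (g ∘ f).
Proof.
move=> /clmorP[hf f_] /clmorP[hg g_]; apply/clmorP; split.
  by rewrite addbC; apply: comp_homog.
by apply: intertwines_parity (intertwines_comp f_ g_); rewrite oddD !oddb.
Qed.

Lemma clmor_inv e (X Y : clobj A p) f g : clmor e X Y f ->
  g ∘ f = idm A (clob X) -> f ∘ g = idm A (clob Y) -> clmor e Y X g.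
Proof.
move=> /clmorP[hf f_] gf fg; apply/clmorP; split; first exact: inverse_homog gf fg.
exact: intertwines_isom f_.
Qed.

Lemma clmor_amp e (X Y : clobj A p) (P Q : O) (t : tensU A U (clob X) P)
    (t' : tensU A U (clob Y) Q) f :
  clmor e X Y f -> clmor e (clU t) (clU t') (amp e t t' f).
Proof.
move=> /clmorP[hf [sz ef]]; apply/clmorP; split; first exact: amp_homog.
apply: intertwines_cat; last first.
  by apply: intertwines_map => j _; apply: amp_ampU2; case: (umx_rel U).
split=> [|i]; first by rewrite !size_map.
case: (ltnP i (size (clgens X))) => li; last first.
  by rewrite !nth_default ?size_map -?sz // comp0l comp0r scaler0.
rewrite !(nth_map 0) -?sz // !amp_comp ef ampZ.
by case: e {hf ef}.
Qed.

End Functoriality.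

Section TensorU.
Variables (k : fieldType) (q : int) (O : mobjects q) (A : monoidal k O).
Variables (p : nat) (U : clmod k p).

Section Morphisms.
Variables (M P N Q L L' : O) (t : tensU A U M P) (t' : tensU A U N Q).

(** The sign of moving f past [tin t x] is the one built into [amp], and the two cancel. *)
Lemma amp_tensU_l_tensl e (f : Mor A L L') : homog e f ->
  amp e (tensU_l L t) (tensU_l L' t) (f ⊠ idm A M) = f ⊠ idm A P.
Proof.
move=> hf; rewrite -(tensU_sum t) /amp /=.
have -> : f ⊠ (\sum_x (tin t x ∘ tpr t x)) = \sum_x (f ⊠ (tin t x ∘ tpr t x)).
  elim/big_rec2: _ => [|x a b _ <-]; first by rewrite tensh0r.
  by rewrite tenshDr.
apply: eq_bigr => x _.
rewrite (tensh_comp _ _ hf (tin_homog t x)) comp1m compm1 compZl signrZK.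
by rewrite (tensh_comp _ _ (idm_even _ _) (tin_homog t x)) scale1r compm1.
Qed.

Lemma amp_tensU_l_tensr e (g : Mor A M N) :
  amp e (tensU_l L t) (tensU_l L t') (idm A L ⊠ g) = idm A L ⊠ amp e t t' g.
Proof.
rewrite /amp; elim/big_rec2: _ => [|x a b _ ->]; first by rewrite tensh0r.
by rewrite /= !tensh1_comp tenshDr tenshZr.
Qed.

Lemma amp_tensU_r_tensl e (f : Mor A M N) :
  amp e (tensU_r t L) (tensU_r t' L) (f ⊠ idm A L) = amp e t t' f ⊠ idm A L.
Proof.
rewrite /amp; elim/big_rec2: _ => [|x a b _ ->]; first by rewrite tensh0l.
by rewrite /= !tensh_comp1 tenshDl tenshZl.
Qed.

Lemma amp_tensU_r_tensr e (g : Mor A L L') : homog e g ->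
  amp e (tensU_r t L) (tensU_r t L') (idm A M ⊠ g) = idm A P ⊠ g.
Proof.
move=> hg; rewrite -(tensU_sum t) /amp /=.
have -> : (\sum_x (tin t x ∘ tpr t x)) ⊠ g = \sum_x ((tin t x ∘ tpr t x) ⊠ g).
  elim/big_rec2: _ => [|x a b _ <-]; first by rewrite tensh0l.
  by rewrite tenshDl.
apply: eq_bigr => x _.
rewrite (tensh_comp _ _ (idm_even _ _) (idm_even _ _)) scale1r comp1m compm1.
rewrite (tensh_comp _ _ (tpr_homog t x) hg) compm1 andbC.
by rewrite signrZK.
Qed.

Lemma ampU_tensU_l (B : 'M[k]_(um U + un U)) :
  ampU (tensU_l L t) B = idm A L ⊠ ampU t B.
Proof.
rewrite /ampU; elim/big_rec2: _ => [|x a b _ ->]; first by rewrite tensh0r.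
rewrite tenshDr; congr (_ + _).
elim/big_rec2: _ => [|y c d _ ->]; first by rewrite tensh0r.
by rewrite /= !tensh1_comp tenshDr tenshZr.
Qed.

Lemma ampU_tensU_r (B : 'M[k]_(um U + un U)) :
  ampU (tensU_r t L) B = ampU t B ⊠ idm A L.
Proof.
rewrite /ampU; elim/big_rec2: _ => [|x a b _ ->]; first by rewrite tensh0l.
rewrite tenshDl; congr (_ + _).
elim/big_rec2: _ => [|y c d _ ->]; first by rewrite tensh0l.
by rewrite /= !tensh_comp1 tenshDl tenshZl.
Qed.

End Morphisms.

Lemma clgens_clifford (X : clobj A p) : clifford (clgens X).
Proof. exact/cliffordP/clrel. Qed.

Lemma clgens_homog (X : clobj A p) f : f \in clgens X -> homog true f.
Proof. by move=> /(allP (proj1 (andP (clgens_clifford X))))/andP[/eqP]. Qed.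

Variable pq : (p%:Z %| q)%Z.

Definition ugens (M P : O) (t : tensU A U M P) : seq (Mor A P P) :=
  [seq ampU t (umx U j) | j <- enum 'I_p].

Lemma clgens_clU_tensU_l (X Y : clobj A p) P (t : tensU A U (clob Y) P) :
  clgens (clU (X := cltens pq X Y) (tensU_l (clob X) t)) =
    clgens (cltens pq X (clU t)).
Proof.
rewrite /= /gensU !map_cat -catA -!map_comp; congr (_ ++ (_ ++ _)).
- by apply/eq_in_map => f /clgens_homog hf /=; apply: amp_tensU_l_tensl.
- by apply: eq_map => f /=; apply: amp_tensU_l_tensr.
by apply: eq_map => j /=; apply: ampU_tensU_l.
Qed.

(** Unlike for [tensU_l], the generators of U stand after those of Y here but before them in the
    tensor product of [clU t] with Y; hence the need for [pass_U]. *)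
Lemma clgens_clU_tensU_r (X Y : clobj A p) P (t : tensU A U (clob X) P) :
  clgens (clU (X := cltens pq X Y) (tensU_r t (clob Y))) =
    [seq amp true t t f ⊠ idm A (clob Y) | f <- clgens X] ++
    [seq idm A P ⊠ g | g <- clgens Y] ++ [seq f ⊠ idm A (clob Y) | f <- ugens t].
Proof.
rewrite /= /gensU !map_cat -catA -!map_comp; congr (_ ++ (_ ++ _)).
- by apply: eq_map => f /=; apply: amp_tensU_r_tensl.
- by apply/eq_in_map => f /clgens_homog hf /=; apply: amp_tensU_r_tensr.
by apply: eq_map => j /=; apply: ampU_tensU_r.
Qed.

End TensorU.

(** * Existence of M ⊗ U in a nice supercategory *)

Section ExistsTensU.
Variables (k : fieldType) (q : int) (O : mobjects q) (A : monoidal k O).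
Hypothesis niceA : nice A.

(** Eversions quantify over all ways to form M ⊗ U without providing one; here it is built from a
    zero object, parity shifts and binary sums. The maps are indexed by all of [I], but are
    orthogonal only on the summands listed in [r]. *)
Lemma nice_sums (I : eqType) (par : I -> bool) (M : O) (r : seq I) : uniq r ->
  exists P (i : I -> Mor A M P) (j : I -> Mor A P M),
    [/\ deg P = deg M, forall x, homog (par x) (i x), forall x, homog (par x) (j x),
        {in r &, forall x y, j x ∘ i y = if x == y then idm A M else 0}
      & \sum_(x <- r) (i x ∘ j x) = idm A P].
Proof.
elim: r => [_|x r IH /= /andP[xr ur]].
  have [Z dZ Z0] := nice_zero niceA (deg M).
  exists Z, (fun _ => 0), (fun _ => 0); split=> // [x|x|].
  - exact: homog0.
  - exact: homog0.
  by rewrite big_nil.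
have [P [i [j [dP hi hj ji ij]]]] := IH ur.
have [N [f [g [dN hf hg [gf fg]]]]] : exists N (f : Mor A M N) (g : Mor A N M),
    [/\ deg N = deg M, homog (par x) f, homog (par x) g
      & g ∘ f = idm A M /\ f ∘ g = idm A N].
  case: (par x); last by exists M, (idm A M), (idm A M); rewrite comp1m; split=> //;
    exact: idm_even.
  have [N [f [dN hf [g [gf fg]]]]] := nice_shift niceA M.
  by exists N, f, g; split=> //; apply: inverse_homog gf fg.
have [S [i1 [i2 [p1 [p2 [dS [h1 h2] [h1' h2'] [e11 e22 e12 e21] sumS]]]]]] :=
  nice_sum niceA (etrans dN (esym dP)).
exists S, (fun y => if y == x then i1 ∘ f else i2 ∘ i y),
  (fun y => if y == x then g ∘ p1 else j y ∘ p2); split=> [|y|y|y z|].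
- by rewrite dS dN.
- by case: eqP => [->|_]; [apply: (comp_homog h1 hf)|apply: (comp_homog h2 (hi y))].
- case: eqP => [->|_].
    by have := comp_homog hg h1'; rewrite addbF.
  by have := comp_homog (hj y) h2'; rewrite addbF.
- rewrite !inE; case: (eqVneq y x) => [->|yx];
  case: (eqVneq z x) => [->|zx] //= yr zr.
  + by rewrite -compA (compA p1) e11 comp1m.
  + by rewrite -compA (compA p1) e12 comp0l comp0r.
  + by rewrite -compA (compA p2) e21 comp0l comp0r (negPf yx).
  by rewrite -compA (compA p2) e22 comp1m ji.
rewrite big_cons eqxx -compA (compA f) fg comp1m -sumS; congr (_ + _).
rewrite big_seq (eq_bigr (fun y => i2 ∘ (i y ∘ j y) ∘ p2)) => [|y yr].
  by rewrite -big_seq -comp_suml -comp_sumr ij compm1.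
have yx : y != x by apply: contraNneq xr => <-.
by rewrite (negPf yx) !compA.
Qed.

Lemma nice_tensU p (U : clmod k p) (M : O) : exists P, inhabited (tensU A U M P).
Proof.
have [P [i [j [dP hi hj ji ij]]]] := nice_sums (@ipar (um U) (un U))
  M (index_enum_uniq _).
exists P; split; apply: (@TensU _ _ _ _ _ U M P i j) => // x y.
by apply: ji; rewrite mem_index_enum.
Qed.

End ExistsTensU.

(** * Eversions and the divisibility of p by 4 *)

Section EversionBasics.
Variables (k : fieldType) (two_neq0 : 2%:R != 0 :> k).
Variables (q : int) (O : mobjects q) (A : monoidal k O).
Variables (p : nat) (pq : (p%:Z %| q)%Z) (U : clmod k p) (E : eversion A pq U).

Local Notation J X Y f := (@evJ _ _ _ _ _ _ _ E X Y f).
Local Notation j X t := (@evj _ _ _ _ _ _ _ E X _ t).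
Local Notation "X ⊙ Y" := (cltens pq X Y) (at level 39, left associativity).

Lemma clmorL e (X Y : clobj A p) c f g :
  clmor e X Y f -> clmor e X Y g -> clmor e X Y (c *: f + g).
Proof.
move=> [sz hf ef] [_ hg eg]; split=> // [|i li].
  by apply: homogD => //; apply: homogZ.
by rewrite compDl compZl compDr compZr ef // eg // !scalerDr !scalerA mulrC.
Qed.

Lemma evJZ e (X Y : clobj A p) c f : clmor e X Y f -> J X Y (c *: f) = c *: J X Y f.
Proof.
move=> hf; have := evJ_linear E (c - 1) hf hf.
by rewrite -[X in J _ _ (_ + X)](scale1r f) -[X in _ = _ + X](scale1r (J X Y f))
  -!scalerDl subrK.
Qed.

Lemma evJ_inj e (X Y : clobj A p) f g : clmor e X Y f -> clmor e X Y g ->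
  J X Y f = J X Y g -> f = g.
Proof.
move=> hf hg fg; apply/eqP; rewrite -subr_eq0 addrC -scaleN1r; apply/eqP.
apply: (@ev_faithful _ _ _ _ _ _ _ E _ _ _ _ (clmorL (-1) hg hf)).
by rewrite (evJ_linear E _ hg hf) fg scaleN1r addNr.
Qed.

Lemma evJ_compE e e' (X Y Z : clobj A p) f g : clmor e X Y f -> clmor e' Y Z g ->
  J Y Z g ∘ J X Y f = J X Z (g ∘ f).
Proof. by move=> hf hg; rewrite (evJ_comp E hf hg). Qed.

Lemma evJ_isom e (X Y : clobj A p) f : clmor e X Y f -> isom f -> isom (J X Y f).
Proof.
move=> hf [g [gf fg]]; have hg := clmor_inv hf gf fg; exists (J Y X g).
by rewrite (evJ_compE hf hg) (evJ_compE hg hf) gf fg !evJ1.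
Qed.

Lemma clmor_tensU_l (X Y : clobj A p) P (t : tensU A U (clob Y) P) :
  clmor false (X ⊙ clU t) (clU (X := X ⊙ Y) (tensU_l (clob X) t))
    (idm A (clob X ⊗ P)).
Proof.
apply/clmorP; split; first exact: idm_even.
by rewrite clgens_clU_tensU_l; apply: intertwines_id.
Qed.

(* The block swap of evj_tens_r, moving the generators of U past those of Y. *)
Definition pass_U (X Y : clobj A p) P (t : tensU A U (clob X) P) :
    Mor A (P ⊗ clob Y) (P ⊗ clob Y) :=
  block_swap (ugens t ◁ clob Y) (P ▷ clgens Y).

Lemma pass_U_gens (X Y : clobj A p) P (t : tensU A U (clob X) P) :
  clifford (([seq amp true t t f | f <- clgens X] ◁ clob Y) ++
            (ugens t ◁ clob Y) ++ (P ▷ clgens Y)).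
Proof. by have := clgens_clifford (clU t ⊙ Y); rewrite /= map_cat -catA. Qed.

Lemma clmor_pass_U (X Y : clobj A p) P (t : tensU A U (clob X) P) :
  clmor (odd (p * size (clgens Y))) (clU t ⊙ Y)
    (clU (X := X ⊙ Y) (tensU_r t (clob Y))) (pass_U Y t).
Proof.
have := pass_U_gens Y t; rewrite clifford_cat => /and3P[_ cl anti].
have sz : (size (ugens t ◁ clob Y) * size (P ▷ clgens Y) = p * size (clgens Y))%N.
  by rewrite !size_map -enumT size_enum_ord.
apply/clmorP; split; first by rewrite -sz; apply: block_swap_homog.
rewrite clgens_clU_tensU_r /= map_cat -catA -map_comp.
apply: (@intertwines_parity _ _ _ _ _ _ _ (size (ugens t ◁ clob Y)
  * size (P ▷ clgens Y))).
  by rewrite sz oddb.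
apply: intertwines_cat; first by rewrite map_comp; apply: block_swap_fix.
exact: block_swap_intertwines.
Qed.

Lemma evj_pass_U (X Y : clobj A p) P (t : tensU A U (clob X) P) :
  J (clU t ⊙ Y) (clU (X := X ⊙ Y) (tensU_r t (clob Y))) (pass_U Y t)
    ∘ (j X t ⊠ idm E Y) =
    j (X ⊙ Y) (tensU_r t (clob Y)).
Proof.
rewrite -(evj_tens_r E Y t) /pass_U /block_swap -map_comp !size_map.
by rewrite -enumT size_enum_ord.
Qed.

Lemma pass_U_isom (X Y : clobj A p) P (t : tensU A U (clob X) P) :
  isom (pass_U Y t).
Proof.
by apply: block_swap_isom => //; have := pass_U_gens Y t;
  rewrite clifford_cat => /and3P[].
Qed.

End EversionBasics.

Section Interchange.
Variables (k : fieldType) (two_neq0 : 2%:R != 0 :> k).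
Variables (q : int) (O : mobjects q) (A : monoidal k O).
Variables (p : nat) (pq : (p%:Z %| q)%Z) (U : clmod k p) (E : eversion A pq U).

Local Notation J X Y f := (@evJ _ _ _ _ _ _ _ E X Y f).
Local Notation j X t := (@evj _ _ _ _ _ _ _ E X _ t).
Local Notation "X ⊙ Y" := (cltens pq X Y) (at level 39, left associativity).

Lemma tensU_joint_epi (M P L : O) (t : tensU A U M P) (f g : Mor A P L) :
  (forall x, f ∘ tin t x = g ∘ tin t x) -> f = g.
Proof.
move=> fg; rewrite -[f]compm1 -[g]compm1 -(tensU_sum t) !comp_sumr.
by apply: eq_bigr => x _; rewrite !compA fg.
Qed.

Lemma amp_tin e (M P N Q : O) (t : tensU A U M P) (t' : tensU A U N Q) f x :
  amp e t t' f ∘ tin t x = (-1) ^+ (e && ipar x) *: (tin t' x ∘ f).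
Proof.
rewrite /amp comp_suml (bigD1 x) //= big1 ?addr0 => [|y yx].
  by rewrite compZl -compA tensU_pi eqxx compm1.
by rewrite compZl -compA tensU_pi (negPf yx) comp0r scaler0.
Qed.

Variables (X Y : clobj A p) (P Q : O).
Variables (t : tensU A U (clob X) P) (t' : tensU A U (clob Y) Q).

(* Flips the two copies of U in (M ⊗ U) ⊗ (N ⊗ U). *)
Definition flip_U : Mor A (P ⊗ Q) (P ⊗ Q) :=
  amp false (tensU_l P t') (tensU_r t Q)
    (amp false (tensU_r t (clob Y)) (tensU_l (clob X) t') (idm A (clob X ⊗ clob Y))).

(** The sign is the Koszul sign for exchanging the two basis vectors of U. *)
Lemma flip_U_tin x y : flip_U ∘ (tin t x ⊠ tin t' y) =
  (-1) ^+ (ipar x && ipar y) *: (tin t y ⊠ tin t' x).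
Proof.
have <- : (-1) ^+ (ipar x && ipar y) *:
    ((idm A P ⊠ tin t' y) ∘ (tin t x ⊠ idm A (clob Y))) = tin t x ⊠ tin t' y.
  by rewrite (tensh_exchange (tin_homog t x) (tin_homog t' y)) signrZK.
rewrite compZr compA; congr (_ *: _).
have /= -> := amp_tin false (tensU_l P t') (tensU_r t Q) _ y; rewrite scale1r -compA.
have /= -> := amp_tin false (tensU_r t (clob Y)) (tensU_l (clob X) t') (idm A _) x.
by rewrite scale1r compm1 -tensh_split.
Qed.

Lemma flip_UK : flip_U ∘ flip_U = idm A (P ⊗ Q).
Proof.
apply: (tensU_joint_epi (t := tensU_l P t')) => y.
apply: (tensU_joint_epi (t := tensU_r t (clob Y))) => x.
rewrite -!compA /= comp1m (tensh_exchange (tin_homog t x) (tin_homog t' y)) !compZr.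
rewrite flip_U_tin compZr flip_U_tin !scalerA andbC -!exprD; congr (_ *: _).
by rewrite (andbC (ipar y)); sign_parity.
Qed.

Lemma flip_U_clmor :
  clmor false (clU (X := clU (X := X ⊙ Y) (tensU_r t (clob Y))) (tensU_l P t'))
    (clU (X := clU (X := X ⊙ Y) (tensU_l (clob X) t')) (tensU_r t Q)) flip_U.
Proof. by do 2!apply: clmor_amp; apply: clmor_id. Qed.

Hypothesis p_even : ~~ odd p.

Let passT : clmor false (clU t ⊙ Y) (clU (X := X ⊙ Y) (tensU_r t (clob Y)))
  (pass_U Y t).
Proof. by have := clmor_pass_U two_neq0 pq Y t; rewrite oddM (negPf p_even). Qed.

(** By the interchange law, the tensor product of the two transition morphisms can be computed in
    either order. Each order amounts to two successive transitions from [X ⊙ Y], with the copies of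
    U attached in different orders, and naturality of the transitions relates these by [flip_U].
    Faithfulness brings the comparison down to A. *)
Lemma flip_U_pass :
  flip_U ∘ amp false (tensU_l P t') (tensU_l P t') (pass_U Y t) = pass_U (clU t') t.
Proof.
pose Z := X ⊙ Y.
pose Z1 : clobj A p := clU (X := Z) (tensU_r t (clob Y)).
pose Z2 : clobj A p := clU (X := Z) (tensU_l (clob X) t').
pose W1 : clobj A p := clU (X := Z1) (tensU_l P t').
pose W2 : clobj A p := clU (X := Z2) (tensU_r t Q).
pose V : clobj A p := clU t ⊙ clU t'.
have tt : (idm E (clU t) ⊠ j Y t') ∘ (j X t ⊠ idm E Y) = j X t ⊠ j Y t'.
  by rewrite (tensh_exchange (evj_even E t) (evj_even E t')) scale1r.
have ampT : clmor false (clU (X := clU t ⊙ Y) (tensU_l P t')) W1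
    (amp false (tensU_l P t') (tensU_l P t') (pass_U Y t)).
  exact: (clmor_amp (X := clU t ⊙ Y) (Y := Z1) (tensU_l P t') (tensU_l P t') passT).
have e1 : j Z1 (tensU_l P t') ∘ j Z (tensU_r t (clob Y)) =
    J V W1 (amp false (tensU_l P t') (tensU_l P t') (pass_U Y t)) ∘ (j X t ⊠ j Y t').
  rewrite -(evj_pass_U E Y t) compA -(evj_nat E (X := clU t ⊙ Y) (Y := Z1)
    (tensU_l P t') (tensU_l P t') passT).
  rewrite -(evj_tens_l E (clU t) t') -!compA tt compA.
  by rewrite (evJ_compE E (clmor_tensU_l pq (clU t) t') ampT) compm1.
have passU : clmor false V (clU (X := X ⊙ clU t') (tensU_r t Q)) (pass_U (clU t') t).
  by have := clmor_pass_U two_neq0 pq (clU t') t; rewrite oddM (negPf p_even).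
have e2 : j Z2 (tensU_r t Q) ∘ j Z (tensU_l (clob X) t') =
    J V W2 (pass_U (clU t') t) ∘ (j X t ⊠ j Y t').
  have idl := clmor_tensU_l pq X t'.
  rewrite -(evj_tens_l E X t') compA -(evj_nat E (X := X ⊙ clU t') (Y := Z2)
    (tensU_r t Q) (tensU_r t Q) idl).
  rewrite -(evj_pass_U E (clU t') t) -!compA -tensh_split compA.
  rewrite (evJ_compE E passU (clmor_amp (X := X ⊙ clU t') (Y := Z2) (tensU_r t Q)
    (tensU_r t Q) idl)).
  by rewrite amp1 comp1m.
have e3 : J W1 W2 flip_U ∘ (j Z1 (tensU_l P t') ∘ j Z (tensU_r t (clob Y))) =
    j Z2 (tensU_r t Q) ∘ j Z (tensU_l (clob X) t').
  have idZ := clmor_id Z.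
  have nat1 := evj_nat E (X := Z) (Y := Z) (tensU_r t (clob Y)) (tensU_l (clob X) t')
    idZ.
  have nat2 := evj_nat E (X := Z1) (Y := Z2) (tensU_l P t') (tensU_r t Q)
    (clmor_amp _ _ idZ).
  by rewrite compA nat2 -compA nat1 evJ1 compm1.
have : J W1 W2 flip_U ∘ J V W1 (amp false (tensU_l P t') (tensU_l P t') (pass_U Y t))
  =
    J V W2 (pass_U (clU t') t).
  apply: (isom_epic (f := j X t ⊠ j Y t')); last by rewrite -compA -e1 e3 e2.
  rewrite tensh_split; apply: isom_comp.
    exact: isom_tensl (evj_iso E t).
  exact: isom_tensr (evj_iso E t').
have ampV : clmor false V W1 (amp false (tensU_l P t') (tensU_l P t') (pass_U Y t)).
  by have := clmor_comp (clmor_tensU_l pq (clU t) t') ampT; rewrite compm1.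
rewrite (evJ_compE E ampV flip_U_clmor); apply: evJ_inj.
  exact: clmor_comp ampV flip_U_clmor.
by have := clmor_comp passU (clmor_amp (X := X ⊙ clU t') (Y := Z2) (tensU_r t Q)
  (tensU_r t Q) (clmor_tensU_l pq X t')); rewrite amp1 comp1m.
Qed.

(** [pass_U (clU t') t] moves U past the generators of Y and then past the second copy of U; the
    first move is the other factor in [flip_U_pass] and cancels. *)
Lemma flip_U_block_swap :
  flip_U = block_swap (ugens t ◁ Q) (P ▷ ugens t').
Proof.
have := flip_U_pass.
have ampT : amp false (tensU_l P t') (tensU_l P t') (pass_U Y t) =
    block_swap (ugens t ◁ Q) (P ▷ [seq amp true t' t' f | f <- clgens Y]).
  have -> : false = odd (size (ugens t ◁ clob Y) * size (P ▷ clgens Y)).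
    by rewrite !size_map -enumT size_enum_ord oddM (negPf p_even).
  rewrite amp_block_swap -!map_comp; congr block_swap.
    by apply: eq_map => i /=; apply: amp_tensU_l_tensl; apply: ampU_homog;
      case: (umx_rel U).
  by apply: eq_map => f /=; apply: amp_tensU_l_tensr.
have cl : clifford ((ugens t ◁ Q) ++ (P ▷ [seq amp true t' t' f | f <- clgens Y])
  ++ (P ▷ ugens t')).
  by have := pass_U_gens pq (clU t') t; rewrite clifford_cat /= map_cat => /and3P[].
rewrite ampT /pass_U /= map_cat block_swap_catr //.
have -> : (-1) ^+ (size (ugens t ◁ Q)
  * size (P ▷ [seq amp true t' t' f | f <- clgens Y]) *
    size (P ▷ ugens t')) = (-1) ^+ 0 :> k.
  apply: sign_eq; rewrite !oddM !size_map -enumT size_enum_ord.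
  by rewrite (negPf p_even).
rewrite scale1r; apply: isom_epic; apply: block_swap_isom => //.
by apply: clifford_subseq cl; rewrite catA prefix_subseq.
Qed.

(* The two sides of the interchange law differ by a block swap of two copies of
   U, whose square is the sign (-1)^(p(p-1)/2), but also by an involution. *)
Lemma flip_U_degenerate : odd 'C(p, 2) -> idm A (P ⊗ Q) = 0.
Proof.
move=> p4; have r2l : intertwines 0 flip_U (P ▷ ugens t') (ugens t ◁ Q).
  rewrite -!map_comp; apply: intertwines_map => i _ /=.
  rewrite -(ampU_tensU_l P t') -(ampU_tensU_r Q t).
  have [uo _ _] := umx_rel U.
  exact: (amp_ampU2 false (tensU_l P t') (tensU_r t Q) _ (uo i)).
have l2r := intertwines_isom flip_UK flip_UK r2l.
have cl : clifford ((ugens t ◁ Q) ++ (P ▷ ugens t')).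
  have := clgens_clifford (clU t ⊙ clU t'); rewrite /= !map_cat.
  apply: clifford_subseq; apply: cat_subseq; exact: suffix_subseq.
(* Pushing the block swap through [flip_U] exchanges its blocks, so the square of [flip_U] is also a
   product of two opposite swaps, which [block_swapK] evaluates. *)
have := block_swap_transport l2r r2l; rewrite -flip_U_block_swap flip_UK scale1r.
rewrite flip_U_block_swap (block_swapK two_neq0 cl).
have -> : (-1) ^+ (size (ugens t ◁ Q) * size (P ▷ ugens t') +
    'C(size (ugens t ◁ Q), 2) * 'C(size (P ▷ ugens t'), 2)) = (-1) ^+ 1 :> k.
  apply: sign_eq; rewrite !size_map -enumT size_enum_ord oddD !oddM p4.
  by rewrite (negPf p_even).
rewrite scaleN1r => /eqP; rewrite -subr_eq0 opprK -mulr2n -scaler_nat.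
by rewrite scaler_eq0 (negPf two_neq0) => /eqP.
Qed.

End Interchange.

Section Level.
Variables (k : fieldType) (two_neq0 : 2%:R != 0 :> k).
Variables (q : int) (O : mobjects q) (A : monoidal k O) (niceA : nice A).
Variables (p : nat) (pq : (p%:Z %| q)%Z) (U : clmod k p) (E : eversion A pq U).

(** Here [pass_U] is odd, so an invertible transition morphism is both even and odd, hence zero. *)
Lemma odd_pass_degenerate (X Y : clobj A p) : odd (p * size (clgens Y)) ->
  idm E (cltens pq X Y) = 0.
Proof.
move=> ps; have [P [t]] := nice_tensU niceA U (clob X).
have := clmor_pass_U two_neq0 pq Y t; rewrite ps => hT.
have hodd := comp_homog (evJ_homog E hT) (tensh_homog (evj_even E t) (idm_even E Y)).
rewrite evj_pass_U // in hodd.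
have [g [<- _]] := evj_iso E (X := cltens pq X Y) (tensU_r t (clob Y)).
by rewrite (homog_unique (evj_even E _) hodd) comp0r.
Qed.

Lemma eversion_level :
  (4 %| p)%N \/ forall X Y : clobjects A pq, idm E (X ⊗ Y) = 0.
Proof.
have [p4|p4] := boolP (4 %| p)%N; [by left | right => X Y].
have [P [t]] := nice_tensU niceA U (clob X).
have [Q [t']] := nice_tensU niceA U (clob Y).
have isoX := isom_tensl (clU t' : clobjects A pq) (evj_iso E t).
have isoY := isom_tensr X (evj_iso E t').
have [p_odd|p_even] := boolP (odd p).
  have [s_odd|s_even] := boolP (odd (size (clgens Y))).
    by apply: odd_pass_degenerate; rewrite oddM p_odd.
  (* Replacing Y by [clU t'] adds p generators, which makes their number odd. *)
  apply: id0_isom isoY _; apply: odd_pass_degenerate.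
  by rewrite oddM size_cat !size_map -enumT size_enum_ord oddD p_odd (negPf s_even).
apply: id0_isom isoY _; apply: id0_isom isoX _.
have PQ0 : idm A (P ⊗ Q) = 0.
  apply: (flip_U_degenerate two_neq0 E t t' p_even).
  (* As p/2 is odd, C(p,2) = (p/2)(p - 1) is odd. *)
  have pE : p = p./2.*2 by rewrite -[LHS]odd_double_half (negPf p_even).
  have m_odd : odd p./2 by move: p4; rewrite pE; lia.
  rewrite pE bin2 -doubleMl doubleK oddM m_odd.
  by move: m_odd; case: (p./2) => //= m _; rewrite odd_double.
have := evJZ E 0 (clmor_id (cltens pq (clU t) (clU t'))).
by rewrite /= PQ0 !scale0r -PQ0 => <-; rewrite evJ1.
Qed.

End Level.

(** * Braidings *)

Section Braidings.
Variables (k : fieldType) (q : int).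

(* Braidings are the case c = false and type II superbraidings the case
   c = true. *)
Record graded_braiding (O : mobjects q) (A : monoidal k O) (c : bool)
    (b : forall X Y : O, Mor A (X ⊗ Y) (Y ⊗ X))
    (u v : Zmodulo q -> Zmodulo q -> Zmodulo q -> k) : Prop := GradedBraiding {
  gb_iso : forall X Y, isom (b X Y);
  gb_homog : forall X Y, homog (c && (degodd X && degodd Y)) (b X Y);
  gb_nat : forall (X X' Y Y' : O) (f : Mor A X X') (g : Mor A Y Y') d d',
    homog d f -> homog d' g ->
    (g ⊠ f) ∘ b X Y =
      (-1) ^+ ((c && (degodd X && degodd Y && (d (+) d'))) (+) (d && d')) *:
        (b X' Y' ∘ (f ⊠ g));
  gb_hex1 : hexagon1 b u;
  gb_hex2 : hexagon2 b v }.

Lemma braidingP (O : mobjects q) (A : monoidal k O)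
    (b : forall X Y : O, Mor A (X ⊗ Y) (Y ⊗ X)) e (w : Bfactor k q e) :
  braiding b w <-> graded_braiding false b (w1 w) (w2 w).
Proof. by split=> -[? ? ? ? ?]; split. Qed.

Lemma superbraidingP (O : mobjects q) (A : monoidal k O)
    (b : forall X Y : O, Mor A (X ⊗ Y) (Y ⊗ X)) e (w : Bfactor k q e) :
  superbraiding b w <-> graded_braiding true b (w1 w) (w2 w).
Proof. by split=> -[? ? ? ? ?]; split. Qed.

Variables (two_neq0 : 2%:R != 0 :> k) (O : mobjects q) (A : monoidal k O).

Lemma intertwines_tensl n (X Y N : O) (f : Mor A X Y) s t :
  intertwines n f s t -> intertwines n (f ⊠ idm A N) (s ◁ N) (t ◁ N).
Proof.
move=> [sz e]; split=> [|i]; first by rewrite !size_map.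
case: (ltnP i (size s)) => li; last first.
  by rewrite !nth_default ?size_map -?sz // comp0l comp0r scaler0.
by rewrite !(nth_map 0) -?sz // !tensh_comp1 e tenshZl.
Qed.

Lemma intertwines_tensr n (X Y N : O) (f : Mor A X Y) s t :
  intertwines n f s t -> intertwines n (idm A N ⊠ f) (N ▷ s) (N ▷ t).
Proof.
move=> [sz e]; split=> [|i]; first by rewrite !size_map.
case: (ltnP i (size s)) => li; last first.
  by rewrite !nth_default ?size_map -?sz // comp0l comp0r scaler0.
by rewrite !(nth_map 0) -?sz // !tensh1_comp e tenshZr.
Qed.

Lemma intertwines_assoc1 (X Y Z : O) (s : seq (Mor A X X)) :
  intertwines 0 (assoc A X Y Z) (s ◁ (Y ⊗ Z)) (s ◁ Y ◁ Z).
Proof.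
rewrite -map_comp; apply: intertwines_map => f _ /=.
by rewrite scale1r -assoc_nat tensh1.
Qed.

Lemma intertwines_assoc2 (X Y Z : O) (s : seq (Mor A Y Y)) :
  intertwines 0 (assoc A X Y Z) (X ▷ (s ◁ Z)) ((X ▷ s) ◁ Z).
Proof.
rewrite -!map_comp; apply: intertwines_map => f _ /=.
by rewrite scale1r -assoc_nat.
Qed.

Lemma intertwines_assoc3 (X Y Z : O) (s : seq (Mor A Z Z)) :
  intertwines 0 (assoc A X Y Z) (X ▷ (Y ▷ s)) ((X ⊗ Y) ▷ s).
Proof.
rewrite -map_comp; apply: intertwines_map => f _ /=.
by rewrite scale1r assoc_nat tensh1.
Qed.

Definition intertwines_associ n (X Y Z : O) s t (h : intertwines n (assoc A X Y Z)
  s t) :=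
  intertwines_isom (assocK A X Y Z) (associK A X Y Z) h.

Variables (c : bool) (b : forall M N : O, Mor A (M ⊗ N) (N ⊗ M)).
Variables u v : Zmodulo q -> Zmodulo q -> Zmodulo q -> k.
Hypothesis braid_b : graded_braiding c b u v.

Lemma gb_natl (M M' N : O) (f : Mor A M M') d : homog d f ->
  (idm A N ⊠ f) ∘ b M N =
    (-1) ^+ [&& c, degodd M && degodd N & d] *: (b M' N ∘ (f ⊠ idm A N)).
Proof.
by move=> hf; rewrite (gb_nat braid_b hf (idm_even A N)) andbF !addbF.
Qed.

Lemma gb_natr (M N N' : O) (g : Mor A N N') d : homog d g ->
  (g ⊠ idm A M) ∘ b M N =
    (-1) ^+ [&& c, degodd M && degodd N & d] *: (b M N' ∘ (idm A M ⊠ g)).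
Proof. by move=> hg; rewrite (gb_nat braid_b (idm_even A M) hg) addbF. Qed.

Definition gb_sign (M N : O) : nat := c && (degodd M && degodd N).

Lemma gb_signC M N : gb_sign M N = gb_sign N M.
Proof. by rewrite /gb_sign (andbC (degodd M)). Qed.

Lemma gb_gensl (M N : O) (s : seq (Mor A M M)) : (forall f, f \in s -> homog true f)
  ->
  intertwines (gb_sign M N) (b M N) (s ◁ N) (N ▷ s).
Proof.
move=> hs; apply: intertwines_map => f /hs hf.
by rewrite (gb_natl N hf) !andbT signrZK.
Qed.

Lemma gb_gensr (M N : O) (s : seq (Mor A N N)) : (forall f, f \in s -> homog true f)
  ->
  intertwines (gb_sign M N) (b M N) (M ▷ s) (s ◁ M).
Proof.
move=> hs; apply: intertwines_map => f /hs hf.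
by rewrite (gb_natr M hf) !andbT signrZK.
Qed.

Lemma exchange_gensl (X Y N : O) (f : Mor A X Y) e (s : seq (Mor A N N)) :
  homog e f -> (forall g, g \in s -> homog true g) ->
  intertwines e (idm A N ⊠ f) (s ◁ X) (s ◁ Y).
Proof.
move=> hf hs; apply: intertwines_map => g /hs hg.
by rewrite (tensh_exchange hg hf) -tensh_split.
Qed.

Lemma exchange_gensr (X Y N : O) (f : Mor A X Y) e (s : seq (Mor A N N)) :
  homog e f -> (forall g, g \in s -> homog true g) ->
  intertwines e (f ⊠ idm A N) (X ▷ s) (Y ▷ s).
Proof.
move=> hf hs; apply: intertwines_map => g /hs hg.
by rewrite -tensh_split (tensh_exchange hf hg) andbT signrZK.
Qed.

Variables (p : nat) (pq : (p%:Z %| q)%Z).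
Local Notation "X ⊙ Y" := (cltens pq X Y) (at level 39, left associativity).
Implicit Types X Y Z : clobj A p.

(* The morphism of A that ev_braid maps to the eversion. *)
Definition clbraid X Y : Mor A (clob X ⊗ clob Y) (clob Y ⊗ clob X) :=
  block_swap (clob Y ▷ clgens X) (clgens Y ◁ clob X) ∘ b (clob X) (clob Y).

Lemma clifford_swapped X Y :
  clifford ((clob Y ▷ clgens X) ++ (clgens Y ◁ clob X)).
Proof. by rewrite clifford_catC; exact: (clgens_clifford (Y ⊙ X)). Qed.

Lemma clbraid_clmor X Y :
  clmor (odd (gb_sign (clob X) (clob Y) + size (clgens X) * size (clgens Y)))
    (X ⊙ Y) (Y ⊙ X) (clbraid X Y).
Proof.
apply/clmorP; split.
  have := comp_homog (block_swap_homog (clifford_swapped X Y)) (gb_homog braid_b _ _).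
  by rewrite oddD oddb addbC !size_map.
apply: intertwines_parity; last first.
  apply: (intertwines_comp _ (block_swap_intertwines two_neq0 (clifford_swapped X
    Y))).
  apply: intertwines_cat; [apply: gb_gensl|apply: gb_gensr]; exact: clgens_homog.
by rewrite oddb !size_map.
Qed.

Lemma clbraid_isom X Y : isom (clbraid X Y).
Proof.
by apply: isom_comp (gb_iso braid_b _ _); apply/block_swap_isom/clifford_swapped.
Qed.

(** The first term of the exponent is the cost of carrying the swap of X and Y through b on X and Z;
    the second comes from rejoining the generators of Y and Z by [block_swap_catr]. *)
Lemma clbraid_hex1 X Y Z :
  (idm A (clob Y) ⊠ clbraid X Z) ∘ associ A (clob Y) (clob X) (clob Z)
    ∘ (clbraid X Y ⊠ idm A (clob Z)) =
  ((-1) ^+ (gb_sign (clob X) (clob Z) * (size (clgens X) * size (clgens Y)) +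
            size (clgens X) * size (clgens Y) * size (clgens Z)) *
     u (deg (clob X)) (deg (clob Y)) (deg (clob Z))) *:
    (associ A (clob Y) (clob Z) (clob X) ∘ clbraid X (Y ⊙ Z)
       ∘ associ A (clob X) (clob Y) (clob Z)).
Proof.
case: X Y Z => [M mu mu_rel mu_lev] [N nu nu_rel nu_lev] [L la la_rel la_lev].
set X := ClObj mu_rel mu_lev; set Y := ClObj nu_rel nu_lev;
  set Z := ClObj la_rel la_lev.
have cl : clifford ((N ▷ (L ▷ mu)) ++ (nu ◁ (L ⊗ M)) ++ (N ▷ (la ◁ M))).
  have := clgens_clifford (Y ⊙ (Z ⊙ X)); rewrite /= map_cat => h.
  by rewrite clifford_catC -catA.
have bML := gb_homog braid_b M L.
have hmu : intertwines (gb_sign M L) ((idm A N ⊠ b M L) ∘ associ A N M L)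
    ((N ▷ mu) ◁ L) (N ▷ (L ▷ mu)).
  apply: (intertwines_comp (intertwines_associ (intertwines_assoc2 N L mu))).
  exact/intertwines_tensr/gb_gensl/(@clgens_homog _ _ _ _ _ X).
have hnu : intertwines (gb_sign M L) ((idm A N ⊠ b M L) ∘ associ A N M L)
    (nu ◁ M ◁ L) (nu ◁ (L ⊗ M)).
  apply: (intertwines_comp (intertwines_associ (intertwines_assoc1 M L nu))).
  by apply: exchange_gensl (@clgens_homog _ _ _ _ _ Y).
have move1 := block_swap_transport hmu hnu.
have move2 := block_swap_transport (intertwines_associ (intertwines_assoc3 N L mu))
  (intertwines_cat (intertwines_associ (intertwines_assoc1 L M nu))
                   (intertwines_associ (intertwines_assoc2 N M la))).
have hex := gb_hex1 braid_b M N L.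
rewrite /clbraid /= -tensh1_comp -tensh_comp1 block_swap_tensr block_swap_tensl
  map_cat.
move: move1 move2 hex; rewrite (block_swap_catr two_neq0 cl) scale1r !size_map.
set S1 := block_swap _ (N ▷ (la ◁ M)); set S2 := block_swap _ (nu ◁ (L ⊗ M)).
set S3 := block_swap _ (nu ◁ M ◁ L); set S4 := block_swap _ (_ ++ _).
set b1 := idm A N ⊠ _; set b2 := b M N ⊠ _; set b3 := b M (N ⊗ L).
set a1 := associ A N M L; set a2 := associ A N L M; set a3 := associ A M N L.
move=> move1 move2 hex.
have -> : S1 ∘ b1 ∘ a1 ∘ (S3 ∘ b2) = S1 ∘ (b1 ∘ a1 ∘ S3) ∘ b2 by rewrite !compA.
have -> : a2 ∘ (S4 ∘ b3) ∘ a3 = a2 ∘ S4 ∘ b3 ∘ a3 by rewrite !compA.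
rewrite move1 move2 compZr !compZl.
have -> : S1 ∘ (S2 ∘ (b1 ∘ a1)) ∘ b2 = S1 ∘ S2 ∘ (b1 ∘ a1 ∘ b2) by rewrite !compA.
rewrite hex compZr !scalerA -!compA mulrAC -exprD; congr (_ * _ *: _).
sign_parity.
Qed.

(** As for the first hexagon, but now the swap of Y and Z is carried through b on X and Z, and the
    generators of X and Y are rejoined by [block_swap_catl]. *)
Lemma clbraid_hex2 X Y Z :
  (clbraid X Z ⊠ idm A (clob Y)) ∘ assoc A (clob X) (clob Z) (clob Y)
    ∘ (idm A (clob X) ⊠ clbraid Y Z) =
  ((-1) ^+ (gb_sign (clob X) (clob Z) * (size (clgens Y) * size (clgens Z)) +
            size (clgens X) * size (clgens Y) *
              (size (clgens Z) + 'C(size (clgens Z), 2))) *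
     v (deg (clob X)) (deg (clob Y)) (deg (clob Z))) *:
    (assoc A (clob Z) (clob X) (clob Y) ∘ clbraid (X ⊙ Y) Z
       ∘ assoc A (clob X) (clob Y) (clob Z)).
Proof.
case: X Y Z => [M mu mu_rel mu_lev] [N nu nu_rel nu_lev] [L la la_rel la_lev].
set X := ClObj mu_rel mu_lev; set Y := ClObj nu_rel nu_lev;
  set Z := ClObj la_rel la_lev.
have cl : clifford ((L ▷ mu ◁ N) ++ ((L ⊗ M) ▷ nu) ++ (la ◁ M ◁ N)).
  have := clgens_clifford (Z ⊙ X ⊙ Y); rewrite /= map_cat -catA => h.
  by rewrite catA clifford_catC.
have bML := gb_homog braid_b M L.
have hnu : intertwines (gb_sign M L) ((b M L ⊠ idm A N) ∘ assoc A M L N)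
    (M ▷ (L ▷ nu)) ((L ⊗ M) ▷ nu).
  apply: (intertwines_comp (intertwines_assoc3 M L nu)).
  by apply: exchange_gensr (@clgens_homog _ _ _ _ _ Y).
have hla : intertwines (gb_sign M L) ((b M L ⊠ idm A N) ∘ assoc A M L N)
    (M ▷ (la ◁ N)) (la ◁ M ◁ N).
  apply: (intertwines_comp (intertwines_assoc2 M N la)).
  exact/intertwines_tensl/gb_gensr/(@clgens_homog _ _ _ _ _ Z).
have move1 := block_swap_transport hnu hla.
have move2 := block_swap_transport
  (intertwines_cat (intertwines_assoc2 L N mu) (intertwines_assoc3 L M nu))
  (intertwines_assoc1 M N la).
have hex := gb_hex2 braid_b M N L.
rewrite /clbraid /= -tensh1_comp -tensh_comp1 block_swap_tensr block_swap_tensl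
  map_cat.
move: move1 move2 hex; rewrite (block_swap_catl two_neq0 cl) scale1r !size_map.
set S1 := block_swap (_ ◁ N) _; set S2 := block_swap _ (la ◁ M ◁ N).
set S3 := block_swap _ (M ▷ _); set S4 := block_swap (_ ++ _) _.
set b1 := _ ⊠ idm A N; set b2 := _ ⊠ b N L; set b3 := b (M ⊗ N) L.
set a1 := assoc A M L N; set a2 := assoc A L M N; set a3 := assoc A M N L.
move=> move1 move2 hex.
have -> : S1 ∘ b1 ∘ a1 ∘ (S3 ∘ b2) = S1 ∘ (b1 ∘ a1 ∘ S3) ∘ b2 by rewrite !compA.
have -> : a2 ∘ (S4 ∘ b3) ∘ a3 = a2 ∘ S4 ∘ b3 ∘ a3 by rewrite !compA.
rewrite move1 move2 compZr !compZl.
have -> : S1 ∘ (S2 ∘ (b1 ∘ a1)) ∘ b2 = S1 ∘ S2 ∘ (b1 ∘ a1 ∘ b2) by rewrite !compA.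
rewrite hex compZr !scalerA -!compA mulrAC -exprD; congr (_ * _ *: _).
sign_parity.
Qed.

Lemma clbraidK X Y (z : Zmodulo q -> Zmodulo q -> k) : involutive_up_to b z ->
  clbraid Y X ∘ clbraid X Y =
    ((-1) ^+ (gb_sign (clob X) (clob Y) * (size (clgens X) * size (clgens Y)) +
              size (clgens X) * size (clgens Y) +
              'C(size (clgens X), 2) * 'C(size (clgens Y), 2)) *
       z (deg (clob X)) (deg (clob Y))) *: idm A (clob X ⊗ clob Y).
Proof.
move=> bK.
have move1 := block_swap_transport
  (gb_gensr (clob Y) (@clgens_homog _ _ _ _ _ X))
  (gb_gensl (clob X) (@clgens_homog _ _ _ _ _ Y)).
have cl : clifford ((clgens X ◁ clob Y) ++ (clob X ▷ clgens Y)).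
  exact: (clgens_clifford (X ⊙ Y)).
rewrite /clbraid -compA [b _ _ ∘ (_ ∘ _)]compA move1 !compZl compZr -compA bK.
rewrite !compZr compm1 (block_swapK two_neq0 cl).
rewrite !scalerA !size_map mulrAC -exprD; congr (_ * _ *: _).
by rewrite gb_signC; sign_parity.
Qed.

Lemma clbraid_natl X X' Y f d : clmor d X X' f ->
  (idm A (clob Y) ⊠ f) ∘ clbraid X Y =
    (-1) ^+ (d * (gb_sign (clob X) (clob Y) + size (clgens X) * size (clgens Y))) *:
      (clbraid X' Y ∘ (f ⊠ idm A (clob Y))).
Proof.
move=> /clmorP[hf if_].
have fmu := intertwines_tensr (clob Y) if_.
have fnu := exchange_gensl hf (@clgens_homog _ _ _ _ _ Y).
rewrite /clbraid compA (block_swap_transport fmu fnu) compZl -compA.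
rewrite (gb_natl _ hf) compZr scalerA -exprD !size_map compA.
congr (_ *: _); apply: sign_eq; rewrite !(oddD, oddM) !oddb.
by case: c; case: (degodd _ && _); case: d {hf if_ fmu fnu}; case: (odd _ && _).
Qed.

Lemma clbraid_natr X Y Y' g d : clmor d Y Y' g ->
  (g ⊠ idm A (clob X)) ∘ clbraid X Y =
    (-1) ^+ (d * (gb_sign (clob X) (clob Y) + size (clgens X) * size (clgens Y))) *:
      (clbraid X Y' ∘ (idm A (clob X) ⊠ g)).
Proof.
move=> /clmorP[hg ig_].
have gnu := intertwines_tensl (clob X) ig_.
have gmu := exchange_gensr hg (@clgens_homog _ _ _ _ _ X).
rewrite /clbraid compA (block_swap_transport gmu gnu) compZl -compA.
rewrite (gb_natr _ hg) compZr scalerA -exprD !size_map compA.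
congr (_ *: _); apply: sign_eq; rewrite !(oddD, oddM) !oddb.
by case: c; case: (degodd _ && _); case: d {hg ig_ gmu gnu}; case: (odd _ && _).
Qed.

End Braidings.

(** * Sizes against degrees, and compatibility of the braiding with U *)

Section SizeParity.
Variables (k : fieldType) (q : int) (O : mobjects q) (A : monoidal k O).
Variables (p : nat) (p4 : (4 %| p)%N).

Lemma zodd_nat n : zodd n%:Z = odd n.
Proof. by []. Qed.

Lemma size_clgens_odd (X : clobj A p) : odd (size (clgens X)) = degodd (clob X).
Proof.
have p2 : (2 %| p%:Z)%Z by rewrite dvdzE /=; move: p4; lia.
by rewrite -zodd_nat -(zodd_mod _ p2) (eqP (cllevel X)) zodd_mod.
Qed.

Lemma size_clgens_binz2 (X : clobj A p) :
  odd 'C(size (clgens X), 2) = zodd (binz2 (zrep (deg (clob X)))).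
Proof.
have p4' : (4 %| p%:Z)%Z by rewrite dvdzE.
rewrite -(zodd_binz2_mod _ p4') -(eqP (cllevel X)) zodd_binz2_mod // -zodd_nat.
congr zodd; have := binz2E (size (clgens X))%:Z.
have : ('C(size (clgens X), 2) * 2 = size (clgens X) * (size (clgens X)).-1)%N.
  rewrite bin2 muln2 even_halfK // oddM.
  by case: (size _) => //= n; rewrite andNb.
by nia.
Qed.

End SizeParity.

Section BraidU.
Variables (k : fieldType) (two_neq0 : 2%:R != 0 :> k).
Variables (q : int) (O : mobjects q) (A : monoidal k O).
Variables (p : nat) (pq : (p%:Z %| q)%Z) (p4 : (4 %| p)%N) (U : clmod k p).
Variables (c : bool) (b : forall M N : O, Mor A (M ⊗ N) (N ⊗ M)).
Variables u v : Zmodulo q -> Zmodulo q -> Zmodulo q -> k.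
Hypothesis braid_b : graded_braiding c b u v.

Local Notation "X ⊙ Y" := (cltens pq X Y) (at level 39, left associativity).

Let p_even : odd p = false.
Proof. by move: p4; lia. Qed.

Let p2_even : odd 'C(p, 2) = false.
Proof.
case/dvdnP: p4 => m ->; have -> : (m * 4 = m.*2.*2)%N by lia.
by rewrite bin2 -doubleMl doubleK oddM odd_double.
Qed.

Section Left.
Variables (X Y : clobj A p) (P : O) (t : tensU A U (clob X) P).

(** Naturality of b for each inclusion of M into M ⊗ U; its sign is the one in [amp]. *)
Lemma amp_gb_l : amp (odd (gb_sign c (clob X) (clob Y))) (tensU_r t (clob Y))
  (tensU_l (clob Y) t)
   (b (clob X) (clob Y)) = b P (clob Y).
Proof.
apply: (tensU_joint_epi (t := tensU_r t (clob Y))) => x.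
rewrite amp_tin /= (gb_natl braid_b _ (tin_homog t x)) oddb.
by rewrite -!andbA signrZK.
Qed.

(** The generators of U, last in [clU t], are cut off by [block_swap_catl], and their swap with
    those of Y is [pass_U] carried through b. Every sign contains the even factor p. *)
Lemma amp_clbraid_l :
  amp (odd (gb_sign c (clob X) (clob Y) + size (clgens X) * size (clgens Y)))
    (tensU_r t (clob Y)) (tensU_l (clob Y) t) (clbraid b X Y) ∘ pass_U Y t =
  clbraid b (clU t) Y.
Proof.
rewrite oddD -(amp_comp _ _ _ (tensU_l (clob Y) t)) amp_gb_l.
have -> : odd (size (clgens X) * size (clgens Y)) =
    odd (size (clob Y ▷ clgens X) * size (clgens Y ◁ clob X)) by rewrite !size_map.
rewrite amp_block_swap -!map_comp.
have -> : [seq (amp true (tensU_l (clob Y) t) (tensU_l (clob Y) t) \o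
      [eta tensh (idm A (clob Y))]) f | f <- clgens X] =
    clob Y ▷ [seq amp true t t f | f <- clgens X].
  by rewrite -map_comp; apply: eq_map => f /=; apply: amp_tensU_l_tensr.
have -> : [seq (amp true (tensU_l (clob Y) t) (tensU_l (clob Y) t) \o
      (tensh^~ (idm A (clob X)))) f | f <- clgens Y] = clgens Y ◁ P.
  by apply/eq_in_map => f /clgens_homog hf /=; apply: amp_tensU_l_tensl.
have hu f : f \in ugens t -> homog true f.
  by move=> /mapP[i _ ->]; apply: ampU_homog; case: (umx_rel U).
have cl : clifford ((clob Y ▷ [seq amp true t t f | f <- clgens X]) ++
    (clob Y ▷ ugens t) ++ (clgens Y ◁ P)).
  by have := clifford_swapped pq (clU t) Y; rewrite /= map_cat -catA.
rewrite /pass_U -compA (block_swap_transport (gb_gensl braid_b (clob Y) hu)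
  (gb_gensr braid_b P (@clgens_homog _ _ _ _ _ Y))).
rewrite compZr /clbraid /= map_cat (block_swap_catl two_neq0 cl) compZl compA.
congr (_ *: _); apply: sign_eq; rewrite !size_map -enumT size_enum_ord.
by rewrite !(oddM, oddD) p_even !(andbF, andFb).
Qed.

End Left.

Section Right.
Variables (X Y : clobj A p) (Q : O) (t : tensU A U (clob Y) Q).

Lemma amp_gb_r : amp (odd (gb_sign c (clob X) (clob Y))) (tensU_l (clob X) t)
  (tensU_r t (clob X))
   (b (clob X) (clob Y)) = b (clob X) Q.
Proof.
apply: (tensU_joint_epi (t := tensU_l (clob X) t)) => x.
rewrite amp_tin /= (gb_natr braid_b _ (tin_homog t x)) oddb.
by rewrite -!andbA signrZK.
Qed.

(** [pass_U] undoes the swap of the generators of X with those of U inside the braiding. By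
    [block_swapK] the resulting sign involves p and C(p,2), and both are even exactly because 4
    divides p. *)
Lemma amp_clbraid_r :
  amp (odd (gb_sign c (clob X) (clob Y) + size (clgens X) * size (clgens Y)))
    (tensU_l (clob X) t) (tensU_r t (clob X)) (clbraid b X Y) =
  pass_U X t ∘ clbraid b X (clU t).
Proof.
rewrite oddD -(amp_comp _ _ _ (tensU_r t (clob X))) amp_gb_r.
have -> : odd (size (clgens X) * size (clgens Y)) =
    odd (size (clob Y ▷ clgens X) * size (clgens Y ◁ clob X)) by rewrite !size_map.
rewrite amp_block_swap -!map_comp.
have -> : [seq (amp true (tensU_r t (clob X)) (tensU_r t (clob X)) \o
      [eta tensh (idm A (clob Y))]) f | f <- clgens X] = Q ▷ clgens X.
  by apply/eq_in_map => f /clgens_homog hf /=; apply: amp_tensU_r_tensr.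
have -> : [seq (amp true (tensU_r t (clob X)) (tensU_r t (clob X)) \o
      (tensh^~ (idm A (clob X)))) f | f <- clgens Y] =
    [seq amp true t t f | f <- clgens Y] ◁ clob X.
  by rewrite -map_comp; apply: eq_map => f /=; apply: amp_tensU_r_tensl.
have cl : clifford ((Q ▷ clgens X) ++ ([seq amp true t t f | f <- clgens Y] ◁ clob X)
  ++
    (ugens t ◁ clob X)).
  by have := clifford_swapped pq X (clU t); rewrite /= map_cat.
have clu : clifford ((Q ▷ clgens X) ++ (ugens t ◁ clob X)).
  by apply: clifford_subseq cl; rewrite subseq_cat2l suffix_subseq.
rewrite /pass_U /clbraid /= map_cat (block_swap_catr two_neq0 cl)
  compZl compZr !compA.
rewrite (block_swapK two_neq0 clu) !compZl comp1m scalerA -exprD.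
rewrite -[LHS]scale1r -[1](expr0 (-1)); congr (_ *: _); apply: sign_eq.
rewrite !size_map -enumT size_enum_ord.
by rewrite !(oddM, oddD) p_even p2_even !(andbF, andFb).
Qed.

End Right.
End BraidU.

(** * The induced braiding on the eversion *)

Section EversionBraiding.
Variables (k : fieldType) (two_neq0 : 2%:R != 0 :> k).
Variables (q : int) (O : mobjects q) (A : monoidal k O).
Variables (p : nat) (pq : (p%:Z %| q)%Z) (p4 : (4 %| p)%N) (U : clmod k p).
Variable E : eversion A pq U.
Variables (c : bool) (b : forall M N : O, Mor A (M ⊗ N) (N ⊗ M)).
Variables u v : Zmodulo q -> Zmodulo q -> Zmodulo q -> k.
Hypothesis braid_b : graded_braiding c b u v.

Local Notation J X Y f := (@evJ _ _ _ _ _ _ _ E X Y f).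
Local Notation j X t := (@evj _ _ _ _ _ _ _ E X _ t).
Local Notation "X ⊙ Y" := (cltens pq X Y) (at level 39, left associativity).
Local Notation beta := (ev_braid E b).

Lemma clmor_tensl d (X X' Y : clobj A p) f :
  clmor d X X' f -> clmor d (X ⊙ Y) (X' ⊙ Y) (f ⊠ idm A (clob Y)).
Proof.
move=> /clmorP[hf if_]; apply/clmorP; split.
  by rewrite -[d]addbF; apply: tensh_homog hf (idm_even _ _).
exact: intertwines_cat (intertwines_tensl _ if_)
  (exchange_gensr hf (@clgens_homog _ _ _ _ _ Y)).
Qed.

Lemma clmor_tensr d (X Y Y' : clobj A p) g :
  clmor d Y Y' g -> clmor d (X ⊙ Y) (X ⊙ Y') (idm A (clob X) ⊠ g).
Proof.
move=> /clmorP[hg ig_]; apply/clmorP; split.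
  exact: tensh_homog (idm_even _ _) hg.
exact: intertwines_cat (exchange_gensl hg (@clgens_homog _ _ _ _ _ X))
  (intertwines_tensr _ ig_).
Qed.

Lemma evJ_tensl d (X X' Y : clobj A p) f : clmor d X X' f ->
  J X X' f ⊠ idm E Y = J (X ⊙ Y) (X' ⊙ Y) (f ⊠ idm A (clob Y)).
Proof. by move=> hf; rewrite -evJ1 (ev_tens E hf (clmor_id Y)). Qed.

Lemma evJ_tensr d (X Y Y' : clobj A p) g : clmor d Y Y' g ->
  idm E X ⊠ J Y Y' g = J (X ⊙ Y) (X ⊙ Y') (idm A (clob X) ⊠ g).
Proof. by move=> hg; rewrite -evJ1 (ev_tens E (clmor_id X) hg). Qed.

Lemma clmor_assoc (X Y Z : clobj A p) :
  clmor false (X ⊙ (Y ⊙ Z)) (X ⊙ Y ⊙ Z) (assoc A (clob X) (clob Y) (clob Z)).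
Proof.
apply/clmorP; split; first exact: assoc_even.
rewrite /= !map_cat -catA; apply: intertwines_cat; first exact: intertwines_assoc1.
apply: intertwines_cat; [exact: intertwines_assoc2 | exact: intertwines_assoc3].
Qed.

Lemma clmor_associ (X Y Z : clobj A p) :
  clmor false (X ⊙ Y ⊙ Z) (X ⊙ (Y ⊙ Z)) (associ A (clob X) (clob Y) (clob Z)).
Proof. exact: clmor_inv (clmor_assoc X Y Z) (assocK _ _ _ _) (associK _ _ _ _). Qed.

Lemma ev_associ (X Y Z : clobj A p) : associ E X Y Z =
  J (X ⊙ Y ⊙ Z) (X ⊙ (Y ⊙ Z)) (associ A (clob X) (clob Y) (clob Z)).
Proof.
apply: (isom_monic (f := assoc E X Y Z)).
  by exists (associ E X Y Z); rewrite assocK associK.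
by rewrite associK ev_assoc (evJ_compE E (clmor_associ X Y Z) (clmor_assoc X Y Z))
  associK evJ1.
Qed.

Lemma ev_braidE (X Y : clobj A p) : beta X Y = J (X ⊙ Y) (Y ⊙ X) (clbraid b X Y).
Proof. by rewrite /ev_braid /clbraid /block_swap !size_map. Qed.

(** A block swap has the parity of the product of the two degrees. Added to the parity of b, it
    turns even braidings into type II superbraidings and conversely. *)
Lemma clbraid_parity (X Y : clobj A p) :
  odd (gb_sign c (clob X) (clob Y) + size (clgens X) * size (clgens Y)) =
  ~~ c && (degodd (clob X) && degodd (clob Y)).
Proof.
rewrite /gb_sign oddD oddM !(size_clgens_odd p4) oddb.
by case: c; rewrite /= ?addbb.
Qed.

Lemma clbraidP (X Y : clobj A p) :
  clmor (~~ c && (degodd (clob X) && degodd (clob Y))) (X ⊙ Y) (Y ⊙ X)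
    (clbraid b X Y).
Proof. rewrite -clbraid_parity; exact: (clbraid_clmor two_neq0 braid_b). Qed.

Lemma ev_braid_homog (X Y : clobjects A pq) :
  homog (~~ c && (degodd X && degodd Y)) (beta X Y).
Proof. by rewrite ev_braidE; apply: evJ_homog (clbraidP X Y). Qed.

Lemma ev_braid_isom (X Y : clobjects A pq) : isom (beta X Y).
Proof.
rewrite ev_braidE; apply: evJ_isom (clbraidP X Y) _.
exact: (clbraid_isom two_neq0 braid_b pq).
Qed.

(** Naturality in one variable, stated for a single morphism: it passes to composites and can be
    cancelled along even isomorphisms that slide, so transition morphisms can be stripped off. *)
Definition slides_l d (X X' : clobjects A pq) (f : Mor E X X') : Prop :=
  forall Y : clobjects A pq, (idm E Y ⊠ f) ∘ beta X Y =
    (-1) ^+ [&& ~~ c, degodd X && degodd Y & d] *: (beta X' Y ∘ (f ⊠ idm E Y)).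

Definition slides_r d (Y Y' : clobjects A pq) (g : Mor E Y Y') : Prop :=
  forall X : clobjects A pq, (g ⊠ idm E X) ∘ beta X Y =
    (-1) ^+ [&& ~~ c, degodd X && degodd Y & d] *: (beta X Y' ∘ (idm E X ⊠ g)).

Lemma evJ_slides_l d (X X' : clobj A p) f : clmor d X X' f -> slides_l d (J X X' f).
Proof.
move=> hf Y; rewrite !ev_braidE (evJ_tensl Y hf) (evJ_tensr Y hf).
rewrite (evJ_compE E (clbraidP X Y) (clmor_tensr Y hf)) (clbraid_natl braid_b Y hf).
rewrite (evJ_compE E (clmor_tensl Y hf) (clbraidP X' Y)).
rewrite (evJZ E _ (clmor_comp (clmor_tensl Y hf) (clbraidP X' Y))).
congr (_ *: _); apply: sign_eq; rewrite oddM clbraid_parity !oddb /=.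
by rewrite andbC -andbA.
Qed.

Lemma evJ_slides_r d (Y Y' : clobj A p) g : clmor d Y Y' g -> slides_r d (J Y Y' g).
Proof.
move=> hg X; rewrite !ev_braidE (evJ_tensl X hg) (evJ_tensr X hg).
rewrite (evJ_compE E (clbraidP X Y) (clmor_tensl X hg)) (clbraid_natr braid_b X hg).
rewrite (evJ_compE E (clmor_tensr X hg) (clbraidP X Y')).
rewrite (evJZ E _ (clmor_comp (clmor_tensr X hg) (clbraidP X Y'))).
congr (_ *: _); apply: sign_eq; rewrite oddM clbraid_parity !oddb /=.
by rewrite andbC -andbA.
Qed.

Let p_even : odd p = false.
Proof. by move: p4; lia. Qed.

Lemma pass_U_even (X Y : clobj A p) P (t : tensU A U (clob X) P) :
  clmor false (clU t ⊙ Y) (clU (X := X ⊙ Y) (tensU_r t (clob Y))) (pass_U Y t).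
Proof. by have := clmor_pass_U two_neq0 pq Y t; rewrite oddM p_even. Qed.

(** Naturality of the transitions is applied to the braiding itself, as a morphism from [X ⊙ Y] to
    [Y ⊙ X]; [amp_clbraid_l] identifies its tensor product with U. *)
Lemma evj_slides_l (X : clobj A p) P (t : tensU A U (clob X) P)
  : slides_l false (j X t).
Proof.
move=> Y; rewrite !andbF scale1r !ev_braidE.
have idl := clmor_tensU_l pq Y t.
have bXY := clbraidP X Y; have bUY := clbraidP (clU t) Y.
have amp_b := clmor_amp (X := X ⊙ Y) (Y := Y ⊙ X) (tensU_r t (clob Y))
  (tensU_l (clob Y) t) bXY.
apply: (isom_monic (evJ_isom E idl (isom_id _ _))).
rewrite !compA (evj_tens_l E Y t).
rewrite -(evj_nat E (X := X ⊙ Y) (Y := Y ⊙ X) (tensU_r t (clob Y)) (tensU_l (clob Y)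
  t) bXY).
rewrite -(evj_pass_U E Y t) compA (evJ_compE E (pass_U_even Y t) amp_b).
rewrite (evJ_compE E bUY idl) comp1m.
by rewrite -clbraid_parity (amp_clbraid_l two_neq0 pq p4 braid_b).
Qed.

Lemma evj_slides_r (Y : clobj A p) Q (t : tensU A U (clob Y) Q)
  : slides_r false (j Y t).
Proof.
move=> X; rewrite !andbF scale1r !ev_braidE.
have idl := clmor_tensU_l pq X t.
have bXY := clbraidP X Y; have bXU := clbraidP X (clU t).
have amp_b := clmor_amp (X := X ⊙ Y) (Y := Y ⊙ X) (tensU_l (clob X) t)
  (tensU_r t (clob X)) bXY.
have pass := pass_U_even X t.
apply: (isom_monic (evJ_isom E pass (pass_U_isom two_neq0 pq X t))).
rewrite !compA (evj_pass_U E X t).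
rewrite -(evj_nat E (X := X ⊙ Y) (Y := Y ⊙ X) (tensU_l (clob X) t)
  (tensU_r t (clob X)) bXY).
rewrite -(evj_tens_l E X t) compA (evJ_compE E idl amp_b) (evJ_compE E bXU pass).
by rewrite compm1 -clbraid_parity (amp_clbraid_r two_neq0 pq p4 braid_b).
Qed.

(** The sign of the second step involves the degree of the middle object, whence the condition on
    degrees. *)
Lemma slides_l_comp d d' (X Y Z : clobjects A pq) (f : Mor E X Y) (g : Mor E Y Z) :
  deg X = deg Y -> slides_l d f -> slides_l d' g -> slides_l (d (+) d') (g ∘ f).
Proof.
move=> XY hf hg W; rewrite -tensh1_comp -compA hf compZr compA hg compZl -compA.
rewrite tensh_comp1 scalerA -exprD; congr (_ *: _); apply: sign_eq.
rewrite oddD !oddb /degodd XY.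
by case: (~~ c); case: (zodd _); case: (zodd _); case: d {hf}; case: d' {hg}.
Qed.

Lemma slides_r_comp d d' (X Y Z : clobjects A pq) (f : Mor E X Y) (g : Mor E Y Z) :
  deg X = deg Y -> slides_r d f -> slides_r d' g -> slides_r (d (+) d') (g ∘ f).
Proof.
move=> XY hf hg W; rewrite -tensh_comp1 -compA hf compZr compA hg compZl -compA.
rewrite tensh1_comp scalerA -exprD; congr (_ *: _); apply: sign_eq.
rewrite oddD !oddb /degodd XY.
by case: (~~ c); case: (zodd _); case: (zodd _); case: d {hf}; case: d' {hg}.
Qed.

Lemma slides_l_cancel d (X Y Z : clobjects A pq) (f : Mor E X Y) (g : Mor E Y Z) :
  isom g -> slides_l false g -> slides_l d (g ∘ f) -> slides_l d f.
Proof.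
move=> ig hg hgf W; apply: (isom_monic (isom_tensr W ig)).
rewrite compA tensh1_comp hgf compZr compA hg !andbF scale1r -compA.
by rewrite tensh_comp1.
Qed.

Lemma slides_r_cancel d (X Y Z : clobjects A pq) (f : Mor E X Y) (g : Mor E Y Z) :
  isom g -> slides_r false g -> slides_r d (g ∘ f) -> slides_r d f.
Proof.
move=> ig hg hgf W; apply: (isom_monic (isom_tensl W ig)).
rewrite compA tensh_comp1 hgf compZr compA hg !andbF scale1r -compA.
by rewrite tensh1_comp.
Qed.

Lemma stage_slides (X X' : clobj A p) (f : Mor E X X') : stage (evj E) f ->
  [/\ deg (clob X') = deg (clob X), isom f, slides_l false f & slides_r false f].
Proof.
elim=> {X' f} [|X' f P t _ [dX iso_f l_f r_f]].
  split=> //; first exact: isom_id.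
    by rewrite -(evJ1 E X); apply: evJ_slides_l (clmor_id X).
  by rewrite -(evJ1 E X); apply: evJ_slides_r (clmor_id X).
split; first by rewrite -dX -(tensU_deg t).
- exact: isom_comp (evj_iso E t) iso_f.
- apply: (@slides_l_comp false false X X' (clU t : clobjects A pq)) l_f _ => //.
  exact: evj_slides_l.
- apply: (@slides_r_comp false false X X' (clU t : clobjects A pq)) r_f _ => //.
  exact: evj_slides_r.
Qed.

Lemma ev_slides d (X Y : clobjects A pq) (f : Mor E X Y) : deg X = deg Y ->
  homog d f -> slides_l d f /\ slides_r d f.
Proof.
move=> XY /(ev_full XY)[X' [Y' [g [h [f0 [sg sh hf0 e]]]]]].
have [dX ig lg rg] := stage_slides sg; have [dY ih lh rh] := stage_slides sh.
have XX' : deg X = deg (X' : clobjects A pq) by rewrite /= dX.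
split.
  apply: (slides_l_cancel ih lh); rewrite e -[d]addFb.
  exact: slides_l_comp XX' lg (evJ_slides_l hf0).
apply: (slides_r_cancel ih rh); rewrite e -[d]addFb.
exact: slides_r_comp XX' rg (evJ_slides_r hf0).
Qed.

Lemma ev_braid_nat (X X' Y Y' : clobjects A pq) (f : Mor E X X') (g : Mor E Y Y')
  d d' :
  homog d f -> homog d' g ->
  (g ⊠ f) ∘ beta X Y =
    (-1) ^+ ((~~ c && (degodd X && degodd Y && (d (+) d'))) (+) (d && d')) *:
      (beta X' Y' ∘ (f ⊠ g)).
Proof.
move=> hf hg.
have [XX'|/(hom_deg f)->] := eqVneq (deg X) (deg X'); last first.
  by rewrite tensh0r tensh0l comp0l comp0r scaler0.
have [YY'|/(hom_deg g)->] := eqVneq (deg Y) (deg Y'); last first.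
  by rewrite tensh0r tensh0l comp0l comp0r scaler0.
have [lf _] := ev_slides XX' hf; have [_ rg] := ev_slides YY' hg.
rewrite tensh_split -compA lf compZr compA rg compZl -compA.
rewrite (tensh_exchange hf hg) compZr !scalerA -!exprD; congr (_ *: _);
  apply: sign_eq.
rewrite !oddD !oddb /degodd XX'.
by case: (~~ c); case: (zodd _); case: (zodd _); case: d {hf lf}; case: d' {hg rg}.
Qed.

(* For c = true the sign D is cancelled by the one that arises when generators
   pass through the odd morphisms b. *)
Definition twist_D (x y : k) : k := if c then y else x * y.

Lemma twist_D_sign m y : twist_D ((-1) ^ m) y = (-1) ^+ (~~ c && zodd m) * y.
Proof. by rewrite /twist_D; case: c; rewrite ?mul1r //= expz_sign. Qed.

(** For either value of [c] these reduce by computation to the components of the products with D and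
    A, or with A alone, so the theorem follows by conversion. *)
Definition ev_w1 r s t : k := twist_D (D_w1 k r s t) (A_w1 k r s t * u r s t).
Definition ev_w2 r s t : k := twist_D (D_w2 k r s t) (A_w2 k r s t * v r s t).
Definition ev_ws (z : Zmodulo q -> Zmodulo q -> k) r s : k :=
  twist_D (D_ws k r s) (A_ws k r s * z r s).

Lemma ev_braid_hex1 : hexagon1 beta ev_w1.
Proof.
move=> X Y Z; rewrite !ev_braidE !ev_associ.
have hXY := clbraidP X Y; have hXZ := clbraidP X Z; have hXYZ := clbraidP X (Y ⊙ Z).
have h1 := clmor_tensl Z hXY; have h2 := clmor_tensr Y hXZ.
rewrite (evJ_tensl Z hXY) (evJ_tensr Y hXZ).
have h3 := clmor_comp (clmor_associ Y X Z) h2.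
have h4 := clmor_comp hXYZ (clmor_associ Y Z X).
rewrite (evJ_compE E (clmor_associ Y X Z) h2) (evJ_compE E h1 h3).
rewrite (evJ_compE E hXYZ (clmor_associ Y Z X)) (evJ_compE E (clmor_associ X Y Z) h4).
rewrite (clbraid_hex1 two_neq0 braid_b pq).
rewrite (evJZ E _ (clmor_comp (clmor_associ X Y Z) h4)); congr (_ *: _).
rewrite /ev_w1 /A_w1 mul1r /D_w1 twist_D_sign; congr (_ * _).
apply: sign_eq; rewrite /gb_sign !(oddD, oddM) !oddb !(size_clgens_odd p4) !zoddM.
by rewrite /degodd; case: (c); case: (zodd _); case: (zodd _); case: (zodd _).
Qed.

Lemma ev_braid_hex2 : hexagon2 beta ev_w2.
Proof.
move=> X Y Z; rewrite !ev_braidE !ev_assoc.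
have hYZ := clbraidP Y Z; have hXZ := clbraidP X Z; have hXYZ := clbraidP (X ⊙ Y) Z.
have h1 := clmor_tensr X hYZ; have h2 := clmor_tensl Y hXZ.
rewrite (evJ_tensr X hYZ) (evJ_tensl Y hXZ).
have h3 := clmor_comp (clmor_assoc X Z Y) h2.
have h4 := clmor_comp hXYZ (clmor_assoc Z X Y).
rewrite (evJ_compE E (clmor_assoc X Z Y) h2) (evJ_compE E h1 h3).
rewrite (evJ_compE E hXYZ (clmor_assoc Z X Y)) (evJ_compE E (clmor_assoc X Y Z) h4).
rewrite (clbraid_hex2 two_neq0 braid_b pq).
rewrite (evJZ E _ (clmor_comp (clmor_assoc X Y Z) h4)); congr (_ *: _).
rewrite /ev_w2 /A_w2 /D_w2 twist_D_sign mulrA; congr (_ * _).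
rewrite expz_sign -exprD; apply: sign_eq.
rewrite /gb_sign !(oddD, oddM) !oddb !(size_clgens_odd p4) (size_clgens_binz2 p4)
  !zoddM.
rewrite /degodd; case: (c); case: (zodd (deg _)); case: (zodd (deg _));
  case: (zodd (deg _));
  by case: (zodd _).
Qed.

Lemma ev_braid_inv z : involutive_up_to b z -> involutive_up_to beta (ev_ws z).
Proof.
move=> bK X Y; rewrite !ev_braidE (evJ_compE E (clbraidP X Y) (clbraidP Y X)).
rewrite (clbraidK two_neq0 braid_b pq X Y bK) (evJZ E _ (clmor_id (X ⊙ Y))) evJ1.
congr (_ *: _); rewrite /ev_ws /A_ws /D_ws twist_D_sign mulrA; congr (_ * _).
rewrite expz_sign -exprD; apply: sign_eq.
rewrite /gb_sign !(oddD, oddM) !oddb !(size_clgens_odd p4) !(size_clgens_binz2 p4)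
  !zoddM.
by rewrite /degodd; case: (c); case: (zodd (deg _)); case: (zodd (deg _)) => /=;
  case: (_ && _).
Qed.

Lemma ev_graded_braiding : graded_braiding (~~ c) beta ev_w1 ev_w2.
Proof.
split; [exact: ev_braid_isom | exact: ev_braid_homog | exact: ev_braid_nat
  | exact: ev_braid_hex1 | exact: ev_braid_hex2].
Qed.

End EversionBraiding.

(** * Vanishing tensor products *)

Section Degenerate.
Variables (k : fieldType) (q : int) (O : mobjects q) (A : monoidal k O).
Hypothesis tens0 : forall X Y : O, idm A (X ⊗ Y) = 0.
Variable b : forall X Y : O, Mor A (X ⊗ Y) (Y ⊗ X).

(** All morphisms out of a tensor product are zero, so each equation holds and 0 is invertible. *)
Lemma degenerate_graded_braiding c u v : graded_braiding c b u v.
Proof.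
have zero (X Y Z : O) (f g : Mor A (X ⊗ Y) Z) : f = g by apply: id0_mor.
split=> [X Y|X Y|X X' Y Y' f g d d' _ _|X Y Z|X Y Z]; try exact: zero.
by exists 0; split; apply: zero.
Qed.

Lemma degenerate_involutive z : involutive_up_to b z.
Proof. by move=> X Y; apply: id0_mor. Qed.

End Degenerate.

Theorem proposition8p9
    (k : fieldType) (char2 : 2%N \notin [pchar k])
    (p : nat) (p_gt0 : (0 < p)%N) (Clp : clifford_is_matrix k p)
    (q : int) (pq : (p%:Z %| q)%Z) (q4 : (4 %| q)%Z)
    (U : clmod k p) (UP : tensor_equivalence U)
    (O : mobjects q) (A : monoidal k O) (niceA : nice A)
    (E : eversion A pq U)
    (b : forall M N : O, Mor A (M ⊗ N) (N ⊗ M)) :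
  ((forall w : Sfactor k q false, symmetry b w ->
      supersymmetry (ev_braid E b) (mulS (D_sys k q4) (mulS (A_sys k q4) w))) /\
   (forall w : Bfactor k q false, braiding b w ->
      superbraiding (ev_braid E b) (mulB (D_B k q4) (mulB (A_B k q4) w)))) /\
  ((forall w : Sfactor k q true, supersymmetry b w ->
      symmetry (ev_braid E b) (mulS (A_sys k q4) w)) /\
   (forall w : Bfactor k q true, superbraiding b w ->
      braiding (ev_braid E b) (mulB (A_B k q4) w))).
Proof.
have two_neq0 : 2%:R != 0 :> k by move: char2; rewrite inE.
have ev_gb c u v : graded_braiding c b u v ->
    graded_braiding (~~ c) (ev_braid E b) (ev_w1 c u) (ev_w2 c v).
  move=> hb; have [p4|tens0] := eversion_level two_neq0 niceA E.
    exact: ev_graded_braiding.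
  exact: degenerate_graded_braiding.
have ev_inv c u v z : graded_braiding c b u v -> involutive_up_to b z ->
    involutive_up_to (ev_braid E b) (ev_ws c z).
  move=> hb hz; have [p4|tens0] := eversion_level two_neq0 niceA E.
    exact: ev_braid_inv hb z hz.
  exact: degenerate_involutive.
split; split=> w.
- move=> [/braidingP hb hz]; split; last exact: ev_inv hb hz.
  exact/superbraidingP/(ev_gb _ _ _ hb).
- by move=> /braidingP hb; apply/superbraidingP/(ev_gb _ _ _ hb).
- move=> [/superbraidingP hb hz]; split; last exact: ev_inv hb hz.
  exact/braidingP/(ev_gb _ _ _ hb).
by move=> /superbraidingP hb; apply/braidingP/(ev_gb _ _ _ hb).
Qed.
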